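(* Let $z_0$ be the initial end-point of $\gamma$ and a ramification point of $g$, and let $n$, $\tilde g$, $g_r$, $h$, $U_0$, $t_j=t_j(t)$, $z_1$, $c=h(z_1)$, $\mathrm{Log}$ and $\mathrm{Log}_1$ be as described in the context. Then for any $t\in U_0$ ($U_0$ being sufficiently small near $z_0$), $$I(t)=R(t)-\sum_{j=0}^{n-1}\Big(\frac jn-\frac12\Big)\tilde g(t_j)+\frac1{2\pi i}\sum_{j=0}^{n-1}\tilde g(t_j)\,\mathrm{Log}_1(c-t_j)-\frac1{2\pi i}\,g_r(t)\,\mathrm{Log}(t-z_0),$$ where $R(t)$ is a function regular (holomorphic) at $z_0$ and $c\neq 0$ is a complex constant.
   Context: $\gamma\subset\mathbb C$ is an oriented piecewise-smooth curve with only transversal self-intersections; outside a finite set of points of $\gamma$ the function $g$ on $\gamma$ is given by analytic continuation of germs of algebraic functions (with branches fixed so that $g$ is single-valued on $\gamma$ outside this finite set), and $g$ has no poles on $\gamma$. For $t\notin\gamma$, $I(t)=\frac1{2\pi i}\int_\gamma\frac{g(z)\,dz}{z-t}$. The point $z_0$ is the starting point of $\gamma$ (the integration direction goes from $z_0$ along $\gamma$), and $\gamma$ passes through $z_0$ only there. The Puiseux series of $g$ at $z_0$ is $g(z)=\sum_{k\ge0}a_k(z-z_0)^{k/n}$. Put $\tilde g(u)=\sum_{k\ge0}a_ku^k$ (holomorphic near $0$), and let $g_r(z)=\sum_{\ell\ge0}a_{n\ell}(z-z_0)^\ell$ be the regular part of $g$ at $z_0$. Let $V_\gamma$ be a small simply-connected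 neighborhood of the part of $\gamma\setminus\{z_0\}$ near $z_0$, and let $h$ be the branch on $V_\gamma$ of the inverse function to $h\mapsto z_0+h^n$ (so $h(z)^n=z-z_0$) for which the branch of $g$ fixed on $\gamma$ near $z_0$ equals $\tilde g(h(z))$. Let $U_0$ be the (simply-connected) part of $V_\gamma$ near $z_0$ lying on the side of $\gamma\setminus\{z_0\}$ in the counter-clockwise direction (with respect to $z_0$) from $\gamma$. For $t\in U_0$ put $t_0=h(t)$ and $t_j=\epsilon^jt_0$, $j=0,\dots,n-1$, $\epsilon=e^{2\pi i/n}$. Fix an arbitrary branch $\mathrm{Log}(t-z_0)$ of $\log(t-z_0)$ on $U_0$ (extended to the adjacent part of $\gamma\setminus\{z_0\}$). Fix $z_1\in\gamma\setminus\{z_0\}$ in the part of $\gamma$ contained in $V_\gamma$, and put $c=h(z_1)$. Let $\mathrm{Log}_1$ be the branch of the logarithm in a small simply-connected neighborhood $V$ of $c$ with $\mathrm{Log}_1(c)=\frac1n\mathrm{Log}(z_1-z_0)$; $t$ is taken so close to $z_0$ that $c-t_j(t)\in V$ for all $j$. *)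

(* Defs.v *)
From Stdlib Require Export Reals List.
From Coquelicot Require Export Coquelicot.
Open Scope R_scope.

Definition Cexp (z : C) : C :=
  (exp (Re z) * cos (Im z), exp (Re z) * sin (Im z)).

Definition two_pi_i : C := (RtoC (2 * PI) * Ci)%C.

Definition rotate (z0 : C) (alpha : R) (z : C) : C :=
  (z0 + Cexp (RtoC alpha * Ci) * (z - z0))%C.

(* Coquelicot's total operators [Series] and [Derive] are real-valued, hence
   the componentwise definitions of [Cpseries] and [Cderive]. *)
Definition Cpseries (a : nat -> C) (u : C) : C :=
  (Series (fun k => Re (a k * u ^ k)%C), Series (fun k => Im (a k * u ^ k)%C)).

Definition convergent_near_0 (a : nat -> C) : Prop :=
  exists rho : R, 0 < rho /\ forall u : C, Cmod u < rho -> ex_pseries a u.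

Definition holomorphic_at (f : C -> C) (z0 : C) : Prop :=
  exists r : R, 0 < r /\ forall z : C, Cmod (z - z0) < r -> ex_derive f z.

Definition continuous_in (D : C -> Prop) (f : C -> C) : Prop :=
  forall z : C, D z -> filterlim f (within D (locally z)) (locally (f z)).

Definition log_branch (D : C -> Prop) (L : C -> C) : Prop :=
  continuous_in D L /\ forall w : C, D w -> Cexp (L w) = w.

(* If [L c] is prescribed to be [Log (z1 - z0) / n], where [c ^ n = z1 - z0]
   and [Log] is an arbitrary branch, then [exp (L c)] is [c] only up to an n-th
   root of unity.  So [L] is a branch of the logarithm up to an additive
   constant, the constant [0] being the case of a genuine branch. *)
Definition log_branch_upto_constant (D : C -> Prop) (L : C -> C) : Prop :=
  exists kappa : C, log_branch D (fun w => L w - kappa)%C.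

Definition root_branch (n : nat) (z0 : C) (D : C -> Prop) (h : C -> C) : Prop :=
  continuous_in D h /\ forall z : C, D z -> (h z ^ n = z - z0)%C.

(* Paths and homotopies are defined on all of [R] and [R * R]; only their
   restrictions to [0,1] and [0,1]^2 matter. *)
Definition simply_connected (D : C -> Prop) : Prop :=
  (exists z : C, D z) /\
  (forall x y : C, D x -> D y ->
     exists p : R -> C, (forall s, continuous p s) /\ p 0 = x /\ p 1 = y /\
       forall s, 0 <= s <= 1 -> D (p s)) /\
  (forall p : R -> C, (forall s, continuous p s) -> p 0 = p 1 ->
     (forall s, 0 <= s <= 1 -> D (p s)) ->
     exists H : R * R -> C, (forall q, continuous H q) /\
       (forall s, 0 <= s <= 1 -> H (s, 0) = p s) /\
       (forall s, 0 <= s <= 1 -> H (s, 1) = H (0, 1)) /\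
       (forall x, 0 <= x <= 1 -> H (0, x) = H (1, x)) /\
       (forall s x, 0 <= s <= 1 -> 0 <= x <= 1 -> D (H (s, x)))).

(* [p] is a C^1 extension of [gamma] restricted to [a,b]. *)
Definition smooth_arc (gamma : R -> C) (a b : R) : Prop :=
  exists p dp : R -> C,
    (forall s, is_derive p s (dp s)) /\ (forall s, continuous dp s) /\
    (forall s, a <= s <= b -> p s = gamma s /\ dp s <> 0%C).

Definition piecewise_smooth (gamma : R -> C) : Prop :=
  exists (N : nat) (x : nat -> R),
    x 0%nat = 0 /\ x N = 1 /\
    forall i, (i < N)%nat -> x i < x (S i) /\ smooth_arc gamma (x i) (x (S i)).

(* [Im (Cconj v * v')] is the determinant of [(v, v')].  The condition bears on
   the points where both strands have a tangent line. *)
Definition transversal_self_intersections (gamma : R -> C) : Prop :=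
  forall (s s' : R) (v v' : C),
    0 < s -> s < s' -> s' < 1 -> gamma s = gamma s' ->
    is_derive gamma s v -> is_derive gamma s' v' -> Im (Cconj v * v')%C <> 0.

Definition Cderive (gamma : R -> C) (s : R) : C :=
  (Derive (fun x => Re (gamma x)) s, Derive (fun x => Im (gamma x)) s).

(* The values of the integrand at the finitely many corners are irrelevant. *)
Definition contour_integral (gamma : R -> C) (f : C -> C) : C :=
  @RInt C_R_CompleteNormedModule
    (fun s => f (gamma s) * Cderive gamma s)%C 0 1.

Definition cauchy_integral (gamma : R -> C) (g : C -> C) (t : C) : C :=
  (/ two_pi_i * contour_integral gamma (fun z => g z / (z - t)))%C.

(* [f] is holomorphic and algebraic on the disc of centre [z] and radius [r]. *)
Definition algebraic_germ (f : C -> C) (z : C) (r : R) : Prop :=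
  (forall w, Cmod (w - z) < r -> ex_derive f w) /\
  exists (d e : nat) (P : nat -> nat -> C),
    (exists i j, (i <= d)%nat /\ (j <= e)%nat /\ P i j <> 0%C) /\
    forall w, Cmod (w - z) < r ->
      sum_n (fun i => sum_n (fun j => P i j * w ^ i * f w ^ j)%C e) d = RtoC 0.

(* The germs at nearby parameters coincide on a piece of the curve, so they are
   analytic continuations of each other along it.  A germ is attached to a
   parameter and not to a point: strands of the curve that meet at a point may
   carry different germs there. *)
Definition algebraic_on_curve (gamma : R -> C) (g : C -> C) : Prop :=
  exists exceptional : list C, forall s, 0 <= s <= 1 ->
    ~ In (gamma s) exceptional ->
    exists (f : C -> C) (r : R), 0 < r /\ algebraic_germ f (gamma s) r /\
      locally s (fun s' => 0 <= s' <= 1 -> g (gamma s') = f (gamma s')).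

(* Along the part of the curve described by the filter [F], [g] is the sum of a
   Puiseux series at [z] without negative powers; [u] is the branch of
   [(z' - z)^(1/m)] along the curve. *)
Definition puiseux_along (F : (R -> Prop) -> Prop)
    (gamma : R -> C) (g : C -> C) (z : C) : Prop :=
  exists (m : nat) (b : nat -> C) (u : R -> C),
    (0 < m)%nat /\ convergent_near_0 b /\
    F (fun s => continuous u s /\ (u s ^ m = gamma s - z)%C /\
                g (gamma s) = Cpseries b (u s)).

Definition no_poles_on_curve (gamma : R -> C) (g : C -> C) : Prop :=
  (forall s, 0 <= s < 1 -> puiseux_along (at_right s) gamma g (gamma s)) /\
  (forall s, 0 < s <= 1 -> puiseux_along (at_left s) gamma g (gamma s)).

Definition initial_part (gamma : R -> C) (eta : R) (z : C) : Prop :=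
  exists s, 0 < s < eta /\ z = gamma s.

(* The points reached from the initial part of [gamma] by a path in [Vg] that
   leaves [gamma] counter-clockwise with respect to [gamma 0] and does not meet
   it again.  Near [gamma 0] the distance to [gamma 0] is strictly increasing
   along [gamma], so that [(sigma, alpha)], with [alpha] in ]0, 2 pi[, are
   coordinates on the complement of [gamma]. *)
Definition ccw_side (gamma : R -> C) (eta : R) (Vg : C -> Prop) (t : C) : Prop :=
  exists sigma alpha : R -> R,
    (forall x, continuous sigma x) /\ (forall x, continuous alpha x) /\
    alpha 0 = 0 /\
    (forall x, 0 < x <= 1 -> 0 < alpha x < 2 * PI) /\
    (forall x, 0 <= x <= 1 -> 0 < sigma x < eta /\
       Vg (rotate (gamma 0) (alpha x) (gamma (sigma x)))) /\
    t = rotate (gamma 0) (alpha 1) (gamma (sigma 1)).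

(* Main.v *)
Require Import Defs.
From Stdlib Require Import Lra Lia.
Open Scope R_scope.

(** Near [z0] the curve is uniformized by [z = z0 + w ^ n]: in the parameter
    [x = s ^ (1 / n)] the branch [h] becomes a C^1 path [Q] from [0] to a point
    [Q b] ([root_parametrization]), and with [t_j = eps ^ j * h t] partial fractions give
    [dz / (z - t) = sum_j dw / (w - t_j)].  The remaining part of the curve stays
    away from [z0], and its contribution is analytic at [z0]
    ([far_cauchy_integral]).  Hence, up to an analytic function of [t], the
    contour integral is the sum over [j] of the integrals of
    [gt w / (w - t_j)] along [Q] ([uniformized_cauchy_integral]), and each of them is
    [G t_j + gt t_j * K t_j], where [G] integrates the divided difference
    [(gt w - gt v) / (w - v)] and is analytic, and [K v] is the integral of
    [dw / (w - v)], a logarithm of [(Q b - v) / (- v)].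

    Which logarithm this is follows from continuity alone.  Write
    [v = exp (i * beta / n) * Q x] with [beta] in ]0, 2 pi n[.  Then [v] never lies
    on [Q]: the modulus is strictly increasing along [Q], so that [v = Q y] would
    force [y = x] and [exp (i * beta / n) = 1].  The expression
    [K v - log (1 - v / Q b) + (i * beta + Log (Q x ^ n)) / n] is therefore
    continuous on a connected set of pairs [(x, beta)], and the exponential of
    [n] times it is constant; so it is a constant [M] ([arc_logarithm]).  A point
    [t] of the counter-clockwise side with angle [alpha] in ]0, 2 pi[ corresponds to
    the [n] values [beta = alpha + 2 pi j], and by continuity
    [h t = exp (i * alpha / n) * Q x] and
    [Log (t - z0) = i * alpha + Log (Q x ^ n)] ([ccw_side_branches]).  This gives
    the terms [- (j / n) * gt t_j] and [- Log (t - z0) * gt t_j / (2 pi i n)], and,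
    the constant [M] being the same for all [j], [M * gt t_j].

    The sum over [j] of [F t_j] is analytic in [t] at [z0] for every
    convergent power series [F], since only the exponents divisible by [n] survive
    ([Cpseries_average]).  Applied to [gt] this turns the sum of the [gt t_j] into
    [n * gr t]; applied to the other summands it makes them part of the regular
    term, [M * gt t_j] included.  The summand [gt u * Log1 (c - u)] is treated in the
    same way, a continuous logarithm being analytic ([log_branch_series]). *)

(** * The complex exponential *)

Ltac Cring :=
  match goal with |- @eq _ ?a ?b => change (@eq C a b); ring end.

Ltac Cfield :=
  match goal with |- @eq _ ?a ?b => change (@eq C a b); field end.

Lemma C_ext (z w : C) : Re z = Re w -> Im z = Im w -> z = w.
Proof. destruct z, w; simpl; intros; subst; reflexivity. Qed.

Lemma Cexp_plus (z w : C) : Cexp (z + w) = (Cexp z * Cexp w)%C.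
Proof.
  apply C_ext; unfold Cexp, Re, Im; simpl; rewrite exp_plus, ?cos_plus, ?sin_plus; ring.
Qed.

Lemma Cexp_0 : Cexp 0 = 1%C.
Proof. apply C_ext; unfold Cexp, Re, Im; simpl; rewrite exp_0, ?cos_0, ?sin_0; ring. Qed.

Lemma Cexp_opp (z : C) : (Cexp z * Cexp (- z))%C = 1%C.
Proof. rewrite <- Cexp_plus, Cplus_opp_r. apply Cexp_0. Qed.

Lemma Cexp_nz (z : C) : Cexp z <> 0%C.
Proof.
  intros H. assert (E := Cexp_opp z). rewrite H, Cmult_0_l in E.
  apply C1_nz. symmetry. exact E.
Qed.

Lemma Cexp_opp_inv (z : C) : Cexp (- z) = (/ Cexp z)%C.
Proof.
  assert (E := Cexp_opp z). assert (N := Cexp_nz z).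
  replace (Cexp (- z)) with ((/ Cexp z) * (Cexp z * Cexp (- z)))%C by (field; exact N).
  rewrite E. ring.
Qed.

Lemma Cexp_pow (z : C) (k : nat) : (Cexp z ^ k)%C = Cexp (RtoC (INR k) * z).
Proof.
  induction k as [|k IH].
  - simpl. rewrite Cmult_0_l, Cexp_0. reflexivity.
  - rewrite Cpow_S, IH, <- Cexp_plus, S_INR, RtoC_plus. f_equal. ring.
Qed.

Lemma Cmod_Cexp (z : C) : Cmod (Cexp z) = exp (Re z).
Proof.
  unfold Cmod, Cexp; simpl.
  replace (_ + _) with (exp (Re z) ^ 2).
  - rewrite sqrt_pow2; [reflexivity | left; apply exp_pos].
  - assert (H := sin2_cos2 (Im z)). unfold Rsqr in H.
    transitivity (exp (Re z) ^ 2 * (sin (Im z) * sin (Im z) + cos (Im z) * cos (Im z)));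
      [rewrite H | ]; ring.
Qed.

Lemma Cexp_rotation (x : R) : Cexp (RtoC x * Ci) = (cos x, sin x).
Proof.
  apply C_ext; unfold Cexp, Re, Im; simpl;
    replace (x * 0 - 0 * 1) with 0 by ring; replace (x * 1 + 0 * 0) with x by ring;
    rewrite exp_0; ring.
Qed.

Lemma Cmod_rotation (x : R) : Cmod (Cexp (RtoC x * Ci)) = 1.
Proof.
  rewrite Cmod_Cexp; simpl. replace (_ - _) with 0 by ring. apply exp_0.
Qed.

Lemma rotation_neq_1 (x : R) : 0 < x < 2 * PI -> Cexp (RtoC x * Ci) <> 1%C.
Proof.
  intros Hx E. rewrite Cexp_rotation in E.
  apply (f_equal Re) in E; simpl in E.
  assert (S : 0 < sin (x / 2)) by (apply sin_gt_0; lra).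
  replace x with (2 * (x / 2)) in E by field.
  rewrite cos_2a_sin in E. nra.
Qed.

(** The kernel of the exponential is discrete, which is what makes continuous
    logarithms unique. *)
Lemma Cexp_eq_1_small (z : C) : Cexp z = 1%C -> Cmod z < 1 -> z = 0%C.
Proof.
  intros E Hz.
  assert (R0 : Re z = 0).
  { assert (M := f_equal Cmod E). rewrite Cmod_Cexp, Cmod_1 in M.
    rewrite <- exp_0 in M. apply exp_inv in M. exact M. }
  assert (I1 : Rabs (Im z) < 1).
  { apply Rle_lt_trans with (2 := Hz).
    eapply Rle_trans; [apply Rmax_r | apply Rmax_Cmod]. }
  assert (P := PI2_1).
  apply Rabs_def2 in I1.
  assert (Z : z = (RtoC (Im z) * Ci)%C).
  { apply C_ext; simpl; rewrite ?R0; ring. }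
  destruct (Rtotal_order (Im z) 0) as [N | [N | N]].
  - exfalso. apply (rotation_neq_1 (Im z + 2 * PI)); [lra|].
    rewrite Cexp_rotation. rewrite Z, Cexp_rotation in E.
    rewrite cos_plus, sin_plus, cos_2PI, sin_2PI.
    rewrite <- E. apply C_ext; simpl; ring.
  - apply C_ext; simpl; assumption.
  - exfalso. apply (rotation_neq_1 (Im z)); [lra|]. rewrite <- Z. exact E.
Qed.

Lemma two_pi_i_neq_0 : two_pi_i <> 0%C.
Proof.
  unfold two_pi_i. apply Cmult_neq_0; [|exact Ci_nz].
  intros H. apply RtoC_inj in H. assert (P := PI_RGT_0). lra.
Qed.

(** * Continuity of complex-valued functions *)

Local Notation Ccontinuous := (@continuous R_UniformSpace C_UniformSpace).

(** The uniform structure of [C] is that of a product, with squares for balls, and the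
    modulus is equivalent to the maximum of the coordinates. *)
Lemma locally_Cmod (z : C) (P : C -> Prop) :
  @locally C_UniformSpace z P <->
  exists d : R, 0 < d /\ forall y : C, Cmod (y - z) < d -> P y.
Proof.
  split.
  - intros [d Hd]. exists d. split; [apply cond_pos|].
    intros y Hy. apply Hd. apply C_NormedModule_mixin_compat1. exact Hy.
  - intros [d [Hd H]].
    assert (S : 0 < d / sqrt 2).
    { apply Rdiv_lt_0_compat; [exact Hd|]. apply sqrt_lt_R0. lra. }
    exists (mkposreal _ S). intros y Hy. apply H.
    apply C_NormedModule_mixin_compat2 in Hy. simpl in Hy.
    replace (sqrt 2 * (d / sqrt 2)) with d in Hy.
    + exact Hy.
    + field. apply Rgt_not_eq, sqrt_lt_R0. lra.
Qed.

Lemma locally_Rabs (x : R) (P : R -> Prop) :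
  locally x P <-> exists d : R, 0 < d /\ forall y : R, Rabs (y - x) < d -> P y.
Proof.
  split.
  - intros [d Hd]. exists d. split; [apply cond_pos|]. exact Hd.
  - intros [d [Hd H]]. exists (mkposreal _ Hd). exact H.
Qed.

Lemma filterlim_Cmod {T : Type} (F : (T -> Prop) -> Prop) {FF : Filter F}
    (f : T -> C) (l : C) :
  filterlim f F (@locally C_UniformSpace l) <->
  forall e : R, 0 < e -> F (fun y => Cmod (f y - l) < e).
Proof.
  split.
  - intros H e He. apply (H (fun z => Cmod (z - l) < e)).
    apply locally_Cmod. exists e. split; [exact He|]. auto.
  - intros H P HP. apply locally_Cmod in HP. destruct HP as [d [Hd HP]].
    unfold filtermap. generalize (H d Hd). apply filter_imp. intros y. apply HP.
Qed.

Lemma continuous_Cmod {U : UniformSpace} (f : U -> C) (x : U) :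
  @continuous U C_UniformSpace f x <->
  forall e : R, 0 < e -> locally x (fun y => Cmod (f y - f x) < e).
Proof. apply (filterlim_Cmod (locally x)). Qed.

Lemma continuous_Re {U : UniformSpace} (f : U -> C) (x : U) :
  @continuous U C_UniformSpace f x -> continuous (fun y => Re (f y)) x.
Proof.
  intros H. apply (continuous_comp f Re); [exact H|].
  apply continuous_fst.
Qed.

Lemma continuous_Im {U : UniformSpace} (f : U -> C) (x : U) :
  @continuous U C_UniformSpace f x -> continuous (fun y => Im (f y)) x.
Proof.
  intros H. apply (continuous_comp f Im); [exact H|].
  apply continuous_snd.
Qed.

Lemma continuous_C {U : UniformSpace} (f : U -> C) (x : U) :
  continuous (fun y => Re (f y)) x -> continuous (fun y => Im (f y)) x ->
  @continuous U C_UniformSpace f x.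
Proof.
  intros H1 H2.
  apply (continuous_ext (fun y => (Re (f y), Im (f y)) : C)).
  - intros y. symmetry. apply surjective_pairing.
  - apply filterlim_locally. intros e.
    assert (A := proj1 (filterlim_locally _ _) H1 e).
    assert (B := proj1 (filterlim_locally _ _) H2 e).
    generalize (filter_and _ _ A B). apply filter_imp. intros y Hy. exact Hy.
Qed.

Lemma continuous_Cplus {U : UniformSpace} (f g : U -> C) (x : U) :
  @continuous U C_UniformSpace f x -> @continuous U C_UniformSpace g x ->
  @continuous U C_UniformSpace (fun y => f y + g y)%C x.
Proof.
  intros Hf Hg. apply continuous_C; simpl;
    apply (continuous_plus (V := R_NormedModule));
    auto using continuous_Re, continuous_Im.
Qed.

Lemma continuous_Copp {U : UniformSpace} (f : U -> C) (x : U) :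
  @continuous U C_UniformSpace f x ->
  @continuous U C_UniformSpace (fun y => - f y)%C x.
Proof.
  intros Hf. apply continuous_C; simpl;
    apply (continuous_opp (V := R_NormedModule));
    auto using continuous_Re, continuous_Im.
Qed.

Lemma continuous_Cminus {U : UniformSpace} (f g : U -> C) (x : U) :
  @continuous U C_UniformSpace f x -> @continuous U C_UniformSpace g x ->
  @continuous U C_UniformSpace (fun y => f y - g y)%C x.
Proof. intros Hf Hg. apply continuous_Cplus, continuous_Copp; assumption. Qed.

Lemma continuous_Cmult {U : UniformSpace} (f g : U -> C) (x : U) :
  @continuous U C_UniformSpace f x -> @continuous U C_UniformSpace g x ->
  @continuous U C_UniformSpace (fun y => f y * g y)%C x.
Proof.
  intros Hf Hg.
  apply continuous_C; simpl;
    [apply (continuous_minus (V := R_NormedModule)) | apply (continuous_plus (V := R_NormedModule))];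
    apply (continuous_mult (K := R_AbsRing)); auto using continuous_Re, continuous_Im.
Qed.

Lemma continuous_Cinv {U : UniformSpace} (f : U -> C) (x : U) :
  @continuous U C_UniformSpace f x -> f x <> 0%C ->
  @continuous U C_UniformSpace (fun y => / f y)%C x.
Proof.
  intros Hf N.
  assert (D : Re (f x) ^ 2 + Im (f x) ^ 2 <> 0).
  { rewrite <- Cmod2_alt. apply Cmod_gt_0 in N. nra. }
  assert (Hr := continuous_Re _ _ Hf). assert (Hi := continuous_Im _ _ Hf).
  assert (Hd : continuous (fun y => / (Re (f y) ^ 2 + Im (f y) ^ 2)) x).
  { apply (continuous_comp (fun y => Re (f y) ^ 2 + Im (f y) ^ 2) Rinv).
    - apply (continuous_ext (fun y => Re (f y) * Re (f y) + Im (f y) * Im (f y))).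
      { intros y. simpl. ring. }
      apply (continuous_plus (V := R_NormedModule));
      apply (continuous_mult (K := R_AbsRing)); assumption.
    - apply continuous_Rinv. exact D. }
  apply continuous_C; simpl; apply (continuous_mult (K := R_AbsRing)); try exact Hd.
  - exact Hr.
  - apply (continuous_opp (V := R_NormedModule)). exact Hi.
Qed.

Lemma continuous_Cdiv {U : UniformSpace} (f g : U -> C) (x : U) :
  @continuous U C_UniformSpace f x -> @continuous U C_UniformSpace g x -> g x <> 0%C ->
  @continuous U C_UniformSpace (fun y => f y / g y)%C x.
Proof. intros. apply continuous_Cmult; [|apply continuous_Cinv]; assumption. Qed.

Lemma continuous_Cconst {U : UniformSpace} (c : C) (x : U) :
  @continuous U C_UniformSpace (fun _ => c) x.
Proof. apply continuous_const. Qed.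

Lemma continuous_Cpow {U : UniformSpace} (f : U -> C) (k : nat) (x : U) :
  @continuous U C_UniformSpace f x ->
  @continuous U C_UniformSpace (fun y => f y ^ k)%C x.
Proof.
  intros Hf. induction k as [|k IH]; simpl.
  - apply continuous_Cconst.
  - apply continuous_Cmult; assumption.
Qed.

Lemma continuous_RtoC {U : UniformSpace} (f : U -> R) (x : U) :
  continuous f x -> @continuous U C_UniformSpace (fun y => RtoC (f y)) x.
Proof. intros H. apply continuous_C; simpl; [exact H | apply continuous_const]. Qed.

Lemma continuous_Cexp {U : UniformSpace} (f : U -> C) (x : U) :
  @continuous U C_UniformSpace f x ->
  @continuous U C_UniformSpace (fun y => Cexp (f y)) x.
Proof.
  intros Hf. apply continuous_C; simpl; apply (continuous_mult (K := R_AbsRing)).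
  1, 3: apply continuous_comp; [apply continuous_Re, Hf | apply continuous_exp].
  - apply (continuous_comp _ cos); [apply continuous_Im, Hf | apply continuous_cos].
  - apply (continuous_comp _ sin); [apply continuous_Im, Hf | apply continuous_sin].
Qed.

Lemma locally_neq {U : UniformSpace} (f : U -> C) (x : U) (c : C) :
  @continuous U C_UniformSpace f x -> f x <> c -> locally x (fun y => f y <> c).
Proof.
  intros Hf N.
  assert (P : 0 < Cmod (f x - c)) by (apply Cmod_gt_0, Cminus_eq_contra, N).
  generalize (proj1 (continuous_Cmod f x) Hf _ P). apply filter_imp.
  intros y Hy E. rewrite E in Hy.
  replace (c - f x)%C with (- (f x - c))%C in Hy by ring.
  rewrite Cmod_opp in Hy. lra.
Qed.

(** * Uniqueness of continuous logarithms and roots along a path *)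

Definition clamp (a b x : R) : R := Rmax a (Rmin b x).

Lemma clamp_range (a b x : R) : a <= b -> a <= clamp a b x <= b.
Proof.
  intros. unfold clamp, Rmax, Rmin; repeat destruct Rle_dec; lra.
Qed.

Lemma clamp_id (a b x : R) : a <= x <= b -> clamp a b x = x.
Proof.
  intros. unfold clamp, Rmax, Rmin; repeat destruct Rle_dec; lra.
Qed.

Lemma clamp_lipschitz (a b x y : R) :
  a <= b -> Rabs (clamp a b x - clamp a b y) <= Rabs (x - y).
Proof.
  intros. unfold clamp, Rmax, Rmin, Rabs; repeat destruct Rle_dec;
    repeat destruct Rcase_abs; lra.
Qed.

Lemma continuous_clamp (a b x : R) : a <= b -> continuous (clamp a b) x.
Proof.
  intros H. apply filterlim_locally. intros e. apply locally_Rabs.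
  exists e. split; [apply cond_pos|]. intros y Hy.
  apply Rle_lt_trans with (2 := Hy). apply clamp_lipschitz, H.
Qed.

Lemma locally_constant_C (f : R -> C) :
  (forall x, locally x (fun y => f y = f x)) -> f 0 = f 1.
Proof.
  intros H.
  apply (eq_is_derive (V := C_R_NormedModule) f 0 1); [|lra].
  intros t _.
  apply (is_derive_ext_loc (V := C_R_NormedModule) (fun _ => f t)).
  - generalize (H t). apply filter_imp. intros y ->. reflexivity.
  - apply (is_derive_const (V := C_R_NormedModule)).
Qed.

(** A continuous path with values in a uniformly discrete set is constant: it is
    locally constant, hence has derivative [0]. *)
Lemma continuous_discrete (f : R -> C) (e : R) :
  0 < e -> (forall x, 0 <= x <= 1 -> Ccontinuous f x) ->
  (forall x y, 0 <= x <= 1 -> 0 <= y <= 1 -> Cmod (f x - f y) < e -> f x = f y) ->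
  f 0 = f 1.
Proof.
  intros He Hc Hd.
  assert (E : f (clamp 0 1 0) = f (clamp 0 1 1)); [|rewrite !clamp_id in E by lra; exact E].
  apply (locally_constant_C (fun x => f (clamp 0 1 x))).
  intros x.
  assert (C : Ccontinuous (fun y => f (clamp 0 1 y)) x).
  { apply (continuous_comp (V := R_UniformSpace) (W := C_UniformSpace) (clamp 0 1) f).
    - apply continuous_clamp; lra.
    - apply Hc, clamp_range; lra. }
  generalize (proj1 (continuous_Cmod _ _) C _ He). apply filter_imp.
  intros y. apply Hd; apply clamp_range; lra.
Qed.

Lemma continuous_log_unique (f : R -> C) (k : C) :
  (forall x, 0 <= x <= 1 -> Ccontinuous f x) ->
  (forall x, 0 <= x <= 1 -> Cexp (f x) = k) -> f 0 = f 1.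
Proof.
  intros Hc He. apply continuous_discrete with 1; [lra | exact Hc |].
  intros x y Hx Hy Hxy.
  apply Ceq_minus. apply Cexp_eq_1_small; [|exact Hxy].
  unfold Cminus. rewrite Cexp_plus, (He x Hx), <- (He y Hy). apply Cexp_opp.
Qed.

Lemma Cpow_minus_1_bound (w : C) (i : nat) :
  Cmod w = 1 -> Cmod (w ^ i - 1) <= INR i * Cmod (w - 1).
Proof.
  intros Hw. induction i as [|i IH].
  - replace (w ^ 0 - 1)%C with (RtoC 0) by (simpl; ring). rewrite Cmod_0. simpl. lra.
  - rewrite Cpow_S.
    replace (w * w ^ i - 1)%C with (w * (w ^ i - 1) + (w - 1))%C by ring.
    eapply Rle_trans; [apply Cmod_triangle|].
    rewrite Cmod_mult, Hw, S_INR. lra.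
Qed.

Lemma sum_n_C_S (f : nat -> C) (m : nat) : sum_n f (S m) = (sum_n f m + f (S m))%C.
Proof. rewrite sum_Sn. reflexivity. Qed.

Lemma sum_n_C_minus (f g : nat -> C) (m : nat) :
  sum_n (fun i => f i - g i)%C m = (sum_n f m - sum_n g m)%C.
Proof.
  induction m as [|m IH]; [rewrite !sum_O; reflexivity|].
  rewrite !sum_n_C_S, IH. Cring.
Qed.

Lemma sum_n_C_plus (f g : nat -> C) (m : nat) :
  sum_n (fun i => f i + g i)%C m = (sum_n f m + sum_n g m)%C.
Proof.
  induction m as [|m IH]; [rewrite !sum_O; reflexivity|].
  rewrite !sum_n_C_S, IH. Cring.
Qed.

Lemma sum_n_C_mult_l (c : C) (f : nat -> C) (m : nat) :
  sum_n (fun i => c * f i)%C m = (c * sum_n f m)%C.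
Proof.
  induction m as [|m IH]; [rewrite !sum_O; reflexivity|].
  rewrite !sum_n_C_S, IH. Cring.
Qed.

Lemma sum_n_C_const (c : C) (m : nat) :
  sum_n (fun _ => c) m = (RtoC (INR (S m)) * c)%C.
Proof.
  induction m as [|m IH].
  - rewrite sum_O. simpl INR. Cring.
  - rewrite sum_n_C_S, IH, (S_INR (S m)), RtoC_plus. Cring.
Qed.

Lemma Cmod_sum_n_le (f : nat -> C) (g : nat -> R) (m : nat) :
  (forall i, (i <= m)%nat -> Cmod (f i) <= g i) -> Cmod (sum_n f m) <= sum_n g m.
Proof.
  induction m as [|m IH]; intros H.
  - rewrite !sum_O. auto.
  - rewrite sum_n_C_S, sum_Sn. unfold plus; simpl.
    eapply Rle_trans; [apply Cmod_triangle|]. apply Rplus_le_compat; auto.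
Qed.

Lemma geometric_sum_C (w : C) (m : nat) :
  (sum_n (fun i => w ^ i) m * (w - 1))%C = (w ^ S m - 1)%C.
Proof.
  induction m as [|m IH].
  - rewrite sum_O. simpl. Cring.
  - rewrite sum_n_C_S, Cmult_plus_distr_r, IH. rewrite !Cpow_S. Cring.
Qed.

(** If [w <> 1] the geometric sum [1 + w + ... + w ^ (n - 1)] vanishes, whereas all
    its terms are close to [1] when [w] is. *)
Lemma root_of_unity_isolated (n : nat) (w : C) :
  (0 < n)%nat -> Cmod w = 1 -> (w ^ n)%C = 1%C -> Cmod (w - 1) < / INR n -> w = 1%C.
Proof.
  intros Hn Hw E Hs. destruct n as [|m]; [lia|]. clear Hn.
  assert (P : 0 < INR (S m)) by (apply lt_0_INR; lia).
  destruct (Ceq_dec w 1) as [D|D]; [exact D|exfalso].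
  assert (G := geometric_sum_C w m). rewrite E in G.
  replace (1 - 1)%C with (RtoC 0) in G by ring.
  assert (Z : sum_n (fun i => w ^ i)%C m = RtoC 0).
  { destruct (Ceq_dec (sum_n (fun i => w ^ i)%C m) (RtoC 0)) as [Z|Z]; [exact Z|].
    exfalso. apply (Cmult_neq_0 _ _ Z (Cminus_eq_contra _ _ D)). exact G. }
  assert (B : Cmod (sum_n (fun i => w ^ i - 1)%C m)
      <= sum_n (fun _ => INR (S m) * Cmod (w - 1)) m).
  { apply Cmod_sum_n_le. intros i Hi.
    eapply Rle_trans; [apply Cpow_minus_1_bound, Hw|].
    apply Rmult_le_compat_r; [apply Cmod_ge_0|]. apply le_INR. lia. }
  rewrite (sum_n_C_minus (fun i => w ^ i)%C (fun _ => RtoC 1)), Z, sum_n_C_const, sum_n_const in B.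
  replace (0 - RtoC (INR (S m)) * 1)%C with (- RtoC (INR (S m)))%C in B by ring.
  rewrite Cmod_opp, Cmod_R, Rabs_pos_eq in B by lra.
  assert (L : INR (S m) * Cmod (w - 1) < 1).
  { apply Rmult_lt_compat_l with (1 := P) in Hs.
    rewrite Rinv_r in Hs by lra. exact Hs. }
  nra.
Qed.

Lemma pow_eq_1 (x : R) (n : nat) : (0 < n)%nat -> 0 <= x -> x ^ n = 1 -> x = 1.
Proof.
  intros Hn Hx E. destruct (Rtotal_order x 1) as [L|[L|L]]; [|exact L|]; exfalso.
  - assert (H := pow_lt_1_compat x n (conj Hx L) Hn). lra.
  - assert (H := Rlt_pow_R1 x n L Hn). lra.
Qed.

(** Quotients of values of [f] are [n]-th roots of unity, and these are isolated. *)
Lemma continuous_root_unique (n : nat) (f : R -> C) (k : C) :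
  (0 < n)%nat -> k <> 0%C ->
  (forall x, 0 <= x <= 1 -> Ccontinuous f x) ->
  (forall x, 0 <= x <= 1 -> (f x ^ n)%C = k) -> f 0 = f 1.
Proof.
  intros Hn Hk Hc Hf.
  assert (N : forall x, 0 <= x <= 1 -> f x <> 0%C).
  { intros x Hx E. apply Hk. rewrite <- (Hf x Hx), E.
    destruct n; [lia|]. rewrite Cpow_S. ring. }
  assert (Q : forall x y, 0 <= x <= 1 -> 0 <= y <= 1 -> ((f x / f y) ^ n)%C = 1%C).
  { intros x y Hx Hy. unfold Cdiv.
    rewrite Cpow_mult_l, Cpow_inv by auto.
    rewrite !Hf by assumption. apply Cinv_r, Hk. }
  assert (M : forall x y, 0 <= x <= 1 -> 0 <= y <= 1 -> Cmod (f x / f y) = 1).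
  { intros x y Hx Hy. apply pow_eq_1 with n; [exact Hn | apply Cmod_ge_0 |].
    rewrite <- Cmod_pow, Q by assumption. apply Cmod_1. }
  assert (P : 0 < / INR n) by (apply Rinv_0_lt_compat, lt_0_INR; exact Hn).
  assert (P0 : 0 < Cmod (f 0)) by (apply Cmod_gt_0, N; lra).
  apply continuous_discrete with (/ INR n * Cmod (f 0)); [nra | exact Hc |].
  intros x y Hx Hy Hxy.
  assert (E : (f x / f y)%C = 1%C).
  { apply root_of_unity_isolated with n; auto.
    replace (f x / f y - 1)%C with ((f x - f y) / f y)%C by (field; auto).
    rewrite Cmod_div by auto.
    assert (My : Cmod (f y) = Cmod (f 0)).
    { assert (M0 := M y 0 Hy ltac:(lra)). rewrite Cmod_div in M0 by (apply N; lra).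
      apply (f_equal (fun r => r * Cmod (f 0))) in M0.
      field_simplify in M0; [exact M0 | lra]. }
    rewrite My. apply Rmult_lt_reg_r with (1 := P0).
    replace (Cmod (f x - f y) / Cmod (f 0) * Cmod (f 0)) with (Cmod (f x - f y))
      by (field; lra). exact Hxy. }
  replace (f x) with ((f x / f y) * f y)%C by (field; auto).
  rewrite E. ring.
Qed.

(** * Roots of unity *)

Lemma sum_n_C_0 (f : nat -> C) (m : nat) :
  (forall i, (0 < i <= m)%nat -> f i = 0%C) -> sum_n f m = f 0%nat.
Proof.
  induction m as [|m IH]; intros H; [apply sum_O|].
  rewrite sum_n_C_S, IH, (H (S m)) by (intros; auto; try apply H; lia). Cring.
Qed.

Definition root_of_unity (n : nat) : C := Cexp (two_pi_i / RtoC (INR n)).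

Lemma INR_C_neq_0 (n : nat) : (0 < n)%nat -> RtoC (INR n) <> 0%C.
Proof.
  intros H E. apply RtoC_inj in E. apply lt_0_INR in H. lra.
Qed.

Lemma root_of_unity_pow (n k : nat) : (0 < n)%nat ->
  (root_of_unity n ^ k)%C = Cexp (RtoC (2 * PI * INR k / INR n) * Ci).
Proof.
  intros H. unfold root_of_unity. rewrite Cexp_pow. f_equal. unfold two_pi_i.
  rewrite RtoC_div by (apply lt_0_INR in H; lra).
  rewrite (RtoC_mult _ (INR k)). field. apply INR_C_neq_0, H.
Qed.

Lemma root_of_unity_pow_n (n : nat) : (0 < n)%nat -> (root_of_unity n ^ n)%C = 1%C.
Proof.
  intros H. rewrite root_of_unity_pow by exact H.
  replace (2 * PI * INR n / INR n) with (2 * PI)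
    by (field; apply lt_0_INR in H; lra).
  rewrite Cexp_rotation, cos_2PI, sin_2PI. reflexivity.
Qed.

Lemma root_of_unity_pow_multiple (n l : nat) : (0 < n)%nat ->
  (root_of_unity n ^ (n * l))%C = 1%C.
Proof.
  intros H. rewrite Cpow_mult_r, root_of_unity_pow_n by exact H. apply Cpow_1_l.
Qed.

Lemma root_of_unity_pow_neq_1 (n k : nat) : (0 < n)%nat -> ~ Nat.divide n k ->
  (root_of_unity n ^ k)%C <> 1%C.
Proof.
  intros H D.
  assert (E := Nat.div_mod_eq k n).
  assert (L := Nat.mod_upper_bound k n ltac:(lia)).
  assert (P : (0 < k mod n)%nat).
  { destruct (k mod n) eqn:Z; [|lia]. exfalso. apply D.
    exists (k / n)%nat. lia. }
  rewrite E, Cpow_add_r, root_of_unity_pow_multiple, Cmult_1_l by exact H.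
  rewrite root_of_unity_pow by exact H. apply rotation_neq_1.
  apply lt_INR in L. apply lt_0_INR in P, H. assert (P' := PI_RGT_0).
  split.
  - apply Rdiv_lt_0_compat; [|exact H]. nra.
  - apply Rmult_lt_reg_r with (INR n); [exact H|].
    unfold Rdiv. rewrite Rmult_assoc, Rinv_l by lra. nra.
Qed.

(** Orthogonality of the characters of the group of [n]-th roots of unity: this
    sum, together with its vanishing for the other exponents, selects the
    multiples of [n]. *)
Lemma root_of_unity_sum_multiple (m l : nat) :
  sum_n (fun j => (root_of_unity (S m) ^ j) ^ (S m * l))%C m = RtoC (INR (S m)).
Proof.
  rewrite (sum_n_ext _ (fun _ => RtoC 1)).
  - rewrite sum_n_C_const. Cring.
  - intros j. rewrite <- Cpow_mult_r, Nat.mul_comm, <- Nat.mul_assoc.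
    apply root_of_unity_pow_multiple. lia.
Qed.

Lemma root_of_unity_sum_0 (m k : nat) : ~ Nat.divide (S m) k ->
  sum_n (fun j => (root_of_unity (S m) ^ j) ^ k)%C m = RtoC 0.
Proof.
  intros D.
  rewrite (sum_n_ext _ (fun j => (root_of_unity (S m) ^ k) ^ j)%C).
  2: { intros j. rewrite <- !Cpow_mult_r. f_equal. lia. }
  assert (N := root_of_unity_pow_neq_1 (S m) k ltac:(lia) D).
  assert (G := geometric_sum_C (root_of_unity (S m) ^ k) m).
  rewrite <- Cpow_mult_r, Nat.mul_comm, root_of_unity_pow_multiple in G by lia.
  replace (1 - 1)%C with (RtoC 0) in G by ring.
  destruct (Ceq_dec (sum_n (fun j => (root_of_unity (S m) ^ k) ^ j)%C m) (RtoC 0)) as [Z|Z];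
    [exact Z|exfalso].
  exact (Cmult_neq_0 _ _ Z (Cminus_eq_contra _ _ N) G).
Qed.

Lemma Cpow_sub_factor (w x : C) (m : nat) :
  ((w - x) * sum_n (fun i => w ^ (m - i) * x ^ i) m)%C = (w ^ S m - x ^ S m)%C.
Proof.
  induction m as [|m IH].
  - rewrite sum_O. simpl. Cring.
  - rewrite sum_n_C_S.
    rewrite (sum_n_ext_loc _ (fun i => w * (w ^ (m - i) * x ^ i))%C).
    2: { intros i Hi. replace (S m - i)%nat with (S (m - i)) by lia.
         rewrite Cpow_S. Cring. }
    rewrite sum_n_C_mult_l.
    transitivity (w * ((w - x) * sum_n (fun i => w ^ (m - i) * x ^ i) m)
      + (w - x) * x ^ S m)%C.
    + rewrite Nat.sub_diag. simpl (w ^ 0)%C. Cring.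
    + rewrite IH, !Cpow_S. Cring.
Qed.

(** The [n]-th roots of [u ^ n] are the simple poles of
    [n * w ^ (n - 1) / (w ^ n - u ^ n)], all with residue 1. *)
Lemma partial_fractions_root (m : nat) (w u : C) :
  (w ^ S m)%C <> (u ^ S m)%C ->
  sum_n (fun j => / (w - root_of_unity (S m) ^ j * u))%C m =
  (RtoC (INR (S m)) * w ^ m / (w ^ S m - u ^ S m))%C.
Proof.
  intros N.
  assert (P : forall j, ((root_of_unity (S m) ^ j * u) ^ S m)%C = (u ^ S m)%C).
  { intros j. rewrite Cpow_mult_l, <- Cpow_mult_r, Nat.mul_comm.
    rewrite root_of_unity_pow_multiple by lia. Cring. }
  assert (D := Cminus_eq_contra _ _ N).
  rewrite (sum_n_ext _ (fun j => / (w ^ S m - u ^ S m) *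
    sum_n (fun i => w ^ (m - i) * u ^ i * (root_of_unity (S m) ^ j) ^ i) m)%C).
  - rewrite sum_n_C_mult_l.
    rewrite (sum_n_switch (fun j i => w ^ (m - i) * u ^ i * (root_of_unity (S m) ^ j) ^ i)%C).
    rewrite (sum_n_ext _ (fun i => (w ^ (m - i) * u ^ i) *
       sum_n (fun j => (root_of_unity (S m) ^ j) ^ i) m)%C).
    2: { intros i. apply sum_n_C_mult_l. }
    rewrite sum_n_C_0.
    + rewrite (sum_n_ext _ (fun _ => RtoC 1)), sum_n_C_const by reflexivity.
      rewrite Nat.sub_0_r. simpl (u ^ 0)%C. unfold Cdiv. Cring.
    + intros i Hi. rewrite root_of_unity_sum_0; [Cring|].
      intros [c Hc]. destruct c; lia.
  - intros j. set (x := (root_of_unity (S m) ^ j * u)%C) in *.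
    rewrite (sum_n_ext _ (fun i => w ^ (m - i) * x ^ i)%C).
    2: { intros i. unfold x. rewrite Cpow_mult_l. Cring. }
    assert (F := Cpow_sub_factor w x m).
    assert (Px : (x ^ S m = u ^ S m)%C) by apply P. rewrite Px in F.
    assert (X : (w - x)%C <> 0%C).
    { intros E. apply D. rewrite <- F, E. apply Cmult_0_l. }
    rewrite <- F in D |- *. set (s := sum_n _ m) in *. change C in (type of s).
    match goal with |- @eq _ ?a ?b => change (@eq C a b) end.
    field. split; [|exact X]. intros E. apply D. rewrite E. Cring.
Qed.

(** * Complex power series *)

(** Convergence is expressed by real and imaginary parts because [Cpseries] is
    built from the sums of two real series. *)
Definition Cser (c : nat -> C) (S : C) : Prop :=
  is_series (fun k => Re (c k)) (Re S) /\ is_series (fun k => Im (c k)) (Im S).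

Lemma Cser_ext (c d : nat -> C) (S : C) :
  (forall k, c k = d k) -> Cser c S -> Cser d S.
Proof.
  intros E [H1 H2]. split.
  - apply is_series_ext with (2 := H1). intros k. rewrite E. reflexivity.
  - apply is_series_ext with (2 := H2). intros k. rewrite E. reflexivity.
Qed.

Lemma Cpseries_unique (a : nat -> C) (u S : C) :
  Cser (fun k => a k * u ^ k)%C S -> Cpseries a u = S.
Proof.
  intros [H1 H2]. unfold Cpseries.
  rewrite (is_series_unique _ _ H1), (is_series_unique _ _ H2).
  destruct S; reflexivity.
Qed.

Lemma Cser_plus (c d : nat -> C) (S T : C) :
  Cser c S -> Cser d T -> Cser (fun k => c k + d k)%C (S + T)%C.
Proof.
  intros [H1 H2] [K1 K2]. split.
  - apply (is_series_plus _ _ _ _ H1 K1).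
  - apply (is_series_plus _ _ _ _ H2 K2).
Qed.

Lemma Cser_mult_l (z : C) (c : nat -> C) (S : C) :
  Cser c S -> Cser (fun k => z * c k)%C (z * S)%C.
Proof.
  intros [H1 H2].
  assert (A := fun x l s H => is_series_scal (K := R_AbsRing) (V := R_NormedModule) x l s H).
  split; simpl.
  - apply (is_series_minus _ _ _ _ (A (Re z) _ _ H1) (A (Im z) _ _ H2)).
  - apply (is_series_plus _ _ _ _ (A (Re z) _ _ H2) (A (Im z) _ _ H1)).
Qed.

Lemma Cser_minus (c d : nat -> C) (S T : C) :
  Cser c S -> Cser d T -> Cser (fun k => c k - d k)%C (S - T)%C.
Proof.
  intros [H1 H2] [K1 K2]. split.
  - apply (is_series_minus _ _ _ _ H1 K1).
  - apply (is_series_minus _ _ _ _ H2 K2).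
Qed.

Lemma Cser_incr (c : nat -> C) (S : C) :
  Cser (fun k => c (Datatypes.S k)) S -> Cser c (c 0%nat + S)%C.
Proof.
  intros [H1 H2]. split; simpl.
  - replace (fst (c 0%nat) + fst S) with (plus (Re S) (Re (c 0%nat))) by apply Rplus_comm.
    apply (is_series_decr_1 (K := R_AbsRing) (V := R_NormedModule) (fun k => Re (c k))).
    replace (plus _ _) with (Re S); [exact H1|].
    unfold plus, opp; simpl; ring.
  - replace (snd (c 0%nat) + snd S) with (plus (Im S) (Im (c 0%nat))) by apply Rplus_comm.
    apply (is_series_decr_1 (K := R_AbsRing) (V := R_NormedModule) (fun k => Im (c k))).
    replace (plus _ _) with (Im S); [exact H2|].
    unfold plus, opp; simpl; ring.
Qed.

Lemma Rabs_Re_le (z : C) : Rabs (Re z) <= Cmod z.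
Proof. eapply Rle_trans; [apply Rmax_l | apply Rmax_Cmod]. Qed.

Lemma Rabs_Im_le (z : C) : Rabs (Im z) <= Cmod z.
Proof. eapply Rle_trans; [apply Rmax_r | apply Rmax_Cmod]. Qed.

Lemma Cser_dominated (a : nat -> C) (u : C) (M : nat -> R) :
  (forall k, Cmod (a k * u ^ k) <= M k) -> ex_series M ->
  Cser (fun k => a k * u ^ k)%C (Cpseries a u).
Proof.
  intros H E.
  split; apply Series_correct;
  apply (ex_series_le (K := R_AbsRing) (V := R_CompleteNormedModule)) with (2 := E);
  intros k; (eapply Rle_trans; [|apply H]); [apply Rabs_Re_le | apply Rabs_Im_le].
Qed.

Lemma Re_le_Cmod (z : C) : Re z <= Cmod z.
Proof. eapply Rle_trans; [apply Rle_abs | apply Rabs_Re_le]. Qed.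

Lemma is_series_le_R (f g : nat -> R) (l m : R) :
  (forall k, f k <= g k) -> is_series f l -> is_series g m -> l <= m.
Proof.
  intros H Hf Hg.
  apply (is_lim_seq_le (sum_n f) (sum_n g) l m); [|exact Hf|exact Hg].
  intros n. apply sum_n_m_le. exact H.
Qed.

(** Rotating the sum onto the positive real axis reduces the triangle
    inequality for series to the comparison of two real series. *)
Lemma Cser_Cmod_le (c : nat -> C) (S : C) (M : nat -> R) (B : R) :
  (forall k, Cmod (c k) <= M k) -> is_series M B -> Cser c S -> Cmod S <= B.
Proof.
  intros H HM HS.
  destruct (Ceq_dec S 0) as [->|N].
  - rewrite Cmod_0.
    apply (is_series_le_R (fun _ => 0) M).
    + intros k. eapply Rle_trans; [apply Cmod_ge_0|apply H].
    + apply is_series_Reals. intros e He. exists 0%nat. intros n _.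
      rewrite sum_eq_R0 by auto. unfold Rdist. rewrite Rminus_0_r, Rabs_R0. exact He.
    + exact HM.
  - assert (P := proj1 (Cmod_gt_0 S) N).
    assert (NC : RtoC (Cmod S) <> 0%C) by (intros E; apply RtoC_inj in E; lra).
    set (w := (Cconj S / RtoC (Cmod S))%C).
    assert (Mw : Cmod w = 1).
    { unfold w. rewrite Cmod_div, Cmod_conj, Cmod_R, Rabs_pos_eq by (auto; lra).
      field. lra. }
    assert (E : (w * S)%C = RtoC (Cmod S)).
    { unfold w. transitivity ((S * Cconj S) / RtoC (Cmod S))%C; [field; exact NC|].
      rewrite <- Cmod2_conj. rewrite RtoC_pow. simpl. field. exact NC. }
    apply (is_series_le_R (fun k => Re (w * c k)%C) M); [|  | exact HM].
    + intros k. eapply Rle_trans; [apply Re_le_Cmod|].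
      rewrite Cmod_mult, Mw, Rmult_1_l. apply H.
    + assert (Q := proj1 (Cser_mult_l w _ _ HS)). rewrite E in Q. exact Q.
Qed.

(** The coefficients grow at most geometrically: [a] is the sequence of Taylor
    coefficients of a function that is analytic in the disc of radius [/ Rr]. *)
Definition geometric_bound (a : nat -> C) (A Rr : R) : Prop :=
  0 < Rr /\ forall k, Cmod (a k) <= A * Rr ^ k.

Lemma geometric_bound_ge_0 (a : nat -> C) (A Rr : R) : geometric_bound a A Rr -> 0 <= A.
Proof.
  intros [_ H]. assert (H0 := H 0%nat). simpl in H0.
  assert (G := Cmod_ge_0 (a 0%nat)). lra.
Qed.

Lemma geometric_bound_weaken (a : nat -> C) (A A' Rr Rr' : R) :
  geometric_bound a A Rr -> A <= A' -> Rr <= Rr' -> geometric_bound a A' Rr'.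
Proof.
  intros G HA HR. assert (A0 := geometric_bound_ge_0 _ _ _ G).
  destruct G as [P H]. split; [lra|]. intros k.
  eapply Rle_trans; [apply H|].
  apply Rmult_le_compat; try lra; [apply pow_le; lra | apply pow_incr; lra].
Qed.

Lemma geometric_bound_term (a : nat -> C) (A Rr : R) (u : C) (k : nat) :
  geometric_bound a A Rr -> Cmod (a k * u ^ k) <= A * (Rr * Cmod u) ^ k.
Proof.
  intros [P H]. rewrite Cmod_mult, Cmod_pow, Rpow_mult_distr, <- Rmult_assoc.
  apply Rmult_le_compat_r; [apply pow_le, Cmod_ge_0 | apply H].
Qed.

Lemma is_series_geometric (A q : R) : 0 <= q < 1 ->
  is_series (fun k => A * q ^ k) (A / (1 - q)).
Proof.
  intros H. apply (is_series_scal (K := R_AbsRing) (V := R_NormedModule) A).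
  apply is_series_geom. rewrite Rabs_pos_eq; lra.
Qed.

Lemma Cpseries_correct (a : nat -> C) (A Rr : R) (u : C) :
  geometric_bound a A Rr -> Rr * Cmod u < 1 ->
  Cser (fun k => a k * u ^ k)%C (Cpseries a u).
Proof.
  intros G Hu. apply Cser_dominated with (fun k => A * (Rr * Cmod u) ^ k).
  - intros k. apply geometric_bound_term, G.
  - eexists. apply is_series_geometric. destruct G as [P _].
    assert (Q := Cmod_ge_0 u). split; [nra | exact Hu].
Qed.

Lemma Cpseries_Cmod_le (a : nat -> C) (A Rr : R) (u : C) :
  geometric_bound a A Rr -> Rr * Cmod u < 1 ->
  Cmod (Cpseries a u) <= A / (1 - Rr * Cmod u).
Proof.
  intros G Hu.
  apply Cser_Cmod_le with (fun k => a k * u ^ k)%C (fun k => A * (Rr * Cmod u) ^ k).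
  - intros k. apply geometric_bound_term, G.
  - apply is_series_geometric. destruct G as [P _].
    assert (Q := Cmod_ge_0 u). split; [nra | exact Hu].
  - apply Cpseries_correct with A Rr; assumption.
Qed.

Lemma bounded_from_eventually (f : nat -> R) (N : nat) (B : R) :
  (forall k, (N <= k)%nat -> f k <= B) -> exists B', forall k, f k <= B'.
Proof.
  revert B. induction N as [|N IH]; intros B H.
  - exists B. intros k. apply H. lia.
  - apply (IH (Rmax B (f N))). intros k Hk.
    destruct (Nat.eq_dec k N) as [->|D]; [apply Rmax_r|].
    eapply Rle_trans; [apply H; lia | apply Rmax_l].
Qed.

Lemma convergent_geometric_bound (a : nat -> C) :
  convergent_near_0 a -> exists A Rr, geometric_bound a A Rr.
Proof.
  intros [rho [Hr H]].
  assert (Hu : Cmod (RtoC (rho / 2)) = rho / 2).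
  { rewrite Cmod_R. apply Rabs_pos_eq. lra. }
  destruct (H (RtoC (rho / 2))) as [l Hl]; [rewrite Hu; lra|].
  assert (L : filterlim (sum_n (fun k => scal (pow_n (RtoC (rho / 2)) k) (a k)))
     eventually (@locally C_UniformSpace l)) by exact Hl.
  destruct (proj1 (filterlim_Cmod eventually _ l) L 1 Rlt_0_1) as [N HN].
  destruct (bounded_from_eventually (fun k => Cmod (a k) * (rho / 2) ^ k) (S N) 2)
    as [B HB].
  - intros k Hk. destruct k as [|k]; [lia|].
    assert (H1 := HN k ltac:(lia)). assert (H2 := HN (S k) ltac:(lia)).
    rewrite sum_Sn in H2.
    set (s := sum_n _ k) in *. change C in (type of s).
    change (Cmod (s + RtoC (rho / 2) ^ S k * a (S k) - l) < 1) in H2.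
    replace (Cmod (a (S k)) * (rho / 2) ^ S k) with (Cmod (RtoC (rho / 2) ^ S k * a (S k))%C).
    2: { rewrite Cmod_mult, Cmod_pow, Hu. ring. }
    replace (RtoC (rho / 2) ^ S k * a (S k))%C
      with ((s + RtoC (rho / 2) ^ S k * a (S k) - l) - (s - l))%C by ring.
    eapply Rle_trans; [apply Cmod_triangle|]. rewrite Cmod_opp. lra.
  - exists B, (/ (rho / 2)). split; [apply Rinv_0_lt_compat; lra|].
    intros k. specialize (HB k). simpl in HB.
    assert (P : 0 < (rho / 2) ^ k) by (apply pow_lt; lra).
    rewrite pow_inv.
    apply Rmult_le_reg_r with (1 := P). rewrite Rmult_assoc, Rinv_l by lra. lra.
Qed.

Lemma Cser_unique (c : nat -> C) (S T : C) : Cser c S -> Cser c T -> S = T.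
Proof.
  intros [H1 H2] [K1 K2]. apply C_ext.
  - rewrite <- (is_series_unique _ _ H1). apply is_series_unique, K1.
  - rewrite <- (is_series_unique _ _ H2). apply is_series_unique, K2.
Qed.

Lemma geometric_bound_shift (a : nat -> C) (A Rr : R) (r : nat) :
  geometric_bound a A Rr ->
  geometric_bound (fun p => a (r + p)%nat) (A * Rr ^ r) Rr.
Proof.
  intros [P H]. split; [exact P|]. intros k.
  rewrite Rmult_assoc, <- pow_add. apply H.
Qed.

Lemma Cpseries_step (a : nat -> C) (A Rr : R) (u : C) :
  geometric_bound a A Rr -> Rr * Cmod u < 1 ->
  Cpseries a u = (a 0%nat + u * Cpseries (fun k => a (S k)) u)%C.
Proof.
  intros G Hu. apply Cpseries_unique.
  replace (a 0%nat) with (a 0%nat * u ^ 0)%C by (simpl; ring).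
  apply (Cser_incr (fun k => a k * u ^ k)%C).
  apply Cser_ext with (fun k => u * (a (S k) * u ^ k))%C.
  - intros k. rewrite Cpow_S. ring.
  - apply Cser_mult_l. apply Cpseries_correct with (A * Rr ^ 1) Rr; [|exact Hu].
    exact (geometric_bound_shift a A Rr 1 G).
Qed.

(** The Taylor coefficients in [u] of the divided difference
    [(f z - f u) / (z - u)], where [f] is the sum of the series [a]. *)
Definition divdiff (a : nat -> C) (z : C) (r : nat) : C :=
  Cpseries (fun p => a (S r + p)%nat) z.

Lemma divdiff_Cmod_le (a : nat -> C) (A Rr : R) (z : C) (r : nat) :
  geometric_bound a A Rr -> Rr * Cmod z <= / 2 ->
  Cmod (divdiff a z r) <= 2 * A * Rr * Rr ^ r.
Proof.
  intros G Hz. unfold divdiff.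
  assert (A0 := geometric_bound_ge_0 _ _ _ G).
  eapply Rle_trans.
  - apply Cpseries_Cmod_le with (1 := geometric_bound_shift a A Rr (S r) G). lra.
  - simpl. destruct G as [P _].
    assert (Q : 0 <= A * (Rr * Rr ^ r)).
    { apply Rmult_le_pos; [lra|]. apply Rmult_le_pos; [lra|]. apply pow_le. lra. }
    apply Rmult_le_reg_r with (1 - Rr * Cmod z); [lra|].
    unfold Rdiv. rewrite Rmult_assoc, Rinv_l by lra. nra.
Qed.

Lemma geometric_bound_divdiff (a : nat -> C) (A Rr : R) (z : C) :
  geometric_bound a A Rr -> Rr * Cmod z <= / 2 ->
  geometric_bound (divdiff a z) (2 * A * Rr) Rr.
Proof.
  intros G Hz. split; [apply G|]. intros k. apply divdiff_Cmod_le; assumption.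
Qed.

(** By Horner's rule [z * divdiff a z r] is [divdiff a z (r - 1) - a r], so that
    the product [(z - u) * sum_r (divdiff a z r * u ^ r)] telescopes. *)
Lemma divdiff_correct (a : nat -> C) (A Rr : R) (z u : C) :
  geometric_bound a A Rr -> Rr * Cmod z <= / 2 -> Rr * Cmod u < 1 ->
  (Cpseries a z - Cpseries a u)%C = ((z - u) * Cpseries (divdiff a z) u)%C.
Proof.
  intros G Hz Hu.
  assert (Gd := geometric_bound_divdiff a A Rr z G Hz).
  assert (Sd := Cpseries_correct _ _ _ u Gd Hu).
  assert (Sa := Cpseries_correct _ _ _ u G Hu).
  set (D := Cpseries (divdiff a z) u) in *.
  set (e := fun r => match r with O => Cpseries a z | S r' => divdiff a z r' end).
  assert (Se : Cser (fun r => e r * u ^ r)%C (Cpseries a z + u * D)%C).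
  { replace (Cpseries a z + u * D)%C with (e 0%nat * u ^ 0 + u * D)%C by (simpl; ring).
    apply (Cser_incr (fun r => e r * u ^ r)%C).
    apply Cser_ext with (2 := Cser_mult_l u _ _ Sd).
    intros k. simpl e. rewrite Cpow_S. ring. }
  assert (H : forall r, (z * divdiff a z r)%C = (e r - a r)%C).
  { intros r. destruct r as [|r]; simpl e.
    - rewrite (Cpseries_step a A Rr z G) by lra. unfold divdiff. simpl. ring.
    - unfold divdiff at 2.
      rewrite (Cpseries_step _ _ _ z (geometric_bound_shift a A Rr (S r) G)) by lra.
      rewrite Nat.add_0_r. unfold divdiff.
      replace (Cpseries (fun p => a (S (S r) + p)%nat) z)
        with (Cpseries (fun k => a (S r + S k)%nat) z); [ring|].
      apply Cpseries_unique.
      apply Cser_ext with (fun k => a (S (S r) + k)%nat * z ^ k)%C.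
      + intros k. do 2 f_equal. lia.
      + apply Cpseries_correct with (1 := geometric_bound_shift a A Rr (S (S r)) G). lra. }
  assert (K : Cser (fun r => z * (divdiff a z r * u ^ r))%C (Cpseries a z + u * D - Cpseries a u)%C).
  { apply Cser_ext with (2 := Cser_minus _ _ _ _ Se Sa).
    intros r. rewrite Cmult_assoc, H. ring. }
  assert (E := Cser_unique _ _ _ K (Cser_mult_l z _ _ Sd)).
  replace (Cpseries a z - Cpseries a u)%C
    with ((Cpseries a z + u * D - Cpseries a u) - u * D)%C by ring.
  rewrite E. ring.
Qed.

(** The increment at [z] is [y - z] times a divided difference, which is bounded on
    the disc where the geometric estimates with ratio below [3 / 4] hold. *)
Lemma continuous_Cpseries (a : nat -> C) (A Rr : R) (z : C) :
  geometric_bound a A Rr -> Rr * Cmod z < / 2 ->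
  @continuous C_UniformSpace C_UniformSpace (Cpseries a) z.
Proof.
  intros G Hz. assert (A0 := geometric_bound_ge_0 _ _ _ G).
  assert (P : 0 < Rr) by apply G.
  apply continuous_Cmod. intros e He. apply locally_Cmod.
  assert (Q : 0 < 8 * A * Rr + 1) by nra.
  exists (Rmin (/ (4 * Rr)) (e / (8 * A * Rr + 1))). split.
  { apply Rmin_glb_lt; [apply Rinv_0_lt_compat; lra | apply Rdiv_lt_0_compat; lra]. }
  intros y Hy.
  assert (H1 := Rlt_le_trans _ _ _ Hy (Rmin_l _ _)).
  assert (H2 := Rlt_le_trans _ _ _ Hy (Rmin_r _ _)).
  assert (Y : Rr * Cmod y < 3 / 4).
  { replace y with ((y - z) + z)%C by ring.
    assert (T := Cmod_triangle (y - z) z).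
    apply Rmult_lt_compat_l with (1 := P) in H1.
    replace (Rr * / (4 * Rr)) with (/ 4) in H1 by (field; lra). nra. }
  replace (Cpseries a y - Cpseries a z)%C with (- (Cpseries a z - Cpseries a y))%C by ring.
  rewrite (divdiff_correct a A Rr z y G) by lra.
  rewrite Cmod_opp, Cmod_mult.
  replace (z - y)%C with (- (y - z))%C by ring. rewrite Cmod_opp.
  assert (W : Cmod (Cpseries (divdiff a z) y) <= 8 * A * Rr).
  { eapply Rle_trans.
    - apply Cpseries_Cmod_le with (1 := geometric_bound_divdiff a A Rr z G (Rlt_le _ _ Hz)). lra.
    - apply Rmult_le_reg_r with (1 - Rr * Cmod y); [lra|].
      unfold Rdiv. rewrite Rmult_assoc, Rinv_l by lra.
      assert (0 <= A * Rr) by nra. nra. }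
  apply Rle_lt_trans with (Cmod (y - z) * (8 * A * Rr + 1)).
  - apply Rmult_le_compat_l; [apply Cmod_ge_0 | lra].
  - apply Rmult_lt_compat_r with (1 := Q) in H2.
    replace (e / (8 * A * Rr + 1) * (8 * A * Rr + 1)) with e in H2 by (field; lra).
    exact H2.
Qed.

(** Caratheodory's form of differentiability: for a power series the factor [w] is
    the divided difference, itself a power series, so that continuity of power
    series already yields their differentiability. *)
Lemma is_derive_factor (f w : C -> C) (z : C) :
  @locally C_UniformSpace z (fun y => (f y - f z = (y - z) * w y)%C) ->
  @continuous C_UniformSpace C_UniformSpace w z ->
  @is_derive C_AbsRing C_NormedModule f z (w z).
Proof.
  intros Hf Hw. split.
  - apply (is_linear_scal_l (K := C_AbsRing) (V := C_NormedModule)).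
  - intros x Hx.
    apply (is_filter_lim_locally_unique (K := C_AbsRing) (V := AbsRing_NormedModule C_AbsRing)) in Hx.
    subst x. intros e.
    apply locally_C.
    assert (Hw' := proj1 (continuous_Cmod w z) Hw e (cond_pos e)).
    generalize (filter_and _ _ Hf Hw'). apply filter_imp.
    intros y [E L].
    change (Cmod ((f y - f z) - (y - z) * w z) <= e * Cmod (y - z)).
    rewrite E. replace ((y - z) * w y - (y - z) * w z)%C with ((w y - w z) * (y - z))%C by ring.
    rewrite Cmod_mult. apply Rmult_le_compat_r; [apply Cmod_ge_0 | lra].
Qed.

Lemma holomorphic_Cpseries (a : nat -> C) (A Rr : R) (z0 : C) :
  geometric_bound a A Rr -> holomorphic_at (fun z => Cpseries a (z - z0)%C) z0.
Proof.
  intros G. assert (P : 0 < Rr) by apply G.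
  exists (/ (4 * Rr)). split; [apply Rinv_0_lt_compat; lra|].
  intros z Hz.
  assert (H : Rr * Cmod (z - z0) < / 4).
  { apply Rmult_lt_compat_l with (1 := P) in Hz.
    replace (Rr * / (4 * Rr)) with (/ 4) in Hz by (field; lra). exact Hz. }
  exists (Cpseries (divdiff a (z - z0)%C) (z - z0)%C).
  apply (is_derive_factor _ (fun y => Cpseries (divdiff a (z - z0)%C) (y - z0)%C)).
  - apply locally_Cmod. exists (/ (4 * Rr)). split; [apply Rinv_0_lt_compat; lra|].
    intros y Hy.
    assert (T := Cmod_triangle (y - z) (z - z0)).
    replace ((y - z) + (z - z0))%C with (y - z0)%C in T by ring.
    apply Rmult_lt_compat_l with (1 := P) in Hy.
    replace (Rr * / (4 * Rr)) with (/ 4) in Hy by (field; lra).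
    assert (D := divdiff_correct a A Rr (z - z0) (y - z0) G ltac:(lra) ltac:(nra)).
    replace (Cpseries a (y - z0) - Cpseries a (z - z0))%C
      with (- (Cpseries a (z - z0) - Cpseries a (y - z0)))%C by ring.
    rewrite D. ring.
  - apply (continuous_comp (U := C_UniformSpace) (V := C_UniformSpace) (W := C_UniformSpace)
      (fun y => y - z0)%C (Cpseries (divdiff a (z - z0)%C))).
    + apply continuous_Cminus; [apply continuous_id | apply continuous_Cconst].
    + apply continuous_Cpseries with (2 * A * Rr) Rr; [|lra].
      apply geometric_bound_divdiff; [exact G | lra].
Qed.

(** ** Products and averages over the roots *)

Definition Cauchy_product (a b : nat -> C) (k : nat) : C :=
  sum_n (fun i => a i * b (k - i)%nat)%C k.

(** The number [k + 1] of summands is absorbed by doubling the ratio. *)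
Lemma geometric_bound_Cauchy_product (a b : nat -> C) (A B Rr : R) :
  geometric_bound a A Rr -> geometric_bound b B Rr ->
  geometric_bound (Cauchy_product a b) (A * B) (2 * Rr).
Proof.
  intros Ga Gb.
  assert (A0 := geometric_bound_ge_0 _ _ _ Ga). assert (B0 := geometric_bound_ge_0 _ _ _ Gb).
  destruct Ga as [P Ha], Gb as [_ Hb]. split; [lra|].
  intros k. unfold Cauchy_product.
  eapply Rle_trans.
  - apply (Cmod_sum_n_le _ (fun _ => A * B * Rr ^ k)). intros i Hi.
    rewrite Cmod_mult.
    replace (A * B * Rr ^ k) with ((A * Rr ^ i) * (B * Rr ^ (k - i))).
    + apply Rmult_le_compat; auto using Cmod_ge_0.
    + replace (Rr ^ k) with (Rr ^ i * Rr ^ (k - i)); [ring|].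
      rewrite <- pow_add. f_equal. lia.
  - rewrite sum_n_const, Rpow_mult_distr.
    assert (L : INR (S k) <= 2 ^ k).
    { clear. induction k as [|k IH]; [simpl; lra|].
      rewrite S_INR. assert (1 <= 2 ^ k) by (apply pow_R1_Rle; lra). simpl (2 ^ S k). lra. }
    assert (0 <= A * B * Rr ^ k).
    { apply Rmult_le_pos; [nra | apply pow_le; lra]. }
    nra.
Qed.

Lemma Re_sum_n (f : nat -> C) (m : nat) : Re (sum_n f m) = sum_n (fun i => Re (f i)) m.
Proof.
  induction m as [|m IH]; [rewrite !sum_O; reflexivity|].
  rewrite sum_n_C_S, sum_Sn, <- IH. reflexivity.
Qed.

Lemma Im_sum_n (f : nat -> C) (m : nat) : Im (sum_n f m) = sum_n (fun i => Im (f i)) m.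
Proof.
  induction m as [|m IH]; [rewrite !sum_O; reflexivity|].
  rewrite sum_n_C_S, sum_Sn, <- IH. reflexivity.
Qed.

Lemma sum_n_Rminus (f g : nat -> R) (m : nat) :
  sum_n (fun i => f i - g i) m = sum_n f m - sum_n g m.
Proof.
  induction m as [|m IH]; [rewrite !sum_O; reflexivity|].
  rewrite !sum_Sn, IH. unfold plus; simpl. ring.
Qed.

Lemma Cpseries_mult (a b : nat -> C) (A B Rr : R) (u : C) :
  geometric_bound a A Rr -> geometric_bound b B Rr -> Rr * Cmod u < 1 ->
  Cpseries (Cauchy_product a b) u = (Cpseries a u * Cpseries b u)%C.
Proof.
  intros Ga Gb Hu. apply Cpseries_unique.
  assert (Q : 0 <= Rr * Cmod u < 1).
  { destruct Ga as [P _]. assert (T := Cmod_ge_0 u). split; [nra | exact Hu]. }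
  assert (Ab : forall (c : nat -> C) (M : R) (part : C -> R), geometric_bound c M Rr ->
    (forall z, Rabs (part z) <= Cmod z) -> ex_series (fun k => Rabs (part (c k * u ^ k)%C))).
  { intros c M part G Hp.
    apply (ex_series_le (K := R_AbsRing) (V := R_CompleteNormedModule))
      with (fun k => M * (Rr * Cmod u) ^ k).
    - intros k. unfold norm; simpl. unfold abs; simpl. rewrite Rabs_Rabsolu.
      eapply Rle_trans; [apply Hp | apply geometric_bound_term, G].
    - eexists. apply is_series_geometric, Q. }
  destruct (Cpseries_correct _ _ _ u Ga Hu) as [a1 a2].
  destruct (Cpseries_correct _ _ _ u Gb Hu) as [b1 b2].
  assert (ar := Ab a A Re Ga Rabs_Re_le). assert (ai := Ab a A Im Ga Rabs_Im_le).
  assert (br := Ab b B Re Gb Rabs_Re_le). assert (bi := Ab b B Im Gb Rabs_Im_le).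
  apply Cser_ext with (fun k => sum_n (fun i => (a i * u ^ i) * (b (k - i)%nat * u ^ (k - i))) k)%C.
  { intros k. unfold Cauchy_product. rewrite Cmult_comm, <- sum_n_C_mult_l.
    apply sum_n_ext_loc. intros i Hi.
    replace (u ^ k)%C with (u ^ i * u ^ (k - i))%C; [Cring|].
    rewrite <- Cpow_add_r. f_equal. lia. }
  split.
  - eapply is_series_ext;
      [|exact (is_series_minus _ _ _ _ (is_series_mult _ _ _ _ a1 b1 ar br)
                                (is_series_mult _ _ _ _ a2 b2 ai bi))].
    intros k. rewrite Re_sum_n, <- !sum_n_Reals.
    symmetry. apply (sum_n_Rminus (fun i => Re (a i * u ^ i)%C * Re (b (k - i)%nat * u ^ (k - i))%C)
      (fun i => Im (a i * u ^ i)%C * Im (b (k - i)%nat * u ^ (k - i))%C)).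
  - eapply is_series_ext;
      [|exact (is_series_plus _ _ _ _ (is_series_mult _ _ _ _ a1 b2 ar bi)
                                (is_series_mult _ _ _ _ a2 b1 ai br))].
    intros k. rewrite Im_sum_n, <- !sum_n_Reals, <- sum_n_plus. reflexivity.
Qed.

Lemma Cpseries_plus (a b : nat -> C) (A B Rr : R) (u : C) :
  geometric_bound a A Rr -> geometric_bound b B Rr -> Rr * Cmod u < 1 ->
  Cpseries (fun k => a k + b k)%C u = (Cpseries a u + Cpseries b u)%C.
Proof.
  intros Ga Gb Hu. apply Cpseries_unique.
  apply Cser_ext with (fun k => a k * u ^ k + b k * u ^ k)%C; [intros; ring|].
  apply Cser_plus; eapply Cpseries_correct; eassumption.
Qed.

Lemma geometric_bound_plus (a b : nat -> C) (A B Rr : R) :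
  geometric_bound a A Rr -> geometric_bound b B Rr ->
  geometric_bound (fun k => a k + b k)%C (A + B) Rr.
Proof.
  intros [P Ha] [_ Hb]. split; [exact P|]. intros k.
  eapply Rle_trans; [apply Cmod_triangle|].
  specialize (Ha k). specialize (Hb k). lra.
Qed.

Lemma Cpseries_mult_l (z : C) (a : nat -> C) (A Rr : R) (u : C) :
  geometric_bound a A Rr -> Rr * Cmod u < 1 ->
  Cpseries (fun k => z * a k)%C u = (z * Cpseries a u)%C.
Proof.
  intros Ga Hu. apply Cpseries_unique.
  apply Cser_ext with (fun k => z * (a k * u ^ k))%C; [intros; ring|].
  apply Cser_mult_l. eapply Cpseries_correct; eassumption.
Qed.

Lemma geometric_bound_mult_l (z : C) (a : nat -> C) (A Rr : R) :
  geometric_bound a A Rr -> geometric_bound (fun k => z * a k)%C (Cmod z * A) Rr.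
Proof.
  intros [P Ha]. split; [exact P|]. intros k.
  rewrite Cmod_mult, Rmult_assoc. apply Rmult_le_compat_l; [apply Cmod_ge_0|apply Ha].
Qed.

(** The partial sums over the multiples of [S m] are a subsequence of the partial
    sums of the full series. *)
Lemma is_series_sparse (m : nat) (f : nat -> R) (S0 : R) :
  (forall k, ~ Nat.divide (S m) k -> f k = 0) -> is_series f S0 ->
  is_series (fun l => f (S m * l)%nat) S0.
Proof.
  intros Z H.
  assert (E : forall L, sum_n (fun l => f (S m * l)%nat) L = sum_n f (S m * L)).
  { induction L as [|L IH].
    - rewrite Nat.mul_0_r, !sum_O, Nat.mul_0_r. reflexivity.
    - rewrite sum_Sn, IH.
      assert (G : forall i, (i <= m)%nat ->
        sum_n f (S m * L + i) = sum_n f (S m * L)).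
      { induction i as [|i IHi]; intros Hi; [rewrite Nat.add_0_r; reflexivity|].
        rewrite Nat.add_succ_r, sum_Sn, IHi by lia. rewrite Z.
        - unfold plus; simpl. ring.
        - intros [c Hc]. assert (c < S L \/ S L <= c)%nat as [D|D] by lia; nia. }
      replace (S m * S L)%nat with (S (S m * L + m))%nat by nia.
      rewrite sum_Sn, G by lia. reflexivity. }
  change (is_lim_seq (sum_n (fun l => f (S m * l)%nat)) S0).
  apply (is_lim_seq_ext (fun L => sum_n f (S m * L)%nat)); [intros; symmetry; apply E|].
  apply (is_lim_seq_subseq (sum_n f)); [|exact H].
  apply eventually_subseq. intros. lia.
Qed.

Lemma Cser_sum_n (c : nat -> nat -> C) (s : nat -> C) (m : nat) :
  (forall j, Cser (c j) (s j)) -> Cser (fun k => sum_n (fun j => c j k) m) (sum_n s m).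
Proof.
  intros H. induction m as [|m IH].
  - rewrite sum_O. apply Cser_ext with (2 := H 0%nat). intros k. rewrite sum_O. reflexivity.
  - rewrite sum_n_C_S. apply Cser_ext with (2 := Cser_plus _ _ _ _ IH (H (S m))).
    intros k. rewrite sum_n_C_S. reflexivity.
Qed.

Lemma Cser_sparse (m : nat) (f : nat -> C) (S0 : C) :
  (forall k, ~ Nat.divide (S m) k -> f k = 0%C) -> Cser f S0 ->
  Cser (fun l => f (S m * l)%nat) S0.
Proof.
  intros Z [H1 H2]. split.
  - apply (is_series_sparse m (fun k => Re (f k))); [|exact H1].
    intros k Hk. rewrite Z by exact Hk. reflexivity.
  - apply (is_series_sparse m (fun k => Im (f k))); [|exact H2].
    intros k Hk. rewrite Z by exact Hk. reflexivity.
Qed.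

(** Summing over the [n]-th roots of [T] only keeps the exponents that are
    multiples of [n], so the result is analytic in [T] itself. *)
Lemma Cpseries_average (a : nat -> C) (A Rr : R) (m : nat) (u : C) :
  geometric_bound a A Rr -> Rr * Cmod u < 1 ->
  sum_n (fun j => Cpseries a (root_of_unity (S m) ^ j * u)%C) m =
  (RtoC (INR (S m)) * Cpseries (fun l => a (S m * l)%nat) (u ^ S m)%C)%C.
Proof.
  intros G Hu.
  set (eps := root_of_unity (S m)).
  assert (Me : forall j, Cmod (eps ^ j * u) = Cmod u).
  { intros j. unfold eps. rewrite root_of_unity_pow, Cmod_mult, Cmod_rotation by lia. ring. }
  assert (H : Cser (fun k => sum_n (fun j => a k * (eps ^ j * u) ^ k) m)%C
    (sum_n (fun j => Cpseries a (eps ^ j * u)%C) m)).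
  { apply (Cser_sum_n (fun j k => a k * (eps ^ j * u) ^ k)%C).
    intros j. apply Cpseries_correct with A Rr; [exact G|]. rewrite Me. exact Hu. }
  set (s := sum_n _ m) in *. change C in (type of s).
  assert (E : forall k, sum_n (fun j => a k * (eps ^ j * u) ^ k)%C m =
    (a k * u ^ k * sum_n (fun j => (eps ^ j) ^ k) m)%C).
  { intros k. rewrite <- sum_n_C_mult_l. apply sum_n_ext. intros j.
    rewrite Cpow_mult_l. Cring. }
  assert (NZ : RtoC (INR (S m)) <> 0%C) by (apply INR_C_neq_0; lia).
  assert (K : Cser (fun l => a (S m * l)%nat * (u ^ S m) ^ l)%C (/ RtoC (INR (S m)) * s)%C).
  { apply Cser_ext with (fun l => / RtoC (INR (S m)) *
      sum_n (fun j => a (S m * l)%nat * (eps ^ j * u) ^ (S m * l)) m)%C.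
    - intros l. rewrite E. unfold eps. rewrite root_of_unity_sum_multiple.
      rewrite <- Cpow_mult_r. field. exact NZ.
    - apply Cser_mult_l.
      apply (Cser_sparse m (fun k => sum_n (fun j => a k * (eps ^ j * u) ^ k)%C m)); [|exact H].
      intros k D. rewrite E. unfold eps. rewrite root_of_unity_sum_0 by exact D. Cring. }
  rewrite (Cpseries_unique _ _ _ K). Cfield. exact NZ.
Qed.

Lemma geometric_bound_multiples (a : nat -> C) (A Rr : R) (n : nat) :
  geometric_bound a A Rr -> geometric_bound (fun l => a (n * l)%nat) A (Rr ^ n).
Proof.
  intros [P H]. split; [apply pow_lt, P|]. intros l.
  rewrite <- pow_mult. apply H.
Qed.

Lemma Cpseries_truncate (a : nat -> C) (A Rr : R) (u : C) (N : nat) :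
  geometric_bound a A Rr -> Rr * Cmod u < 1 ->
  Cpseries a u = (sum_n (fun k => a k * u ^ k) N
    + u ^ S N * Cpseries (fun k => a (S N + k)%nat) u)%C.
Proof.
  intros G Hu. induction N as [|N IH].
  - rewrite sum_O, (Cpseries_step a A Rr u G Hu). simpl. Cring.
  - rewrite IH, sum_n_C_S.
    rewrite (Cpseries_step _ _ _ u (geometric_bound_shift a A Rr (S N) G) Hu).
    rewrite Nat.add_0_r.
    replace (Cpseries (fun k => a (S N + S k)%nat) u)
      with (Cpseries (fun k => a (S (S N) + k)%nat) u).
    + rewrite !Cpow_S. Cring.
    + apply Cpseries_unique.
      apply Cser_ext with (fun k => a (S N + S k)%nat * u ^ k)%C.
      * intros k. do 2 f_equal. lia.
      * apply Cpseries_correct with (A * Rr ^ S (S N)) Rr; [|exact Hu].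
        split; [apply G|]. intros k. rewrite Rmult_assoc, <- pow_add.
        replace (S (S N) + k)%nat with (S N + S k)%nat by lia. apply G.
Qed.

Lemma Cpseries_tail_small (A Rr r e : R) : 0 < Rr -> Rr * r < 1 -> 0 <= r -> 0 <= A -> 0 < e ->
  exists N0, forall (N : nat) (a : nat -> C) (u : C), (N0 <= N)%nat ->
    geometric_bound a A Rr -> Cmod u = r ->
    Cmod (sum_n (fun k => a k * u ^ k)%C N - Cpseries a u) < e.
Proof.
  intros P Q r0 A0 He.
  assert (q0 : 0 <= Rr * r) by nra.
  assert (D : 0 < e * (1 - Rr * r) / (A + 1)) by (apply Rdiv_lt_0_compat; nra).
  destruct (pow_lt_1_zero (Rr * r) ltac:(rewrite Rabs_pos_eq; lra) _ D) as [N0 HN].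
  exists N0. intros N a u HNN G Hu.
  rewrite (Cpseries_truncate a A Rr u N G) by (rewrite Hu; exact Q).
  set (s := sum_n _ N). change C in (type of s).
  replace (s - (s + u ^ S N * Cpseries (fun k => a (S N + k)%nat) u))%C
    with (- (u ^ S N * Cpseries (fun k => a (S N + k)%nat) u))%C by ring.
  rewrite Cmod_opp, Cmod_mult, Cmod_pow, Hu.
  assert (B := Cpseries_Cmod_le _ _ _ u (geometric_bound_shift a A Rr (S N) G)
     ltac:(rewrite Hu; exact Q)).
  rewrite Hu in B.
  assert (HN' := HN (S N) ltac:(lia)).
  rewrite Rabs_pos_eq in HN' by (apply pow_le; exact q0).
  rewrite Rpow_mult_distr in HN'.
  assert (rp : 0 <= r ^ S N) by (apply pow_le; exact r0).
  assert (Rp : 0 <= Rr ^ S N) by (apply pow_le; lra).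
  set (x := r ^ S N) in *. set (y := Rr ^ S N) in *.
  apply Rle_lt_trans with (x * (A * y / (1 - Rr * r))).
  { apply Rmult_le_compat_l; assumption. }
  replace (x * (A * y / (1 - Rr * r))) with (A * (y * x) / (1 - Rr * r)) by (field; lra).
  apply Rmult_lt_reg_r with (1 - Rr * r); [lra|].
  replace (A * (y * x) / (1 - Rr * r) * (1 - Rr * r)) with (A * (y * x)) by (field; lra).
  apply Rle_lt_trans with (A * (e * (1 - Rr * r) / (A + 1))).
  { apply Rmult_le_compat_l; lra. }
  apply Rmult_lt_reg_r with (A + 1); [lra|].
  replace (A * (e * (1 - Rr * r) / (A + 1)) * (A + 1)) with (A * (e * (1 - Rr * r))) by (field; lra).
  nra.
Qed.

(** * Integrals of complex-valued functions *)

Local Notation is_CInt := (@is_RInt C_R_NormedModule).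
Local Notation ex_CInt := (@ex_RInt C_R_NormedModule).
Local Notation CInt := (@RInt C_R_CompleteNormedModule).

Lemma is_CInt_Re (f : R -> C) (a b : R) (l : C) :
  is_CInt f a b l -> is_RInt (fun t => Re (f t)) a b (Re l).
Proof. intros H. exact (is_RInt_fct_extend_fst f a b l H). Qed.

Lemma is_CInt_Im (f : R -> C) (a b : R) (l : C) :
  is_CInt f a b l -> is_RInt (fun t => Im (f t)) a b (Im l).
Proof. intros H. exact (is_RInt_fct_extend_snd f a b l H). Qed.

Lemma is_CInt_pair (f : R -> C) (a b : R) (l : C) :
  is_RInt (fun t => Re (f t)) a b (Re l) -> is_RInt (fun t => Im (f t)) a b (Im l) ->
  is_CInt f a b l.
Proof. intros H K. destruct l. exact (is_RInt_fct_extend_pair f a b _ _ H K). Qed.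

Lemma is_CInt_unique (f : R -> C) (a b : R) (l : C) : is_CInt f a b l -> CInt f a b = l.
Proof. apply (is_RInt_unique (V := C_R_CompleteNormedModule)). Qed.

Lemma CInt_correct (f : R -> C) (a b : R) : ex_CInt f a b -> is_CInt f a b (CInt f a b).
Proof. apply (RInt_correct (V := C_R_CompleteNormedModule)). Qed.

Lemma ex_CInt_continuous (f : R -> C) (a b : R) : a <= b ->
  (forall x, a <= x <= b -> Ccontinuous f x) -> ex_CInt f a b.
Proof.
  intros Hab H. apply (ex_RInt_continuous (V := C_R_CompleteNormedModule)).
  rewrite Rmin_left, Rmax_right by exact Hab. exact H.
Qed.

Lemma is_CInt_ext (f g : R -> C) (a b : R) (l : C) : a <= b ->
  (forall x, a < x < b -> f x = g x) -> is_CInt f a b l -> is_CInt g a b l.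
Proof.
  intros Hab H. apply (is_RInt_ext (V := C_R_NormedModule)).
  rewrite Rmin_left, Rmax_right by exact Hab. exact H.
Qed.

Lemma ex_CInt_ext (f g : R -> C) (a b : R) : a <= b ->
  (forall x, a < x < b -> f x = g x) -> ex_CInt f a b -> ex_CInt g a b.
Proof. intros Hab H [l Hl]. exists l. apply is_CInt_ext with f; assumption. Qed.

Lemma is_CInt_mult_l (z : C) (f : R -> C) (a b : R) (l : C) :
  is_CInt f a b l -> is_CInt (fun x => z * f x)%C a b (z * l)%C.
Proof.
  intros H. assert (H1 := is_CInt_Re _ _ _ _ H). assert (H2 := is_CInt_Im _ _ _ _ H).
  assert (A := fun k f a b l H => is_RInt_scal (V := R_NormedModule) f a b k l H).
  apply is_CInt_pair.
  - apply (is_RInt_minus (V := R_NormedModule)  _ _ _ _ _ _ (A (Re z) _ _ _ _ H1) (A (Im z) _ _ _ _ H2)).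
  - apply (is_RInt_plus (V := R_NormedModule)  _ _ _ _ _ _ (A (Re z) _ _ _ _ H2) (A (Im z) _ _ _ _ H1)).
Qed.

Lemma is_CInt_plus (f g : R -> C) (a b : R) (k l : C) :
  is_CInt f a b k -> is_CInt g a b l -> is_CInt (fun x => f x + g x)%C a b (k + l)%C.
Proof. apply (is_RInt_plus (V := C_R_NormedModule)). Qed.

Lemma is_CInt_sum_n (f : nat -> R -> C) (l : nat -> C) (a b : R) (m : nat) :
  (forall j, is_CInt (f j) a b (l j)) ->
  is_CInt (fun x => sum_n (fun j => f j x) m) a b (sum_n l m).
Proof.
  intros H. induction m as [|m IH].
  - rewrite sum_O. apply (is_RInt_ext (V := C_R_NormedModule)) with (2 := H 0%nat).
    intros. rewrite sum_O. reflexivity.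
  - rewrite sum_n_C_S.
    apply (is_RInt_ext (V := C_R_NormedModule)) with (2 := is_CInt_plus _ _ _ _ _ _ IH (H (S m))).
    intros. rewrite sum_n_C_S. reflexivity.
Qed.

Lemma is_CInt_Cmod_le (f : R -> C) (a b M : R) (l : C) : a <= b ->
  (forall x, a <= x <= b -> Cmod (f x) <= M) -> is_CInt f a b l -> Cmod l <= (b - a) * M.
Proof.
  intros Hab H Hl. rewrite Cmod_norm.
  apply (norm_RInt_le_const (V := C_R_NormedModule) f a b l M Hab); [|exact Hl].
  intros x Hx. specialize (H x Hx). rewrite Cmod_norm in H. exact H.
Qed.

(** The bound makes the partial sums converge uniformly on the segment, so the
    series may be integrated term by term.  This yields the Taylor coefficients
    of logarithms, of Cauchy transforms and of integrated divided differences. *)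
Lemma is_CInt_Cpseries (phi : nat -> R -> C) (c : nat -> C) (a b A Rr : R) :
  a <= b -> 0 < Rr -> 0 <= A ->
  (forall r, is_CInt (phi r) a b (c r)) ->
  (forall r x, a < x < b -> Cmod (phi r x) <= A * Rr ^ r) ->
  geometric_bound c ((b - a) * A) Rr /\
  forall u, Rr * Cmod u < 1 ->
    is_CInt (fun x => Cpseries (fun r => phi r x) u) a b (Cpseries c u).
Proof.
  intros Hab P A0 Hc Hb.
  set (psi := fun r x => if Rlt_dec a x then if Rlt_dec x b then phi r x else RtoC 0 else RtoC 0).
  assert (Hpsi : forall r x, a < x < b -> phi r x = psi r x).
  { intros r x Hx. unfold psi. destruct (Rlt_dec a x), (Rlt_dec x b); lra || reflexivity. }
  assert (Gpsi : forall x, geometric_bound (fun r => psi r x) A Rr).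
  { intros x. split; [exact P|]. intros r. unfold psi.
    assert (0 <= A * Rr ^ r) by (apply Rmult_le_pos; [lra | apply pow_le; lra]).
    destruct (Rlt_dec a x), (Rlt_dec x b); rewrite ?Cmod_0; auto. }
  assert (Ipsi : forall r, is_CInt (psi r) a b (c r)).
  { intros r. apply is_CInt_ext with (phi r); auto. }
  assert (G : geometric_bound c ((b - a) * A) Rr).
  { split; [exact P|]. intros r. rewrite Rmult_assoc.
    apply is_CInt_Cmod_le with (psi r); auto. intros x _. apply Gpsi. }
  split; [exact G|]. intros u Hu.
  apply is_CInt_ext with (fun x => Cpseries (fun r => psi r x) u); [exact Hab| |].
  { intros x Hx. unfold Cpseries.
    f_equal; apply Series_ext; intros k; rewrite Hpsi by exact Hx; reflexivity. }
  destruct (filterlim_RInt (V := C_R_CompleteNormedModule)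
    (fun N x => sum_n (fun r => psi r x * u ^ r)%C N) a b eventually _
    (fun x => Cpseries (fun r => psi r x) u) (sum_n (fun r => c r * u ^ r)%C)) as [l [L1 L2]].
  - intros N. apply (is_CInt_sum_n (fun r x => psi r x * u ^ r)%C (fun r => c r * u ^ r)%C).
    intros r. rewrite Cmult_comm.
    apply is_CInt_ext with (fun x => u ^ r * psi r x)%C; [exact Hab | intros; ring |].
    apply is_CInt_mult_l, Ipsi.
  - apply filterlim_locally. intros e.
    destruct (Cpseries_tail_small A Rr (Cmod u) e P Hu (Cmod_ge_0 u) A0 (cond_pos e)) as [N0 HN].
    exists N0. intros N HNN x. apply C_NormedModule_mixin_compat1.
    apply HN; auto.
  - assert (L : filterlim (sum_n (fun r => c r * u ^ r)%C) eventually
      (@locally C_UniformSpace (Cpseries c u))).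
    { apply (filterlim_Cmod eventually). intros e He.
      destruct (Cpseries_tail_small ((b - a) * A) Rr (Cmod u) e P Hu (Cmod_ge_0 u)
        ltac:(nra) He) as [N0 HN].
      exists N0. intros N HNN. apply HN; auto. }
    replace (Cpseries c u) with l; [exact L2|].
    apply (filterlim_locally_unique (K := R_AbsRing) (V := C_R_NormedModule)
      (sum_n (fun r => c r * u ^ r)%C : nat -> C_R_NormedModule) l (Cpseries c u) L1 L).
Qed.

Lemma Cpseries_ext (a b : nat -> C) (u : C) :
  (forall k, a k = b k) -> Cpseries a u = Cpseries b u.
Proof.
  intros H. unfold Cpseries.
  f_equal; apply Series_ext; intros k; rewrite H; reflexivity.
Qed.

Lemma geometric_bound_cauchy_kernel (c w : C) : w <> 0%C ->
  geometric_bound (fun r => c / w ^ S r)%C (Cmod c / Cmod w) (/ Cmod w).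
Proof.
  intros N. assert (P := proj1 (Cmod_gt_0 w) N).
  split; [apply Rinv_0_lt_compat, P|]. intros k.
  rewrite Cmod_div, Cmod_pow by (apply Cpow_nz, N).
  rewrite pow_inv. simpl. right. field. split; [apply pow_nonzero|]; lra.
Qed.

Lemma Cpseries_cauchy_kernel (c w h : C) : Cmod h < Cmod w ->
  Cpseries (fun r => c / w ^ S r)%C h = (c / (w - h))%C.
Proof.
  intros Hh.
  assert (P : 0 < Cmod w) by (assert (T := Cmod_ge_0 h); lra).
  assert (N := proj2 (Cmod_gt_0 w) P).
  assert (G := geometric_bound_cauchy_kernel c w N).
  assert (Q : / Cmod w * Cmod h < 1).
  { apply Rmult_lt_reg_l with (1 := P). rewrite <- Rmult_assoc, Rinv_r by lra. lra. }
  assert (E := Cpseries_step _ _ _ h G Q). cbv beta in E.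
  rewrite (Cpseries_ext (fun k => c / w ^ S (S k))%C (fun k => / w * (c / w ^ S k))%C) in E.
  2: { intros k. rewrite (Cpow_S w (S k)). field. split; [apply Cpow_nz|]; exact N. }
  rewrite (Cpseries_mult_l _ _ _ _ _ G Q) in E.
  set (s := Cpseries _ h) in *.
  assert (D : (w - h)%C <> 0%C).
  { intros D. assert (w = h) by (apply Ceq_minus; exact D). subst h. lra. }
  assert (F : (s * (w - h))%C = c).
  { transitivity (w * (s - h * (/ w * s)))%C; [field; exact N|].
    rewrite E at 1. simpl. field. exact N. }
  rewrite <- F. field. exact D.
Qed.

(** Off the curve [zeta], a Cauchy transform is analytic: expand its kernel
    into a geometric series. *)
Lemma cauchy_transform_series (phi zeta : R -> C) (a b d M : R) (z : C) :
  a <= b -> 0 < d -> 0 <= M ->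
  (forall x, a < x < b -> d <= Cmod (zeta x - z)) ->
  (forall x, a < x < b -> Cmod (phi x) <= M) ->
  (forall r, ex_CInt (fun x => phi x / (zeta x - z) ^ S r)%C a b) ->
  exists (c : nat -> C) (A : R), geometric_bound c A (/ d) /\
    forall u, Cmod (u - z) < d ->
      is_CInt (fun x => phi x / (zeta x - u))%C a b (Cpseries c (u - z)%C).
Proof.
  intros Hab Hd HM Hz Hphi Hint.
  destruct (is_CInt_Cpseries (fun r x => phi x / (zeta x - z) ^ S r)%C
    (fun r => CInt (fun x => phi x / (zeta x - z) ^ S r)%C a b) a b (M / d) (/ d) Hab)
    as [G H].
  - apply Rinv_0_lt_compat, Hd.
  - apply Rmult_le_pos; [exact HM | left; apply Rinv_0_lt_compat, Hd].
  - intros r. apply CInt_correct, Hint.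
  - intros r x Hx. specialize (Hz x Hx). specialize (Hphi x Hx).
    assert (P : 0 < Cmod (zeta x - z)) by lra.
    rewrite Cmod_div by (apply Cpow_nz, Cmod_gt_0, P).
    rewrite Cmod_pow.
    replace (M / d * (/ d) ^ r) with (M * / (d ^ S r)).
    + apply Rmult_le_compat; [apply Cmod_ge_0 | left | exact Hphi |].
      * apply Rinv_0_lt_compat, pow_lt, P.
      * apply Rinv_le_contravar; [apply pow_lt, Hd|]. apply pow_incr. lra.
    + rewrite pow_inv. simpl. field. split; [apply pow_nonzero|]; lra.
  - eexists; eexists; split; [exact G|].
    intros u Hu.
    assert (Q : / d * Cmod (u - z) < 1).
    { apply Rmult_lt_reg_l with (1 := Hd). rewrite <- Rmult_assoc, Rinv_r by lra. lra. }
    apply is_CInt_ext with (3 := H _ Q); [exact Hab|].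
    intros x Hx. cbv beta. rewrite Cpseries_cauchy_kernel.
    + replace (zeta x - z - (u - z))%C with (zeta x - u)%C by ring. reflexivity.
    + specialize (Hz x Hx). lra.
Qed.

(** * Logarithms as integrals *)

Definition Cderiv (f : R -> C) (x : R) (l : C) : Prop :=
  is_derive (fun y => Re (f y)) x (Re l) /\ is_derive (fun y => Im (f y)) x (Im l).

Ltac derive_by B :=
  match type of B with is_derive _ _ ?l =>
    match goal with |- is_derive _ _ ?r =>
      replace r with l; [exact B|
        unfold minus, plus, opp, mult, scal, Re, Im; simpl; unfold mult, Re, Im; simpl; ring]
    end
  end.

Lemma Cderiv_mult (f g : R -> C) (x : R) (k l : C) :
  Cderiv f x k -> Cderiv g x l ->
  Cderiv (fun y => f y * g y)%C x (k * g x + f x * l)%C.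
Proof.
  intros [F1 F2] [G1 G2].
  assert (A := fun f g df dg H K => is_derive_mult f g x df dg H K Rmult_comm).
  split.
  - assert (B := is_derive_minus _ _ _ _ _ (A _ _ _ _ F1 G1) (A _ _ _ _ F2 G2)).
    derive_by B.
  - assert (B := is_derive_plus _ _ _ _ _ (A _ _ _ _ F1 G2) (A _ _ _ _ F2 G1)).
    derive_by B.
Qed.

Lemma Cderiv_opp (f : R -> C) (x : R) (k : C) :
  Cderiv f x k -> Cderiv (fun y => - f y)%C x (- k)%C.
Proof. intros [F1 F2]. split; apply (is_derive_opp (V := R_NormedModule)); assumption. Qed.

Lemma Cderiv_Cexp (f : R -> C) (x : R) (k : C) :
  Cderiv f x k -> Cderiv (fun y => Cexp (f y)) x (Cexp (f x) * k)%C.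
Proof.
  intros [F1 F2].
  assert (A := fun f g df dg H K => is_derive_mult f g x df dg H K Rmult_comm).
  assert (E := is_derive_comp exp _ x _ _ (is_derive_exp _) F1).
  assert (Co := is_derive_comp cos _ x _ _ (is_derive_cos _) F2).
  assert (Si := is_derive_comp sin _ x _ _ (is_derive_sin _) F2).
  split.
  - assert (B := A _ _ _ _ E Co). derive_by B.
  - assert (B := A _ _ _ _ E Si). derive_by B.
Qed.

Lemma derive_0_constant_R (f : R -> R) (a b : R) : a < b ->
  (forall x, a < x < b -> is_derive f x 0) ->
  (forall x, a <= x <= b -> continuous f x) -> f a = f b.
Proof.
  intros Hab Hd Hc.
  destruct (MVT_gen f a b (fun _ => 0)) as [c [_ E]].
  - rewrite Rmin_left, Rmax_right by lra. exact Hd.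
  - rewrite Rmin_left, Rmax_right by lra. intros x Hx.
    apply continuity_pt_filterlim. apply Hc, Hx.
  - lra.
Qed.

Lemma Cderiv_0_constant (f : R -> C) (a b : R) : a < b ->
  (forall x, a < x < b -> Cderiv f x 0) ->
  (forall x, a <= x <= b -> Ccontinuous f x) -> f a = f b.
Proof.
  intros Hab Hd Hc. apply C_ext.
  - apply (derive_0_constant_R (fun x => Re (f x))); [exact Hab| |].
    + intros x Hx. apply (Hd x Hx).
    + intros x Hx. apply continuous_Re, Hc, Hx.
  - apply (derive_0_constant_R (fun x => Im (f x))); [exact Hab| |].
    + intros x Hx. apply (Hd x Hx).
    + intros x Hx. apply continuous_Im, Hc, Hx.
Qed.

Lemma Cderiv_continuous (f : R -> C) (x : R) (l : C) :
  Cderiv f x l -> Ccontinuous f x.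
Proof.
  intros [H1 H2]. apply continuous_C.
  - apply (ex_derive_continuous (V := R_NormedModule)). eexists; exact H1.
  - apply (ex_derive_continuous (V := R_NormedModule)). eexists; exact H2.
Qed.

(** Continuity is only known on a segment, while differentiating an integral with
    respect to its end-point wants it on a neighbourhood; clamping provides it
    without changing the values on the segment. *)
Lemma continuous_comp_clamp (f : R -> C) (a b x : R) : a <= b ->
  (forall x, a <= x <= b -> Ccontinuous f x) ->
  Ccontinuous (fun y => f (clamp a b y)) x.
Proof.
  intros Hab H.
  apply (continuous_comp (V := R_UniformSpace) (W := C_UniformSpace) (clamp a b) f).
  - apply continuous_clamp, Hab.
  - apply H, clamp_range, Hab.
Qed.

Lemma Cderiv_CInt (f : R -> C) (a x : R) :
  (forall y, Ccontinuous f y) ->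
  Cderiv (fun y => CInt f a y) x (f x).
Proof.
  intros Hf.
  assert (E : forall y, ex_CInt f a y).
  { intros y. apply (ex_RInt_continuous (V := C_R_CompleteNormedModule)).
    intros; apply Hf. }
  split.
  - apply (is_derive_RInt (V := R_NormedModule) (fun y => Re (f y)) _ a x).
    + apply filter_forall. intros y. apply is_CInt_Re, CInt_correct, E.
    + apply continuous_Re, Hf.
  - apply (is_derive_RInt (V := R_NormedModule) (fun y => Im (f y)) _ a x).
    + apply filter_forall. intros y. apply is_CInt_Im, CInt_correct, E.
    + apply continuous_Im, Hf.
Qed.

(** The product of [f] with the exponential of minus the integral of [f' / f] has
    derivative [0].  Differentiability is only used inside the segment, so that
    paths may start at a point where they are defined on one side only. *)
Lemma Cexp_CInt_log_derivative (f f' : R -> C) (a b : R) : a < b ->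
  (forall x, a <= x <= b -> Ccontinuous f x) ->
  (forall x, a < x < b -> Cderiv f x (f' x)) ->
  (forall x, a <= x <= b -> Ccontinuous f' x) ->
  (forall x, a <= x <= b -> f x <> 0%C) ->
  Cexp (CInt (fun x => f' x / f x)%C a b) = (f b / f a)%C.
Proof.
  intros Hab Hf Hd Hf' N.
  set (psi := fun x => (f' (clamp a b x) / f (clamp a b x))%C).
  assert (Cpsi : forall x, Ccontinuous psi x).
  { intros x. apply (continuous_comp_clamp (fun x => f' x / f x)%C); [lra|].
    intros y Hy. apply continuous_Cdiv; auto. }
  replace (CInt (fun x => f' x / f x)%C a b) with (CInt psi a b).
  2: { apply (RInt_ext (V := C_R_CompleteNormedModule)).
       rewrite Rmin_left, Rmax_right by lra. intros x Hx.
       unfold psi. rewrite clamp_id by lra. reflexivity. }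
  assert (E : (f a * Cexp (- CInt psi a a))%C = (f b * Cexp (- CInt psi a b))%C).
  { apply (Cderiv_0_constant (fun x => f x * Cexp (- CInt psi a x))%C a b Hab).
    - intros x Hx.
      replace (RtoC 0) with (f' x * Cexp (- CInt psi a x)
        + f x * (Cexp (- CInt psi a x) * (- psi x)))%C.
      + apply Cderiv_mult; [apply Hd, Hx|].
        apply (Cderiv_Cexp (fun x => - CInt psi a x)%C).
        apply Cderiv_opp, Cderiv_CInt, Cpsi.
      + unfold psi at 3. rewrite clamp_id by lra. field. apply N. lra.
    - intros x Hx. apply continuous_Cmult; [apply Hf, Hx|].
      apply continuous_Cexp, continuous_Copp.
      apply Cderiv_continuous with (psi x). apply Cderiv_CInt, Cpsi. }
  rewrite (RInt_point (V := C_R_CompleteNormedModule)) in E.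
  change (f a * Cexp (- RtoC 0) = f b * Cexp (- CInt psi a b))%C in E.
  replace (- RtoC 0)%C with (RtoC 0) in E by ring.
  rewrite Cexp_0, Cexp_opp_inv in E.
  assert (Na := N a ltac:(lra)). assert (Ne := Cexp_nz (CInt psi a b)).
  set (w := Cexp (CInt psi a b)) in *.
  replace (f b) with ((f b * / w) * w)%C by (field; exact Ne).
  rewrite <- E. field. exact Na.
Qed.

Lemma continuous_Cmod_comp (f : R -> C) (x : R) :
  Ccontinuous f x -> continuous (fun y => Cmod (f y)) x.
Proof.
  intros H. apply filterlim_locally. intros e.
  generalize (proj1 (continuous_Cmod f x) H e (cond_pos e)). apply filter_imp.
  intros y Hy. change (Rabs (Cmod (f y) - Cmod (f x)) < e).
  apply Rle_lt_trans with (2 := Hy).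
  apply Rabs_le. assert (T1 := Cmod_triangle (f y - f x) (f x)).
  assert (T2 := Cmod_triangle (- (f y - f x)) (f y)). rewrite Cmod_opp in T2.
  replace (f y - f x + f x)%C with (f y) in T1 by ring.
  replace (- (f y - f x) + f y)%C with (f x) in T2 by ring. lra.
Qed.

Lemma Cmod_min_on_segment (f : R -> C) (a b : R) : a <= b ->
  (forall x, a <= x <= b -> Ccontinuous f x) ->
  (forall x, a <= x <= b -> f x <> 0%C) ->
  exists d, 0 < d /\ forall x, a <= x <= b -> d <= Cmod (f x).
Proof.
  intros Hab Hc N.
  destruct (continuity_ab_min (fun x => Cmod (f x)) a b Hab) as [m [H Hm]].
  - intros x Hx. apply continuity_pt_filterlim. apply continuous_Cmod_comp, Hc, Hx.
  - exists (Cmod (f m)). split; [apply Cmod_gt_0, N, Hm | exact H].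
Qed.

Lemma Cmod_max_on_segment (f : R -> C) (a b : R) : a <= b ->
  (forall x, a <= x <= b -> Ccontinuous f x) ->
  exists M, 0 <= M /\ forall x, a <= x <= b -> Cmod (f x) <= M.
Proof.
  intros Hab Hc.
  destruct (continuity_ab_maj (fun x => Cmod (f x)) a b Hab) as [m [H Hm]].
  - intros x Hx. apply continuity_pt_filterlim. apply continuous_Cmod_comp, Hc, Hx.
  - exists (Cmod (f m)). split; [apply Cmod_ge_0 | exact H].
Qed.

(** At a point off the curve the transform even has a Taylor expansion, with a
    radius given by the distance to the curve. *)
Lemma continuous_cauchy_transform (phi zeta : R -> C) (a b : R) (z : C) : a <= b ->
  (forall x, a <= x <= b -> Ccontinuous zeta x) ->
  (forall x, a <= x <= b -> Ccontinuous phi x) ->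
  (forall x, a <= x <= b -> zeta x <> z) ->
  @continuous C_UniformSpace C_UniformSpace
    (fun u => CInt (fun x => phi x / (zeta x - u))%C a b) z.
Proof.
  intros Hab Hz Hp N.
  assert (Cz : forall x, a <= x <= b ->
    Ccontinuous (fun x => zeta x - z)%C x).
  { intros x Hx. apply continuous_Cminus; [apply Hz, Hx | apply continuous_Cconst]. }
  assert (Nz : forall x, a <= x <= b -> (zeta x - z)%C <> 0%C).
  { intros x Hx. apply Cminus_eq_contra, N, Hx. }
  destruct (Cmod_min_on_segment _ a b Hab Cz Nz) as [d [Hd Hmin]].
  destruct (Cmod_max_on_segment _ a b Hab Hp) as [M [HM Hmax]].
  destruct (cauchy_transform_series phi zeta a b d M z Hab Hd HM) as [c [A [G H]]].
  - intros; apply Hmin; lra.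
  - intros; apply Hmax; lra.
  - intros r. apply ex_CInt_continuous; [exact Hab|]. intros x Hx.
    apply continuous_Cdiv; [apply Hp, Hx | apply continuous_Cpow, Cz, Hx | apply Cpow_nz, Nz, Hx].
  - apply (continuous_ext_loc (T := C_UniformSpace) (U := C_UniformSpace) _ (fun u => Cpseries c (u - z)%C)).
    + apply locally_Cmod. exists d. split; [exact Hd|]. intros y Hy.
      symmetry. apply is_CInt_unique, H, Hy.
    + apply (continuous_comp (U := C_UniformSpace) (V := C_UniformSpace) (W := C_UniformSpace)
        (fun y => y - z)%C (Cpseries c)).
      * apply continuous_Cminus; [apply continuous_id | apply continuous_Cconst].
      * apply continuous_Cpseries with A (/ d); [exact G|].
        replace (z - z)%C with (RtoC 0) by ring. rewrite Cmod_0. lra.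
Qed.

(** [log (1 - u / c)] is the integral of [- u / (c - x * u)] over [x] in [0, 1], and
    the expansion of the kernel in powers of [u] is integrated term by term. *)
Lemma log_series (c : C) : c <> 0%C ->
  exists (l : nat -> C) (A : R), geometric_bound l A (/ Cmod c) /\
    (forall u, Cmod u < Cmod c -> Cexp (Cpseries l u) = (1 - u / c)%C) /\
    (Cpseries l 0 = 0)%C.
Proof.
  intros N. assert (P := proj1 (Cmod_gt_0 c) N).
  (* [phi r x] is the coefficient of [u ^ (r + 1)] in [- u / (c - x * u)] *)
  set (phi := fun r (x : R) => (RtoC x ^ r * (- (1) / c ^ S r))%C).
  assert (Cphi : forall r x, Ccontinuous (phi r) x).
  { intros r x. apply continuous_Cmult; [|apply continuous_Cconst].
    apply continuous_Cpow, continuous_RtoC, continuous_id. }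
  destruct (is_CInt_Cpseries phi (fun r => CInt (phi r) 0 1) 0 1 (/ Cmod c) (/ Cmod c))
    as [G H]; [lra | apply Rinv_0_lt_compat, P | left; apply Rinv_0_lt_compat, P | | |].
  - intros r. apply CInt_correct, ex_CInt_continuous; [lra|]. intros; apply Cphi.
  - intros r x Hx. unfold phi.
    rewrite Cmod_mult, Cmod_div, Cmod_opp, Cmod_1, !Cmod_pow, Cmod_R, Rabs_pos_eq
      by (try apply Cpow_nz; auto; lra).
    assert (B : x ^ r <= 1) by (rewrite <- (pow1 r); apply pow_incr; lra).
    rewrite pow_inv. replace (/ Cmod c * / Cmod c ^ r) with (1 * (1 / Cmod c ^ S r)).
    + apply Rmult_le_compat_r; [|exact B].
      left. apply Rdiv_lt_0_compat; [lra | apply pow_lt, P].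
    + simpl. field. split; [apply pow_nonzero|]; lra.
  - set (k := fun r => CInt (phi r) 0 1) in *.
    set (l := fun r => match r with O => RtoC 0 | S r' => k r' end).
    assert (Gl : geometric_bound l ((1 - 0) * / Cmod c * Cmod c) (/ Cmod c)).
    { split; [apply G|]. intros r.
      assert (Pr := Rinv_0_lt_compat _ P).
      destruct r as [|r]; simpl.
      - rewrite Cmod_0. nra.
      - eapply Rle_trans; [apply G|]. right. field. lra. }
    exists l; eexists. split; [exact Gl|].
    assert (El : forall u, Cmod u < Cmod c -> Cpseries l u = (u * Cpseries k u)%C).
    { intros u Hu. rewrite (Cpseries_step l _ _ u Gl).
      - change (RtoC 0 + u * Cpseries k u = u * Cpseries k u)%C. ring.
      - apply Rmult_lt_reg_l with (1 := P). rewrite <- Rmult_assoc, Rinv_r by lra. lra. }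
    split.
    + intros u Hu. rewrite El by exact Hu.
      assert (Q : / Cmod c * Cmod u < 1).
      { apply Rmult_lt_reg_l with (1 := P). rewrite <- Rmult_assoc, Rinv_r by lra. lra. }
      assert (Nx : forall x, 0 <= x <= 1 -> (c - RtoC x * u)%C <> 0%C).
      { intros x Hx E. assert (E' : c = (RtoC x * u)%C) by (apply Ceq_minus; exact E).
        apply (f_equal Cmod) in E'. rewrite Cmod_mult, Cmod_R, Rabs_pos_eq in E' by lra.
        assert (T := Cmod_ge_0 u). nra. }
      rewrite <- (is_CInt_unique _ _ _ _ (is_CInt_mult_l u _ _ _ _ (H u Q))).
      transitivity (Cexp (CInt (fun x => (- u) / (c - RtoC x * u))%C 0 1)).
      * f_equal. apply (RInt_ext (V := C_R_CompleteNormedModule)).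
        rewrite Rmin_left, Rmax_right by lra. intros x Hx.
        change (u * Cpseries (fun r => phi r x) u = - u / (c - RtoC x * u))%C.
        assert (K : Cpseries (fun r => phi r x) u
          = Cpseries (fun r => - (1) / c ^ S r)%C (RtoC x * u)%C).
        { unfold Cpseries. f_equal; apply Series_ext; intros r; unfold phi;
            rewrite Cpow_mult_l; f_equal; ring. }
        rewrite K, Cpseries_cauchy_kernel.
        -- field. apply Nx. lra.
        -- rewrite Cmod_mult, Cmod_R, Rabs_pos_eq by lra.
           assert (T := Cmod_ge_0 u). nra.
      * rewrite (Cexp_CInt_log_derivative (fun x => c - RtoC x * u)%C (fun _ => - u)%C 0 1).
        -- replace (c - RtoC 0 * u)%C with c by ring. field. exact N.
        -- lra.
        -- intros x _. apply continuous_Cminus; [apply continuous_Cconst|].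
           apply continuous_Cmult; [apply continuous_RtoC, continuous_id | apply continuous_Cconst].
        -- intros x _. split; simpl; auto_derive; auto; ring.
        -- intros x _. apply continuous_Cconst.
        -- exact Nx.
    + rewrite El by (rewrite Cmod_0; exact P). ring.
Qed.

(** * Integrability along the curve *)

(** Next to [s], on the side described by [D], [f] agrees with a function that is
    continuous up to [s] included; [f s] itself is unconstrained, as it is at corners
    and at ramification points. *)
Definition one_sided_continuous (D : R -> Prop) (f : R -> C) (s : R) : Prop :=
  exists (k : R -> C) (d : R), 0 < d /\ Ccontinuous k s /\
    forall x, D x -> Rabs (x - s) < d ->
      Ccontinuous k x /\ f x = k x.

Lemma one_sided_continuous_mult (D : R -> Prop) (f g : R -> C) (s : R) :
  one_sided_continuous D f s -> one_sided_continuous D g s ->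
  one_sided_continuous D (fun x => f x * g x)%C s.
Proof.
  intros (k & d & Hd & K1 & K2) (l & e & He & L1 & L2).
  exists (fun x => k x * l x)%C, (Rmin d e).
  split; [apply Rmin_glb_lt; assumption|].
  split; [apply continuous_Cmult; assumption|].
  intros x Dx Hx.
  destruct (K2 x Dx (Rlt_le_trans _ _ _ Hx (Rmin_l _ _))) as [A1 A2].
  destruct (L2 x Dx (Rlt_le_trans _ _ _ Hx (Rmin_r _ _))) as [B1 B2].
  split; [apply continuous_Cmult; assumption | rewrite A2, B2; reflexivity].
Qed.

(** The supremum of the points up to which [f] is integrable is reached from the
    left germ and passed with the right germ. *)
Lemma ex_CInt_piecewise (f : R -> C) (a b : R) : a <= b ->
  (forall s, a <= s < b -> one_sided_continuous (Rlt s) f s) ->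
  (forall s, a < s <= b -> one_sided_continuous (Rgt s) f s) ->
  ex_CInt f a b.
Proof.
  intros Hab Hr Hl.
  set (E := fun x => a <= x <= b /\ ex_CInt f a x).
  assert (Ea : E a) by (split; [lra | apply (ex_RInt_point (V := C_R_NormedModule))]).
  destruct (completeness E) as [m [Ub Lub]].
  { exists b. intros x [Hx _]. lra. }
  { exists a. exact Ea. }
  assert (Ham : a <= m) by (apply Ub, Ea).
  assert (Hmb : m <= b) by (apply Lub; intros x [Hx _]; lra).
  assert (Em : E m).
  { destruct (Rle_lt_or_eq_dec a m Ham) as [L|<-]; [|exact Ea].
    destruct (Hl m ltac:(lra)) as (k & d & Hd & K1 & K2).
    assert (X : exists x, E x /\ Rmax (m - d) a < x).
    { destruct (Classical_Prop.classic (exists x, E x /\ Rmax (m - d) a < x)) as [Y|Y]; [exact Y|].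
      exfalso. assert (B : m <= Rmax (m - d) a).
      { apply Lub. intros x Ex. apply Rnot_lt_le. intros Hx. apply Y. exists x. auto. }
      revert B. apply Rlt_not_le. apply Rmax_lub_lt; lra. }
    destruct X as [x [Ex Hx]].
    assert (x <= m) by (apply Ub, Ex).
    assert (Hx1 := Rle_lt_trans _ _ _ (Rmax_l _ _) Hx).
    split; [lra|].
    apply (ex_RInt_Chasles (V := C_R_NormedModule) f a x m); [apply Ex|].
    apply ex_CInt_ext with k; [assumption| |].
    - intros y Hy. symmetry. apply K2; [lra | apply Rabs_def1; lra].
    - apply ex_CInt_continuous; [assumption|]. intros y Hy.
      destruct (Req_dec y m) as [->|D]; [exact K1|].
      apply K2; [lra | apply Rabs_def1; lra]. }
  destruct (Rle_lt_or_eq_dec m b Hmb) as [L|<-]; [exfalso|apply Em].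
  destruct (Hr m ltac:(lra)) as (k & d & Hd & K1 & K2).
  set (y := Rmin (m + d / 2) b).
  assert (Hy : m < y) by (apply Rmin_glb_lt; lra).
  assert (Hy1 : y <= m + d / 2) by apply Rmin_l.
  assert (Hy2 : y <= b) by apply Rmin_r.
  assert (Ey : E y).
  { split; [lra|].
    apply (ex_RInt_Chasles (V := C_R_NormedModule) f a m y); [apply Em|].
    apply ex_CInt_ext with k; [lra| |].
    - intros x Hx. symmetry. apply K2; [lra | apply Rabs_def1; lra].
    - apply ex_CInt_continuous; [lra|]. intros x Hx.
      destruct (Req_dec x m) as [->|D]; [exact K1|].
      apply K2; [lra | apply Rabs_def1; lra]. }
  apply Ub in Ey. lra.
Qed.

(** Without negative powers the series is continuous at [0], the limit of the
    branch [u] at [s]. *)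
Lemma one_sided_continuous_puiseux (D : R -> Prop) (gamma : R -> C) (g : C -> C) (s : R) :
  (forall x, {D x} + {~ D x}) -> (forall x, D x -> locally x D) -> ~ D s ->
  filterlim gamma (within D (locally s)) (@locally C_UniformSpace (gamma s)) ->
  puiseux_along (within D (locally s)) gamma g (gamma s) ->
  one_sided_continuous D (fun x => g (gamma x)) s.
Proof.
  intros Ddec Dopen Ds Hlim (m & b & u & Hm & Hb & HF).
  destruct (convergent_geometric_bound b Hb) as [A [Rr G]].
  assert (P : 0 < Rr) by apply G.
  set (k := fun x => if Ddec x then Cpseries b (u x) else Cpseries b 0).
  assert (Hk : forall x, D x -> k x = Cpseries b (u x)).
  { intros x Dx. unfold k. destruct (Ddec x); [reflexivity | contradiction]. }
  (* [u] tends to [0] at [s] because its [m]-th power does *)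
  assert (Hu : forall e, 0 < e -> within D (locally s) (fun x => Cmod (u x) < e)).
  { intros e He.
    assert (Q := proj1 (filterlim_Cmod (within D (locally s)) gamma _) Hlim (e ^ m) (pow_lt _ _ He)).
    generalize (filter_and _ _ HF Q). apply filter_imp.
    intros x [[_ [E _]] L]. rewrite <- E, Cmod_pow in L.
    apply Rnot_le_lt. intros N. apply (Rlt_not_le _ _ L).
    apply pow_incr. lra. }
  assert (Hr : 0 < / (4 * Rr)) by (apply Rinv_0_lt_compat; lra).
  assert (W := filter_and _ _ HF (Hu _ Hr)).
  apply locally_Rabs in W. destruct W as [d [Hd W]].
  assert (Cb : forall w, Cmod w < / (4 * Rr) ->
    @continuous C_UniformSpace C_UniformSpace (Cpseries b) w).
  { intros w Hw. apply continuous_Cpseries with A Rr; [exact G|].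
    apply Rmult_lt_compat_l with (1 := P) in Hw.
    replace (Rr * / (4 * Rr)) with (/ 4) in Hw by (field; lra). lra. }
  exists k, d. split; [exact Hd|]. split.
  - apply continuous_Cmod. intros e He.
    assert (C0 := Cb (RtoC 0) ltac:(rewrite Cmod_0; exact Hr)).
    assert (L0 := proj1 (continuous_Cmod _ _) C0 e He).
    apply locally_Cmod in L0. destruct L0 as [r [Hr0 L0]].
    generalize (Hu r Hr0 : locally s (fun x => D x -> Cmod (u x) < r)).
    apply filter_imp. intros x Hx.
    unfold k at 2. destruct (Ddec s) as [Ds'|_]; [contradiction|].
    destruct (Ddec x) as [Dx|Nx].
    + rewrite Hk by exact Dx. apply L0.
      replace (u x - RtoC 0)%C with (u x) by ring. apply Hx, Dx.
    + unfold k. destruct (Ddec x) as [Dx|_]; [contradiction|].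
      replace (Cpseries b 0 - Cpseries b 0)%C with (RtoC 0) by ring.
      rewrite Cmod_0. exact He.
  - intros x Dx Hx. destruct (W x Hx Dx) as [[Cu [_ Eg]] Lu].
    split; [|rewrite Hk by exact Dx; exact Eg].
    apply (continuous_ext_loc (T := R_UniformSpace) (U := C_UniformSpace) _
      (fun y => Cpseries b (u y))).
    + generalize (Dopen x Dx). apply filter_imp. intros y Dy. symmetry. apply Hk, Dy.
    + apply (continuous_comp (U := R_UniformSpace) (V := C_UniformSpace) (W := C_UniformSpace)
        u (Cpseries b)); [exact Cu | apply Cb, Lu].
Qed.

Lemma piecewise_smooth_right (gamma : R -> C) : piecewise_smooth gamma ->
  forall s, 0 <= s < 1 -> exists d, 0 < d /\ s + d <= 1 /\ smooth_arc gamma s (s + d).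
Proof.
  intros (N & x & X0 & XN & H) s Hs.
  assert (I : forall j, (j <= N)%nat -> s < x j ->
    exists i, (i < N)%nat /\ x i <= s < x (S i)).
  { induction j as [|j IH]; intros Hj L; [lra|].
    destruct (Rlt_le_dec s (x j)) as [L'|L']; [apply IH; [lia | exact L']|].
    exists j. split; [lia | lra]. }
  destruct (I N ltac:(lia) ltac:(lra)) as [i [Hi Hx]].
  assert (Mono : forall j, (S i + j <= N)%nat -> x (S i) <= x (S i + j)%nat).
  { induction j as [|j IH]; intros Hj; [rewrite Nat.add_0_r; lra|].
    destruct (H (S i + j)%nat ltac:(lia)) as [L _].
    rewrite Nat.add_succ_r. specialize (IH ltac:(lia)). lra. }
  assert (M := Mono (N - S i)%nat ltac:(lia)).
  replace (S i + (N - S i))%nat with N in M by lia.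
  exists (x (S i) - s). split; [lra|]. split; [lra|].
  destruct (H i Hi) as [_ (p & dp & P1 & P2 & P3)].
  exists p, dp. split; [exact P1|]. split; [exact P2|].
  intros y Hy. apply P3. lra.
Qed.

Lemma piecewise_smooth_left (gamma : R -> C) : piecewise_smooth gamma ->
  forall s, 0 < s <= 1 -> exists d, 0 < d /\ 0 <= s - d /\ smooth_arc gamma (s - d) s.
Proof.
  intros (N & x & X0 & XN & H) s Hs.
  assert (I : forall j, (j <= N)%nat -> s <= x j ->
    exists i, (i < N)%nat /\ x i < s <= x (S i)).
  { induction j as [|j IH]; intros Hj L; [lra|].
    destruct (Rle_lt_dec s (x j)) as [L'|L']; [apply IH; [lia | exact L']|].
    exists j. split; [lia | lra]. }
  destruct (I N ltac:(lia) ltac:(lra)) as [i [Hi Hx]].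
  assert (Mono : forall j, (j <= N)%nat -> 0 <= x j).
  { induction j as [|j IH]; intros Hj; [lra|].
    destruct (H j ltac:(lia)) as [L _]. specialize (IH ltac:(lia)). lra. }
  assert (M := Mono i ltac:(lia)).
  exists (s - x i). split; [lra|]. split; [lra|].
  destruct (H i Hi) as [_ (p & dp & P1 & P2 & P3)].
  exists p, dp. split; [exact P1|]. split; [exact P2|].
  intros y Hy. apply P3. lra.
Qed.

Lemma is_derive_Cderiv (p : R -> C) (s : R) (l : C) :
  @is_derive R_AbsRing C_R_NormedModule p s l -> Cderiv p s l.
Proof.
  intros H. split.
  - apply (filterdiff_comp' (U := R_NormedModule) (V := C_R_NormedModule) (W := R_NormedModule)
      p fst s (fun y => scal y l) fst); [exact H|].
    apply filterdiff_linear. apply (is_linear_fst (U := R_NormedModule) (V := R_NormedModule)).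
  - apply (filterdiff_comp' (U := R_NormedModule) (V := C_R_NormedModule) (W := R_NormedModule)
      p snd s (fun y => scal y l) snd); [exact H|].
    apply filterdiff_linear. apply (is_linear_snd (U := R_NormedModule) (V := R_NormedModule)).
Qed.

Lemma is_derive_continuous_C (p : R -> C) (s : R) (l : C) :
  @is_derive R_AbsRing C_R_NormedModule p s l ->
  Ccontinuous p s.
Proof. intros H. exact (Cderiv_continuous _ _ _ (is_derive_Cderiv _ _ _ H)). Qed.

Lemma Cderive_locally (gamma p : R -> C) (s : R) (l : C) :
  Cderiv p s l -> locally s (fun x => p x = gamma x) -> Cderive gamma s = l.
Proof.
  intros [H1 H2] L. apply C_ext; apply is_derive_unique.
  - apply is_derive_ext_loc with (2 := H1). generalize L. apply filter_imp.
    intros x ->. reflexivity.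
  - apply is_derive_ext_loc with (2 := H2). generalize L. apply filter_imp.
    intros x ->. reflexivity.
Qed.

Lemma locally_interval (a b s : R) (P : R -> Prop) : a < s < b ->
  (forall x, a < x < b -> P x) -> locally s P.
Proof.
  intros Hs H. apply locally_Rabs. exists (Rmin (s - a) (b - s)).
  split; [apply Rmin_glb_lt; lra|]. intros y Hy. apply H.
  assert (H1 := Rlt_le_trans _ _ _ Hy (Rmin_l _ _)).
  assert (H2 := Rlt_le_trans _ _ _ Hy (Rmin_r _ _)).
  apply Rabs_def2 in H1. apply Rabs_def2 in H2. lra.
Qed.

Lemma Cderive_smooth_arc (gamma p dp : R -> C) (a b s : R) :
  (forall s, @is_derive R_AbsRing C_R_NormedModule p s (dp s)) ->
  (forall s, a <= s <= b -> p s = gamma s) -> a < s < b -> Cderive gamma s = dp s.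
Proof.
  intros P1 P3 Hs. apply Cderive_locally with p; [apply is_derive_Cderiv, P1|].
  apply locally_interval with a b; [exact Hs|]. intros x Hx. apply P3. lra.
Qed.

Lemma curve_limit_right (gamma : R -> C) (s : R) : piecewise_smooth gamma -> 0 <= s < 1 ->
  filterlim gamma (at_right s) (@locally C_UniformSpace (gamma s)).
Proof.
  intros H Hs.
  destruct (piecewise_smooth_right gamma H s Hs) as (d & Hd & _ & p & dp & P1 & _ & P3).
  assert (Cp := is_derive_continuous_C _ _ _ (P1 s)).
  apply (filterlim_Cmod (at_right s)). intros e He.
  destruct (proj1 (locally_Rabs _ _) (proj1 (continuous_Cmod _ _) Cp e He)) as [r [Hr L]].
  apply locally_Rabs. exists (Rmin r d). split; [apply Rmin_glb_lt; assumption|].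
  intros y Hy Dy.
  assert (H1 := Rlt_le_trans _ _ _ Hy (Rmin_l _ _)).
  assert (H2 := Rlt_le_trans _ _ _ Hy (Rmin_r _ _)). apply Rabs_def2 in H2.
  rewrite <- (proj1 (P3 y ltac:(lra))), <- (proj1 (P3 s ltac:(lra))). apply L, H1.
Qed.

Lemma curve_limit_left (gamma : R -> C) (s : R) : piecewise_smooth gamma -> 0 < s <= 1 ->
  filterlim gamma (at_left s) (@locally C_UniformSpace (gamma s)).
Proof.
  intros H Hs.
  destruct (piecewise_smooth_left gamma H s Hs) as (d & Hd & _ & p & dp & P1 & _ & P3).
  assert (Cp := is_derive_continuous_C _ _ _ (P1 s)).
  apply (filterlim_Cmod (at_left s)). intros e He.
  destruct (proj1 (locally_Rabs _ _) (proj1 (continuous_Cmod _ _) Cp e He)) as [r [Hr L]].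
  apply locally_Rabs. exists (Rmin r d). split; [apply Rmin_glb_lt; assumption|].
  intros y Hy Dy.
  assert (H1 := Rlt_le_trans _ _ _ Hy (Rmin_l _ _)).
  assert (H2 := Rlt_le_trans _ _ _ Hy (Rmin_r _ _)). apply Rabs_def2 in H2.
  rewrite <- (proj1 (P3 y ltac:(lra))), <- (proj1 (P3 s ltac:(lra))). apply L, H1.
Qed.

Lemma continuous_curve_clamp (gamma : R -> C) (s : R) : piecewise_smooth gamma -> 0 <= s <= 1 ->
  Ccontinuous (fun x => gamma (clamp 0 1 x)) s.
Proof.
  intros H Hs. apply continuous_Cmod. intros e He.
  rewrite (clamp_id 0 1 s) by lra.
  assert (Rt : exists d, 0 < d /\ forall y, s < y < s + d -> Cmod (gamma (clamp 0 1 y) - gamma s) < e).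
  { destruct (Req_dec s 1) as [->|N].
    - exists 1. split; [lra|]. intros y Hy.
      replace (clamp 0 1 y) with 1 by (unfold clamp, Rmax, Rmin; repeat destruct Rle_dec; lra).
      replace (gamma 1 - gamma 1)%C with (RtoC 0) by ring. rewrite Cmod_0. exact He.
    - destruct (proj1 (locally_Rabs _ _)
        (proj1 (filterlim_Cmod (at_right s) _ _) (curve_limit_right gamma s H ltac:(lra)) e He))
        as [d [Hd L]].
      exists (Rmin d (1 - s)). split; [apply Rmin_glb_lt; lra|]. intros y Hy.
      assert (B1 := Rmin_l d (1 - s)). assert (B2 := Rmin_r d (1 - s)).
      rewrite clamp_id by lra. apply L; [apply Rabs_def1|]; lra. }
  assert (Lt : exists d, 0 < d /\ forall y, s - d < y < s -> Cmod (gamma (clamp 0 1 y) - gamma s) < e).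
  { destruct (Req_dec s 0) as [->|N].
    - exists 1. split; [lra|]. intros y Hy.
      replace (clamp 0 1 y) with 0 by (unfold clamp, Rmax, Rmin; repeat destruct Rle_dec; lra).
      replace (gamma 0 - gamma 0)%C with (RtoC 0) by ring. rewrite Cmod_0. exact He.
    - destruct (proj1 (locally_Rabs _ _)
        (proj1 (filterlim_Cmod (at_left s) _ _) (curve_limit_left gamma s H ltac:(lra)) e He))
        as [d [Hd L]].
      exists (Rmin d s). split; [apply Rmin_glb_lt; lra|]. intros y Hy.
      assert (B1 := Rmin_l d s). assert (B2 := Rmin_r d s).
      rewrite clamp_id by lra. apply L; [apply Rabs_def1|]; lra. }
  destruct Rt as [d [Hd Rt]], Lt as [d' [Hd' Lt]].
  apply (locally_interval (s - d') (s + d)); [lra|]. intros y Hy.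
  destruct (Rtotal_order y s) as [L|[->|L]].
  - apply Lt. lra.
  - rewrite clamp_id by lra. replace (gamma s - gamma s)%C with (RtoC 0) by ring.
    rewrite Cmod_0. exact He.
  - apply Rt. lra.
Qed.

Lemma continuous_curve (gamma : R -> C) (s : R) : piecewise_smooth gamma -> 0 < s < 1 ->
  Ccontinuous gamma s.
Proof.
  intros H Hs.
  apply (continuous_ext_loc (T := R_UniformSpace) (U := C_UniformSpace) _
    (fun x => gamma (clamp 0 1 x))).
  - apply locally_interval with 0 1; [exact Hs|]. intros x Hx. rewrite clamp_id by lra. reflexivity.
  - apply continuous_curve_clamp; [exact H | lra].
Qed.

Lemma one_sided_continuous_kernel_right (gamma : R -> C) (psi : C -> C) (s e : R) :
  piecewise_smooth gamma -> 0 <= s < 1 -> 0 < e ->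
  (forall x, s <= x <= s + e -> x <= 1 -> @continuous C_UniformSpace C_UniformSpace psi (gamma x)) ->
  one_sided_continuous (Rlt s) (fun x => Cderive gamma x * psi (gamma x))%C s.
Proof.
  intros H Hs He Hpsi.
  destruct (piecewise_smooth_right gamma H s Hs) as (d & Hd & Hd1 & p & dp & P1 & P2 & P3).
  assert (K : forall x, s <= x <= s + d -> x <= s + e ->
    Ccontinuous (fun x => dp x * psi (p x))%C x).
  { intros x Hx Hx'. apply continuous_Cmult; [apply P2|].
    apply (continuous_comp (U := R_UniformSpace) (V := C_UniformSpace) (W := C_UniformSpace) p psi).
    - apply is_derive_continuous_C with (dp x), P1.
    - rewrite (proj1 (P3 x Hx)). apply Hpsi; lra. }
  exists (fun x => dp x * psi (p x))%C, (Rmin d e).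
  split; [apply Rmin_glb_lt; assumption|]. split; [apply K; lra|].
  intros x Dx Hx.
  assert (H1 := Rlt_le_trans _ _ _ Hx (Rmin_l _ _)). apply Rabs_def2 in H1.
  assert (H2 := Rlt_le_trans _ _ _ Hx (Rmin_r _ _)). apply Rabs_def2 in H2.
  split; [apply K; lra|].
  rewrite (Cderive_smooth_arc gamma p dp s (s + d)).
  - rewrite (proj1 (P3 x ltac:(lra))). reflexivity.
  - exact P1.
  - intros y Hy. apply P3, Hy.
  - lra.
Qed.

Lemma one_sided_continuous_kernel_left (gamma : R -> C) (psi : C -> C) (s e : R) :
  piecewise_smooth gamma -> 0 < s <= 1 -> 0 < e ->
  (forall x, s - e <= x <= s -> 0 <= x -> @continuous C_UniformSpace C_UniformSpace psi (gamma x)) ->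
  one_sided_continuous (Rgt s) (fun x => Cderive gamma x * psi (gamma x))%C s.
Proof.
  intros H Hs He Hpsi.
  destruct (piecewise_smooth_left gamma H s Hs) as (d & Hd & Hd1 & p & dp & P1 & P2 & P3).
  assert (K : forall x, s - d <= x <= s -> s - e <= x ->
    Ccontinuous (fun x => dp x * psi (p x))%C x).
  { intros x Hx Hx'. apply continuous_Cmult; [apply P2|].
    apply (continuous_comp (U := R_UniformSpace) (V := C_UniformSpace) (W := C_UniformSpace) p psi).
    - apply is_derive_continuous_C with (dp x), P1.
    - rewrite (proj1 (P3 x Hx)). apply Hpsi; lra. }
  exists (fun x => dp x * psi (p x))%C, (Rmin d e).
  split; [apply Rmin_glb_lt; assumption|]. split; [apply K; lra|].
  intros x Dx Hx.
  assert (H1 := Rlt_le_trans _ _ _ Hx (Rmin_l _ _)). apply Rabs_def2 in H1.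
  assert (H2 := Rlt_le_trans _ _ _ Hx (Rmin_r _ _)). apply Rabs_def2 in H2.
  split; [apply K; lra|].
  rewrite (Cderive_smooth_arc gamma p dp (s - d) s).
  - rewrite (proj1 (P3 x ltac:(lra))). reflexivity.
  - exact P1.
  - intros y Hy. apply P3, Hy.
  - lra.
Qed.

Lemma ex_CInt_curve (gamma : R -> C) (g psi : C -> C) (a b : R) :
  piecewise_smooth gamma -> no_poles_on_curve gamma g -> 0 <= a <= b -> b <= 1 ->
  (forall x, a <= x <= b -> @continuous C_UniformSpace C_UniformSpace psi (gamma x)) ->
  ex_CInt (fun x => g (gamma x) * (Cderive gamma x * psi (gamma x)))%C a b.
Proof.
  intros H [Nr Nl] Ha Hb Hpsi.
  apply ex_CInt_piecewise; [lra | |]; intros s Hs; apply one_sided_continuous_mult.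
  - apply one_sided_continuous_puiseux.
    + intros x. apply Rlt_dec.
    + intros x Hx. apply (locally_interval s (x + 1)); [lra|]. intros y Hy. apply Hy.
    + apply Rlt_irrefl.
    + apply curve_limit_right; [exact H | lra].
    + apply Nr. lra.
  - apply one_sided_continuous_kernel_right with (b - s); [exact H | lra | lra |].
    intros x Hx _. apply Hpsi. lra.
  - apply one_sided_continuous_puiseux.
    + intros x. apply Rgt_dec.
    + intros x Hx. apply (locally_interval (x - 1) s); [lra|]. intros y Hy. apply Hy.
    + apply Rlt_irrefl.
    + apply curve_limit_left; [exact H | lra].
    + apply Nl. lra.
  - apply one_sided_continuous_kernel_left with (s - a); [exact H | lra | lra |].
    intros x Hx _. apply Hpsi. lra.
Qed.

(** * Uniformization of the curve near its starting point *)

Local Notation is_Cderive := (@is_derive R_AbsRing C_R_NormedModule).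

Lemma is_Cderive_iff (f : R -> C) (x : R) (l : C) :
  is_Cderive f x l <-> forall e, 0 < e ->
    locally x (fun y => Cmod (f y - f x - RtoC (y - x) * l) <= e * Rabs (y - x)).
Proof.
  split.
  - intros [_ H] e He.
    assert (Hx : is_filter_lim (locally x) x) by (intros P HP; exact HP).
    generalize (H x Hx (mkposreal e He)). apply filter_imp. intros y Hy.
    rewrite <- scal_R_Cmult, Cmod_norm. exact Hy.
  - intros H. split; [apply (is_linear_scal_l (V := C_R_NormedModule))|].
    intros x' Hx'. apply (is_filter_lim_locally_unique (V := R_NormedModule)) in Hx'. subst x'.
    intros e. generalize (H e (cond_pos e)). apply filter_imp. intros y Hy.
    rewrite <- scal_R_Cmult, Cmod_norm in Hy. exact Hy.
Qed.

Lemma is_Cderive_factor (f P w : R -> C) (x : R) (l : C) :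
  is_Cderive P x l -> Ccontinuous w x ->
  locally x (fun y => f y - f x = (P y - P x) * w y)%C ->
  is_Cderive f x (l * w x)%C.
Proof.
  intros HP Hw Hf. apply is_Cderive_iff. intros e He.
  set (B := Cmod (w x) + 1). assert (HB : 0 < B).
  { unfold B. assert (T := Cmod_ge_0 (w x)). lra. }
  set (K := Cmod l + 1). assert (HK : 0 < K).
  { unfold K. assert (T := Cmod_ge_0 l). lra. }
  assert (E1 : 0 < e / (2 * B)) by (apply Rdiv_lt_0_compat; lra).
  assert (E2 : 0 < e / (2 * K)) by (apply Rdiv_lt_0_compat; lra).
  assert (A1 := proj1 (is_Cderive_iff P x l) HP _ E1).
  assert (A2 := proj1 (continuous_Cmod w x) Hw _ E2).
  assert (A3 := proj1 (continuous_Cmod w x) Hw _ Rlt_0_1).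
  generalize (filter_and _ _ (filter_and _ _ A1 A2) (filter_and _ _ A3 Hf)).
  apply filter_imp. intros y [[B1 B2] [B3 E]].
  rewrite E.
  replace ((P y - P x) * w y - RtoC (y - x) * (l * w x))%C
    with ((P y - P x - RtoC (y - x) * l) * w y + RtoC (y - x) * (l * (w y - w x)))%C by ring.
  eapply Rle_trans; [apply Cmod_triangle|].
  rewrite !Cmod_mult, Cmod_R.
  assert (W : Cmod (w y) <= B).
  { replace (w y) with ((w y - w x) + w x)%C by ring.
    eapply Rle_trans; [apply Cmod_triangle|]. unfold B. lra. }
  assert (R0 := Rabs_pos (y - x)).
  apply Rle_trans with (e / (2 * B) * Rabs (y - x) * B + Rabs (y - x) * (K * (e / (2 * K)))).
  - apply Rplus_le_compat.
    + apply Rmult_le_compat; auto using Cmod_ge_0.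
    + apply Rmult_le_compat_l; [exact R0|].
      apply Rmult_le_compat; auto using Cmod_ge_0; [unfold K |]; lra.
  - right. field. lra.
Qed.

Lemma sum_n_continuous_C (f : nat -> R -> C) (m : nat) (x : R) :
  (forall i, Ccontinuous (f i) x) ->
  Ccontinuous (fun y => sum_n (fun i => f i y) m) x.
Proof.
  intros H. induction m as [|m IH].
  - apply (continuous_ext (T := R_UniformSpace) (U := C_UniformSpace) (f 0%nat)); [|apply H].
    intros y. rewrite sum_O. reflexivity.
  - apply (continuous_ext (T := R_UniformSpace) (U := C_UniformSpace)
      (fun y => sum_n (fun i => f i y) m + f (S m) y)%C).
    + intros y. rewrite sum_n_C_S. reflexivity.
    + apply continuous_Cplus; [exact IH | apply H].
Qed.

(** Factoring the difference of two [n]-th powers, the increment of [q] is that of [P]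
    divided by a sum that tends to [n * q x ^ (n - 1)]. *)
Lemma is_Cderive_root (q P : R -> C) (x : R) (l : C) (m : nat) :
  Ccontinuous q x -> q x <> 0%C ->
  locally x (fun y => (q y ^ S m)%C = P y) -> is_Cderive P x l ->
  is_Cderive q x (l / (RtoC (INR (S m)) * q x ^ m))%C.
Proof.
  intros Hq Nq Hl HP.
  set (w := fun y : R => sum_n (fun i => q y ^ (m - i) * q x ^ i)%C m).
  assert (Cw : Ccontinuous w x).
  { apply (sum_n_continuous_C (fun i y => q y ^ (m - i) * q x ^ i)%C). intros i.
    apply continuous_Cmult; [apply continuous_Cpow, Hq | apply continuous_Cconst]. }
  assert (Wx : w x = (RtoC (INR (S m)) * q x ^ m)%C).
  { unfold w. rewrite (sum_n_ext_loc _ (fun _ => q x ^ m)%C), sum_n_C_const; [reflexivity|].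
    intros i Hi. rewrite <- Cpow_add_r. f_equal. lia. }
  change (R -> C) in (type of w). assert (Nw : w x <> RtoC 0).
  { rewrite Wx. apply Cmult_neq_0; [apply INR_C_neq_0; lia | apply Cpow_nz, Nq]. }
  unfold Cdiv. rewrite <- Wx.
  apply (is_Cderive_factor q P (fun y => / w y)%C x l HP).
  - apply continuous_Cinv; assumption.
  - assert (Px := locally_singleton _ _ Hl). cbv beta in Px.
    generalize (filter_and _ _ Hl (locally_neq w x (RtoC 0) Cw Nw)). apply filter_imp.
    intros y [E N]. rewrite <- E, <- Px.
    assert (F := Cpow_sub_factor (q y) (q x) m). fold (w y) in F.
    rewrite <- F. field. exact N.
Qed.

Definition principal_log (w : C) : C := (ln (Cmod w), atan (Im w / Re w)).

Lemma Cexp_principal_log (w : C) : 0 < Re w -> Cexp (principal_log w) = w.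
Proof.
  intros H.
  assert (P : 0 < Cmod w) by (assert (T := Re_le_Cmod w); lra).
  assert (S : sqrt (1 + (Im w / Re w) ^ 2) = Cmod w / Re w).
  { replace (1 + (Im w / Re w) ^ 2) with ((Cmod w / Re w) ^ 2).
    - apply sqrt_pow2. left. apply Rdiv_lt_0_compat; assumption.
    - replace ((Cmod w / Re w) ^ 2) with (Cmod w ^ 2 / Re w ^ 2) by (field; lra).
      rewrite Cmod2_alt. field. lra. }
  unfold principal_log. apply C_ext; unfold Cexp; cbn [Re Im fst snd];
    rewrite exp_ln by exact P.
  - rewrite cos_atan. unfold Rsqr. 
    replace (Im w / Re w * (Im w / Re w)) with ((Im w / Re w) ^ 2) by ring.
    rewrite S. field. lra.
  - rewrite sin_atan. unfold Rsqr.
    replace (Im w / Re w * (Im w / Re w)) with ((Im w / Re w) ^ 2) by ring.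
    rewrite S. field. lra.
Qed.

Lemma continuous_principal_log (f : R -> C) (x : R) :
  Ccontinuous f x -> 0 < Re (f x) ->
  Ccontinuous (fun y => principal_log (f y)) x.
Proof.
  intros Hf H.
  apply continuous_C; unfold principal_log; cbn [Re Im fst snd].
  - apply (continuous_comp (fun y => Cmod (f y)) ln).
    + apply continuous_Cmod_comp, Hf.
    + apply (ex_derive_continuous (V := R_NormedModule)). eexists. apply is_derive_ln.
      assert (T := Re_le_Cmod (f x)). lra.
  - apply (continuous_comp (fun y => Im (f y) / Re (f y)) atan).
    + apply (continuous_mult (K := R_AbsRing)).
      * apply continuous_Im, Hf.
      * apply (continuous_comp (fun y => Re (f y)) Rinv); [apply continuous_Re, Hf|].
        apply continuous_Rinv. lra.
    + apply continuous_atan.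
Qed.

Definition chord_slope (p dp : R -> C) (s : R) : C :=
  if Req_dec_T s 0 then dp 0 else ((p s - p 0) / RtoC s)%C.

Lemma chord_slope_neq_0 (p dp : R -> C) (s : R) : s <> 0 ->
  chord_slope p dp s = ((p s - p 0) / RtoC s)%C.
Proof. intros H. unfold chord_slope. destruct (Req_dec_T s 0); [contradiction | reflexivity]. Qed.

Lemma chord_slope_0 (p dp : R -> C) : chord_slope p dp 0 = dp 0.
Proof. unfold chord_slope. destruct (Req_dec_T 0 0); [reflexivity | congruence]. Qed.

Lemma continuous_chord_slope (p dp : R -> C) (s : R) :
  (forall s, is_Cderive p s (dp s)) ->
  Ccontinuous (chord_slope p dp) s.
Proof.
  intros H. destruct (Req_dec s 0) as [->|N].
  - apply continuous_Cmod. intros e He.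
    assert (E := proj1 (is_Cderive_iff _ _ _) (H 0) (e / 2) ltac:(lra)).
    generalize E. apply filter_imp. intros y Hy.
    rewrite chord_slope_0.
    destruct (Req_dec y 0) as [->|Ny].
    + rewrite chord_slope_0. replace (dp 0 - dp 0)%C with (RtoC 0) by ring.
      rewrite Cmod_0. exact He.
    + rewrite chord_slope_neq_0 by exact Ny.
      assert (Nc : RtoC y <> 0%C) by (intros F; apply RtoC_inj in F; contradiction).
      rewrite Rminus_0_r in Hy.
      replace ((p y - p 0) / RtoC y - dp 0)%C with ((p y - p 0 - RtoC y * dp 0) / RtoC y)%C
        by (field; exact Nc).
      rewrite Cmod_div, Cmod_R by exact Nc.
      assert (Py : 0 < Rabs y) by (apply Rabs_pos_lt, Ny).
      apply Rmult_lt_reg_r with (1 := Py).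
      unfold Rdiv. rewrite Rmult_assoc, Rinv_l by lra. nra.
  - apply (continuous_ext_loc (T := R_UniformSpace) (U := C_UniformSpace) _
      (fun s => (p s - p 0) / RtoC s)%C).
    + apply locally_Rabs. exists (Rabs s). split; [apply Rabs_pos_lt, N|].
      intros y Hy. symmetry. apply chord_slope_neq_0. intros ->.
      rewrite Rminus_0_l, Rabs_Ropp in Hy. lra.
    + apply continuous_Cdiv.
      * apply continuous_Cminus; [|apply continuous_Cconst].
        exact (is_derive_continuous_C _ _ _ (H s)).
      * apply continuous_RtoC, continuous_id.
      * intros F. apply RtoC_inj in F. contradiction.
Qed.

(** The derivative of the squared distance to [p 0] at [s] is [2 * s] times a
    quantity that tends to [Cmod (dp 0) ^ 2]. *)
Lemma distance_increasing (p dp : R -> C) :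
  (forall s, is_Cderive p s (dp s)) ->
  (forall s, Ccontinuous dp s) -> dp 0 <> 0%C ->
  exists d, 0 < d /\ forall s s', 0 <= s < s' -> s' < d ->
    Cmod (p s - p 0) < Cmod (p s' - p 0).
Proof.
  intros H Hd N.
  set (v := chord_slope p dp).
  assert (Cr : continuous (fun s => Re (v s * Cconj (dp s))%C) 0).
  { apply continuous_Re, continuous_Cmult; [apply continuous_chord_slope, H|].
    apply continuous_C; simpl; [apply continuous_Re, Hd|].
    apply (continuous_opp (V := R_NormedModule)), continuous_Im, Hd. }
  assert (P0 : 0 < Re (v 0 * Cconj (dp 0))%C).
  { unfold v. rewrite chord_slope_0. apply Cmod_gt_0 in N.
    assert (M := Cmod2_alt (dp 0)). unfold Re, Im in *. simpl in *. nra. }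
  assert (L := proj1 (filterlim_locally _ _) Cr (mkposreal _ P0)).
  apply locally_Rabs in L. destruct L as [d [Hd0 L]].
  exists d. split; [exact Hd0|]. intros s s' Hs Hs'.
  set (f := fun s => Re (p s - p 0)%C ^ 2 + Im (p s - p 0)%C ^ 2).
  set (f' := fun s => 2 * (Re (p s - p 0)%C * Re (dp s) + Im (p s - p 0)%C * Im (dp s))).
  assert (D : forall c, is_derive f c (f' c)).
  { intros c. destruct (is_derive_Cderiv _ _ _ (H c)) as [D1 D2].
    assert (E1 : is_derive (fun s => Re (p s - p 0)%C) c (Re (dp c))).
    { apply (is_derive_ext (fun s => Re (p s) + - Re (p 0))); [reflexivity|].
      replace (Re (dp c)) with (Re (dp c) + 0) by ring.
      apply (is_derive_plus (V := R_NormedModule)); [exact D1 | apply (is_derive_const (V := R_NormedModule))]. }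
    assert (E2 : is_derive (fun s => Im (p s - p 0)%C) c (Im (dp c))).
    { apply (is_derive_ext (fun s => Im (p s) + - Im (p 0))); [reflexivity|].
      replace (Im (dp c)) with (Im (dp c) + 0) by ring.
      apply (is_derive_plus (V := R_NormedModule)); [exact D2 | apply (is_derive_const (V := R_NormedModule))]. }
    assert (B := is_derive_plus _ _ _ _ _ (is_derive_pow _ 2 _ _ E1) (is_derive_pow _ 2 _ _ E2)).
    unfold f, f'.
    match type of B with is_derive _ _ ?l => match goal with |- is_derive _ _ ?r =>
      replace r with l; [exact B|] end end.
    unfold plus; simpl. ring. }
  destruct (MVT_cor2 f f' s s' (proj2 Hs)) as [c [E Hc]].
  { intros c _. apply is_derive_Reals, D. }
  assert (Pc : 0 < f' c).
  { assert (Lc := L c ltac:(rewrite Rminus_0_r, Rabs_pos_eq; lra)).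
    change (Rabs (Re (v c * Cconj (dp c))%C - Re (v 0 * Cconj (dp 0))%C)
      < Re (v 0 * Cconj (dp 0))%C) in Lc.
    apply Rabs_def2 in Lc.
    assert (Q : f' c = 2 * (c * Re (v c * Cconj (dp c))%C)).
    { unfold f'. replace (p c - p 0)%C with (RtoC c * v c)%C.
      - unfold Re, Im. simpl. ring.
      - unfold v. rewrite chord_slope_neq_0 by lra. field.
        intros F. apply RtoC_inj in F. lra. }
    rewrite Q. assert (0 < Re (v c * Cconj (dp c))%C) by lra.
    assert (0 < c) by lra. nra. }
  assert (F : f s < f s') by nra.
  apply Rnot_le_lt. intros Le. apply (Rlt_not_le _ _ F).
  unfold f. rewrite <- !Cmod2_alt. apply pow_incr. split; [apply Cmod_ge_0 | exact Le].
Qed.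

Lemma exists_root_below (e : R) (n : nat) : 0 < e -> (0 < n)%nat ->
  exists b, 0 < b /\ b ^ n < e /\ b < e.
Proof.
  intros He Hn. set (b := Rmin (e / 2) (1 / 2)).
  assert (B1 := Rmin_l (e / 2) (1 / 2) : b <= _). assert (B2 := Rmin_r (e / 2) (1 / 2) : b <= _).
  assert (B0 : 0 < b) by (apply Rmin_glb_lt; lra).
  exists b. split; [exact B0|]. split; [|lra].
  destruct n as [|n]; [lia|]. simpl.
  assert (b ^ n <= 1) by (rewrite <- (pow1 n); apply pow_incr; lra).
  assert (0 < b ^ n) by (apply pow_lt, B0). nra.
Qed.

(** [(p s - p 0) / s] extends continuously to [0] with the nonzero value [dp 0], so it
    has a continuous [n]-th root near [0].  With [s = x ^ n], [x] times this root is,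
    up to a constant factor, the branch [H]; this makes the singular factor
    [s ^ (1 / n)] of [H] the smooth factor [x] of [Q]. *)
Lemma root_parametrization (p dp H : R -> C) (m : nat) (e : R) :
  (forall s, is_Cderive p s (dp s)) ->
  (forall s, Ccontinuous dp s) -> dp 0 <> 0%C -> 0 < e ->
  (forall s, 0 < s < e -> Ccontinuous H s) ->
  (forall s, 0 < s < e -> (H s ^ S m)%C = (p s - p 0)%C) ->
  exists (b : R) (Q dQ : R -> C), 0 < b /\ b ^ S m < e /\
    (forall x, 0 <= x <= b -> Ccontinuous Q x) /\
    (forall x, 0 <= x <= b -> Ccontinuous dQ x) /\
    (forall x, 0 < x < b -> is_Cderive Q x (dQ x)) /\
    Q 0 = 0%C /\ (forall x, 0 < x <= b -> Q x = H (x ^ S m)) /\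
    (forall x, 0 <= x <= b -> (Q x ^ S m)%C = (p (x ^ S m)%R - p 0)%C) /\
    (forall x, 0 < x < b ->
      (RtoC (INR (S m)) * Q x ^ m * dQ x)%C = (RtoC (INR (S m) * x ^ m) * dp (x ^ S m)%R)%C).
Proof.
  intros Hp Hdp N He CH EH.
  set (n := S m) in *.
  assert (Cpow_n : forall x, continuous (fun y : R => y ^ n) x).
  { intros x. apply (ex_derive_continuous (V := R_NormedModule)).
    eexists. apply (is_derive_pow (fun y => y) n x 1). apply (is_derive_id (K := R_AbsRing)). }
  set (W := fun x => (chord_slope p dp (x ^ n) / dp 0)%C).
  assert (CW : forall x, Ccontinuous W x).
  { intros x. apply continuous_Cdiv; [|apply continuous_Cconst | exact N].
    apply (continuous_comp (U := R_UniformSpace) (V := R_UniformSpace) (W := C_UniformSpace)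
      (fun y => y ^ n) (chord_slope p dp)); [apply Cpow_n | apply continuous_chord_slope, Hp]. }
  assert (W0 : W 0 = 1%C).
  { unfold W. rewrite pow_i by (unfold n; lia). rewrite chord_slope_0. field. exact N. }
  destruct (proj1 (locally_Rabs _ _) (proj1 (continuous_Cmod W 0) (CW 0) 1 Rlt_0_1)) as [d [Hd Hpos]].
  assert (RW : forall x, Rabs x < d -> 0 < Re (W x)).
  { intros x Hx. assert (Q := Hpos x ltac:(rewrite Rminus_0_r; exact Hx)).
    rewrite W0 in Q. assert (T := Rabs_Re_le (W x - 1)%C).
    assert (T' := Rle_lt_trans _ _ _ T Q). apply Rabs_def2 in T'.
    change (Re (W x - 1)%C) with (Re (W x) + - (1)) in T'. lra. }
  destruct (exists_root_below (Rmin e d) n) as (b & Hb & Hbn & Hbd);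
    [apply Rmin_glb_lt; assumption | unfold n; lia |].
  assert (Hbe := Rlt_le_trans _ _ _ Hbn (Rmin_l _ _)).
  assert (Hbd' := Rlt_le_trans _ _ _ Hbd (Rmin_r _ _)).
  set (L := fun x => Cexp (/ RtoC (INR n) * principal_log (W x))%C).
  assert (NL : forall x, L x <> 0%C) by (intros; apply Cexp_nz).
  assert (Nn : RtoC (INR n) <> 0%C) by (apply INR_C_neq_0; unfold n; lia).
  assert (CL : forall x, 0 <= x <= b -> Ccontinuous L x).
  { intros x Hx. apply continuous_Cexp, continuous_Cmult; [apply continuous_Cconst|].
    apply continuous_principal_log; [apply CW | apply RW; rewrite Rabs_pos_eq; lra]. }
  assert (EL : forall x, 0 <= x <= b -> (L x ^ n)%C = W x).
  { intros x Hx. unfold L. rewrite Cexp_pow, Cmult_assoc, Cinv_r, Cmult_1_l by exact Nn.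
    apply Cexp_principal_log, RW. rewrite Rabs_pos_eq; lra. }
  assert (Nx : forall x, 0 < x -> RtoC x <> 0%C).
  { intros x Hx F. apply RtoC_inj in F. lra. }
  assert (Pn : forall x, 0 < x <= b -> 0 < x ^ n < e).
  { intros x Hx. split; [apply pow_lt; lra|].
    apply Rle_lt_trans with (2 := Hbe). apply pow_incr. lra. }
  set (f := fun x => (H (x ^ n)%R / (RtoC x * L x))%C).
  assert (Ef : forall x, 0 < x <= b -> (f x ^ n)%C = dp 0).
  { intros x Hx. assert (Px := Pn x Hx). unfold f, Cdiv.
    assert (NxL : (RtoC x * L x)%C <> 0%C) by (apply Cmult_neq_0; [apply Nx; lra | apply NL]).
    rewrite Cpow_mult_l, Cpow_inv by exact NxL.
    rewrite EH by exact Px.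
    rewrite Cpow_mult_l, EL by lra. unfold W. rewrite chord_slope_neq_0 by lra.
    rewrite <- RtoC_pow.
    assert (X1 := Nx _ (proj1 Px)).
    assert (X2 : (p (x ^ n)%R - p 0)%C <> 0%C).
    { rewrite <- EH by exact Px. intros F.
      assert (Z : W x = 0%C).
      { unfold W. rewrite chord_slope_neq_0, <- EH, F by (exact Px || lra).
        field. split; assumption. }
      assert (R0 := RW x ltac:(rewrite Rabs_pos_eq; lra)). rewrite Z in R0. simpl in R0. lra. }
    field. repeat split; assumption. }
  assert (Cf : forall x, 0 < x <= b -> Ccontinuous f x).
  { intros x Hx. apply continuous_Cdiv.
    - apply (continuous_comp (U := R_UniformSpace) (V := R_UniformSpace) (W := C_UniformSpace)
        (fun y => y ^ n) H); [apply Cpow_n | apply CH, Pn, Hx].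
    - apply continuous_Cmult; [apply continuous_RtoC, continuous_id | apply CL; lra].
    - apply Cmult_neq_0; [apply Nx; lra | apply NL]. }
  set (kappa := f b).
  assert (Kf : forall x, 0 < x <= b -> f x = kappa).
  { intros x Hx. unfold kappa.
    replace (f x) with (f (x + 0 * (b - x))) by (f_equal; ring).
    replace (f b) with (f (x + 1 * (b - x))) by (f_equal; ring).
    apply (continuous_root_unique n (fun r => f (x + r * (b - x))) (dp 0)).
    - unfold n; lia.
    - exact N.
    - intros r Hr.
      apply (continuous_comp (U := R_UniformSpace) (V := R_UniformSpace) (W := C_UniformSpace)
        (fun r => x + r * (b - x)) f).
      + apply (ex_derive_continuous (V := R_NormedModule)). auto_derive. exact I.
      + apply Cf. nra.
    - intros r Hr. apply Ef. nra. }
  assert (Nk : kappa <> 0%C).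
  { intros F. apply N. rewrite <- (Ef b) by lra. fold kappa. rewrite F.
    unfold n. rewrite Cpow_S. ring. }
  set (Q := fun x => (RtoC x * (kappa * L x))%C).
  set (dQ := fun x => (dp (x ^ n)%R / (kappa * L x) ^ m)%C).
  assert (NkL : forall x, (kappa * L x)%C <> 0%C) by (intros; apply Cmult_neq_0; auto).
  assert (CQ : forall x, 0 <= x <= b -> Ccontinuous Q x).
  { intros x Hx. apply continuous_Cmult; [apply continuous_RtoC, continuous_id|].
    apply continuous_Cmult; [apply continuous_Cconst | apply CL, Hx]. }
  assert (EQ : forall x, 0 < x <= b -> Q x = H (x ^ n)).
  { intros x Hx. unfold Q. rewrite <- (Kf x Hx). unfold f. field.
    split; [apply NL | apply Nx; lra]. }
  assert (PQ : forall x, 0 <= x <= b -> (Q x ^ n)%C = (p (x ^ n)%R - p 0)%C).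
  { intros x Hx. destruct (Req_dec x 0) as [->|D].
    - unfold Q. rewrite Cmult_0_l, pow_i by (unfold n; lia). unfold n. rewrite Cpow_S. ring.
    - rewrite EQ by lra. apply EH, Pn. lra. }
  assert (DQ : forall x, 0 < x ->
    (RtoC (INR n) * Q x ^ m * dQ x)%C = (RtoC (INR n * x ^ m) * dp (x ^ n)%R)%C).
  { intros x Hx. unfold Q, dQ. rewrite Cpow_mult_l, RtoC_mult, RtoC_pow.
    field. apply Cpow_nz, NkL. }
  exists b, Q, dQ. split; [exact Hb|]. split; [exact Hbe|]. split; [exact CQ|].
  split.
  { intros x Hx. apply continuous_Cdiv.
    - apply (continuous_comp (U := R_UniformSpace) (V := R_UniformSpace) (W := C_UniformSpace)
        (fun y => y ^ n) dp); [apply Cpow_n | apply Hdp].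
    - apply continuous_Cpow, continuous_Cmult; [apply continuous_Cconst | apply CL, Hx].
    - apply Cpow_nz, NkL. }
  split.
  { intros x Hx.
    assert (NQ : Q x <> 0%C) by (apply Cmult_neq_0; [apply Nx; lra | apply NkL]).
    replace (dQ x) with ((RtoC (INR n * x ^ m) * dp (x ^ n)%R) / (RtoC (INR n) * Q x ^ m))%C.
    2: { rewrite <- DQ by lra. field. split; [apply Cpow_nz, NQ | exact Nn]. }
    apply (is_Cderive_root Q (fun y => p (y ^ n)%R - p 0)%C).
    - apply CQ. lra.
    - exact NQ.
    - apply locally_interval with 0 b; [exact Hx|]. intros y Hy. apply PQ. lra.
    - replace (RtoC (INR n * x ^ m) * dp (x ^ n)%R)%C
        with (RtoC (INR n * x ^ m) * dp (x ^ n)%R + 0)%C by ring.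
      apply (is_derive_plus (V := C_R_NormedModule)).
      + rewrite <- scal_R_Cmult.
        apply (is_derive_comp (K := R_AbsRing) (V := C_R_NormedModule) p (fun y => y ^ n) x);
          [apply Hp|].
        replace (INR n * x ^ m) with (INR n * 1 * x ^ pred n) by (unfold n; simpl pred; ring).
        apply (is_derive_pow (fun y => y) n x 1). apply (is_derive_id (K := R_AbsRing)).
      + apply (is_derive_const (V := C_R_NormedModule)). }
  split; [unfold Q; ring|]. split; [exact EQ|]. split; [exact PQ|].
  intros x Hx. apply DQ. lra.
Qed.

(** * The branches [h] and [Log] on the counter-clockwise side *)

(** [f] is only continuous within [D], so [P] has to stay in [D] for all parameters;
    a path given on a segment is clamped to have this property. *)
Lemma continuous_in_path (D : C -> Prop) (f : C -> C) (P : R -> C) (x : R) :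
  continuous_in D f -> (forall y, D (P y)) ->
  Ccontinuous P x ->
  Ccontinuous (fun y => f (P y)) x.
Proof.
  intros Hf HD HP.
  unfold continuous.
  apply (filterlim_comp _ _ _ P f (locally x) (within D (locally (P x))) (locally (f (P x)))).
  - intros A HA. generalize (HP _ HA). unfold filtermap. apply filter_imp.
    intros y Hy. apply Hy, HD.
  - apply Hf, HD.
Qed.

Lemma continuous_in_path_segment (D : C -> Prop) (f : C -> C) (P : R -> C) (a b x : R) :
  a < x < b -> continuous_in D f -> (forall y, a < y < b -> D (P y)) ->
  (forall y, a < y < b -> Ccontinuous P y) ->
  Ccontinuous (fun y => f (P y)) x.
Proof.
  intros Hx Hf HD HP.
  set (a' := (a + x) / 2). set (b' := (x + b) / 2).
  assert (R' : forall y, a < clamp a' b' y < b).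
  { intros y. assert (T := clamp_range a' b' y ltac:(unfold a', b'; lra)).
    unfold a', b' in *. lra. }
  apply (continuous_ext_loc (T := R_UniformSpace) (U := C_UniformSpace) _
    (fun y => f (P (clamp a' b' y)))).
  - apply locally_interval with a' b'; [unfold a', b'; lra|].
    intros y Hy. rewrite clamp_id by lra. reflexivity.
  - apply (continuous_in_path D f (fun y => P (clamp a' b' y))); [exact Hf| |].
    + intros y. apply HD, R'.
    + apply (continuous_comp (U := R_UniformSpace) (V := R_UniformSpace) (W := C_UniformSpace)
        (clamp a' b') P); [apply continuous_clamp; unfold a', b'; lra|].
      apply HP, R'.
Qed.

Lemma rotation_pow (n : nat) (x : R) : (0 < n)%nat ->
  (Cexp (RtoC (x / INR n) * Ci) ^ n)%C = Cexp (RtoC x * Ci).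
Proof.
  intros H. rewrite Cexp_pow. f_equal. rewrite RtoC_div by (apply lt_0_INR in H; lra).
  field. apply INR_C_neq_0, H.
Qed.

Lemma continuous_rotation (f : R -> R) (x : R) : continuous f x ->
  Ccontinuous (fun y => Cexp (RtoC (f y) * Ci)) x.
Proof.
  intros H. apply continuous_Cexp, continuous_Cmult; [|apply continuous_Cconst].
  apply continuous_RtoC, H.
Qed.

(** In the coordinates [(sigma, alpha)] the point of the plane winds around
    [gamma 0] from the curve without crossing it again, so continuity determines
    [h] and [Log] from their values on the curve. *)
Lemma ccw_side_branches (gamma : R -> C) (n : nat) (eta : R) (Vg : C -> Prop)
    (h Log : C -> C) (t : C) :
  piecewise_smooth gamma -> (forall s, 0 < s <= 1 -> gamma s <> gamma 0) ->
  (0 < n)%nat -> eta <= 1 -> (forall s, 0 < s < eta -> Vg (gamma s)) ->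
  root_branch n (gamma 0) Vg h ->
  log_branch (fun w => ccw_side gamma eta Vg (gamma 0 + w)%C \/
                       initial_part gamma eta (gamma 0 + w)%C) Log ->
  ccw_side gamma eta Vg t ->
  exists s alpha : R, 0 < s < eta /\ 0 < alpha < 2 * PI /\
    t = rotate (gamma 0) alpha (gamma s) /\
    h t = (Cexp (RtoC (alpha / INR n) * Ci) * h (gamma s))%C /\
    Log (t - gamma 0)%C = (RtoC alpha * Ci + Log (gamma s - gamma 0))%C.
Proof.
  intros Hg Once Hn He HV [Ch Eh] [CL EL] (sigma & alpha & Cs & Ca & A0 & Ap & Sp & ->).
  set (P := fun x => rotate (gamma 0) (alpha x) (gamma (sigma x))).
  exists (sigma 1), (alpha 1).
  split; [apply (Sp 1); lra|]. split; [apply Ap; lra|]. split; [reflexivity|].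
  assert (Cg : forall x, 0 <= x <= 1 ->
    Ccontinuous (fun x => gamma (sigma x)) x).
  { intros x Hx. destruct (Sp x Hx) as [S1 _].
    apply (continuous_comp (U := R_UniformSpace) (V := R_UniformSpace) (W := C_UniformSpace)
      sigma gamma); [apply Cs | apply continuous_curve; [exact Hg | lra]]. }
  assert (N : forall x, 0 <= x <= 1 -> (gamma (sigma x) - gamma 0)%C <> 0%C).
  { intros x Hx. destruct (Sp x Hx) as [S1 _]. apply Cminus_eq_contra, Once. lra. }
  assert (CP : forall x, 0 <= x <= 1 -> Ccontinuous P x).
  { intros x Hx. apply continuous_Cplus; [apply continuous_Cconst|].
    apply continuous_Cmult; [apply continuous_rotation, Ca|].
    apply continuous_Cminus; [apply Cg, Hx | apply continuous_Cconst]. }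
  assert (P0 : P 0 = gamma (sigma 0)).
  { unfold P, rotate. rewrite A0, Cmult_0_l, Cexp_0. ring. }
  set (c := clamp 0 1).
  assert (Rc : forall x, 0 <= c x <= 1) by (intros; apply clamp_range; lra).
  assert (c0 : c 0 = 0) by (apply clamp_id; lra).
  assert (c1 : c 1 = 1) by (apply clamp_id; lra).
  assert (Cc : forall x, continuous c x) by (intros; apply continuous_clamp; lra).
  assert (comp : forall (f : R -> C), (forall x, 0 <= x <= 1 ->
      Ccontinuous f x) ->
    forall x, Ccontinuous (fun y => f (c y)) x).
  { intros f Hf x. apply (continuous_comp (U := R_UniformSpace) (V := R_UniformSpace)
      (W := C_UniformSpace) c f); [apply Cc | apply Hf, Rc]. }
  assert (compR : forall x, continuous (fun y => alpha (c y)) x).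
  { intros x. apply (continuous_comp c alpha); [apply Cc | apply Ca]. }
  assert (CPc := comp _ CP). assert (Cgc := comp _ Cg).
  assert (VP : forall x, Vg (P (c x))) by (intros x; apply (Sp (c x)), Rc).
  assert (Vs : forall x, Vg (gamma (sigma (c x)))) by (intros x; apply HV, (Sp (c x)), Rc).
  assert (Hroot : forall z, Vg z -> z <> gamma 0 -> h z <> 0%C).
  { intros z Hz D E. apply (Cminus_eq_contra _ _ D). rewrite <- (Eh z Hz), E.
    destruct n as [|m]; [lia|]. rewrite Cpow_S. ring. }
  assert (Ns : forall x, h (gamma (sigma (c x))) <> 0%C).
  { intros x. apply Hroot; [apply Vs|]. destruct (Sp (c x) (Rc x)) as [S1 _]. apply Once. lra. }
  split.
  - set (f := fun x => (h (P (c x)) / (Cexp (RtoC (alpha (c x) / INR n) * Ci)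
       * h (gamma (sigma (c x)))))%C).
    assert (Nd : forall x, (Cexp (RtoC (alpha (c x) / INR n) * Ci) * h (gamma (sigma (c x))))%C <> 0%C).
    { intros x. apply Cmult_neq_0; [apply Cexp_nz | apply Ns]. }
    assert (F : f 0 = f 1).
    { apply (continuous_root_unique n f 1); [exact Hn | exact C1_nz | |].
      - intros x _. apply continuous_Cdiv; [| |apply Nd].
        + apply (continuous_in_path Vg h (fun x => P (c x))); auto.
        + apply continuous_Cmult.
          * apply (continuous_rotation (fun x => alpha (c x) / INR n)).
            apply (continuous_mult (K := R_AbsRing) (fun x => alpha (c x)) (fun _ => / INR n));
              [apply compR | apply continuous_const].
          * apply (continuous_in_path Vg h (fun x => gamma (sigma (c x)))); auto.
      - intros x _. unfold f, Cdiv. rewrite Cpow_mult_l, Cpow_inv by apply Nd.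
        rewrite Cpow_mult_l, rotation_pow by exact Hn. rewrite !Eh by auto.
        unfold P, rotate.
        assert (E := Cexp_nz (RtoC (alpha (c x)) * Ci)). assert (N' := N (c x) (Rc x)).
        field. split; assumption. }
    unfold f in F. rewrite c0, c1 in F.
    assert (Ns0 := Ns 0). assert (Nd1 := Nd 1). rewrite c0 in Ns0. rewrite c1 in Nd1.
    rewrite P0, A0 in F.
    replace (0 / INR n) with 0 in F by (unfold Rdiv; ring).
    rewrite Cmult_0_l, Cexp_0, Cmult_1_l in F.
    unfold Cdiv in F at 1. rewrite Cinv_r in F by exact Ns0.
    change (h (P 1) = Cexp (RtoC (alpha 1 / INR n) * Ci) * h (gamma (sigma 1)))%C.
    set (d := (Cexp (RtoC (alpha 1 / INR n) * Ci) * h (gamma (sigma 1)))%C) in *.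
    replace (h (P 1)) with ((h (P 1) / d) * d)%C by (field; exact Nd1).
    rewrite <- F. ring.
  - set (D := fun w => ccw_side gamma eta Vg (gamma 0 + w)%C \/
                       initial_part gamma eta (gamma 0 + w)%C) in *.
    assert (DP : forall x, D (P (c x) - gamma 0)%C).
    { intros x. unfold D. replace (gamma 0 + (P (c x) - gamma 0))%C with (P (c x)) by ring.
      assert (X := Rc x). destruct (Req_dec (c x) 0) as [E|E].
      - right. rewrite E, P0. exists (sigma 0). split; [apply (Sp 0); lra | reflexivity].
      - left. exists (fun y => sigma (c x * y)), (fun y => alpha (c x * y)).
        split; [|split; [|split; [|split; [|split]]]].
        + intros y. apply (continuous_comp (fun y => c x * y) sigma); [|apply Cs].
          apply (ex_derive_continuous (V := R_NormedModule)). auto_derive. exact I.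
        + intros y. apply (continuous_comp (fun y => c x * y) alpha); [|apply Ca].
          apply (ex_derive_continuous (V := R_NormedModule)). auto_derive. exact I.
        + rewrite Rmult_0_r. exact A0.
        + intros y Hy. apply Ap. nra.
        + intros y Hy. apply Sp. nra.
        + rewrite Rmult_1_r. reflexivity. }
    assert (Ds : forall x, D (gamma (sigma (c x)) - gamma 0)%C).
    { intros x. right. exists (sigma (c x)). split; [apply (Sp (c x)), Rc|]. ring. }
    set (f := fun x => (Log (P (c x) - gamma 0) - RtoC (alpha (c x)) * Ci
       - Log (gamma (sigma (c x)) - gamma 0))%C).
    assert (Hminus : forall z w, Cexp (z - w) = (Cexp z * / Cexp w)%C).
    { intros z w. unfold Cminus. rewrite Cexp_plus, Cexp_opp_inv. reflexivity. }
    assert (F : f 0 = f 1).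
    { apply (continuous_log_unique f 1).
      - intros x _. apply continuous_Cminus; [apply continuous_Cminus|].
        + apply (continuous_in_path D Log (fun x => P (c x) - gamma 0)%C); [exact CL | exact DP|].
          apply continuous_Cminus; [apply CPc | apply continuous_Cconst].
        + apply continuous_Cmult; [apply continuous_RtoC, compR | apply continuous_Cconst].
        + apply (continuous_in_path D Log (fun x => gamma (sigma (c x)) - gamma 0)%C);
            [exact CL | exact Ds|].
          apply continuous_Cminus; [apply Cgc | apply continuous_Cconst].
      - intros x _. unfold f. rewrite ?Hminus. rewrite !EL by (apply DP || apply Ds).
        unfold P, rotate.
        assert (E := Cexp_nz (RtoC (alpha (c x)) * Ci)). assert (N' := N (c x) (Rc x)).
        field. split; assumption. }
    unfold f in F. rewrite c0, c1, P0, A0 in F.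
    change (Log (P 1 - gamma 0) = RtoC (alpha 1) * Ci + Log (gamma (sigma 1) - gamma 0))%C.
    replace (Log (P 1 - gamma 0)%C) with
      ((Log (P 1 - gamma 0) - RtoC (alpha 1) * Ci - Log (gamma (sigma 1) - gamma 0))
       + (RtoC (alpha 1) * Ci + Log (gamma (sigma 1) - gamma 0)))%C by ring.
    rewrite <- F. ring.
Qed.

Lemma continuous_Log_curve (gamma : R -> C) (eta : R) (Vg : C -> Prop) (Log : C -> C) (s : R) :
  piecewise_smooth gamma -> eta <= 1 ->
  log_branch (fun w => ccw_side gamma eta Vg (gamma 0 + w)%C \/
                       initial_part gamma eta (gamma 0 + w)%C) Log ->
  0 < s < eta ->
  Ccontinuous (fun s => Log (gamma s - gamma 0)%C) s /\
  Cexp (Log (gamma s - gamma 0)%C) = (gamma s - gamma 0)%C.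
Proof.
  intros Hg He [CL EL] Hs.
  set (D := fun w => ccw_side gamma eta Vg (gamma 0 + w)%C \/
                     initial_part gamma eta (gamma 0 + w)%C) in *.
  assert (HD : forall y, 0 < y < eta -> D (gamma y - gamma 0)%C).
  { intros y Hy. right. exists y. split; [exact Hy | ring]. }
  split; [|apply EL, HD, Hs].
  apply (continuous_in_path_segment D Log (fun s => gamma s - gamma 0)%C 0 eta); auto.
  intros y Hy. apply continuous_Cminus; [apply continuous_curve; [exact Hg | lra]
    | apply continuous_Cconst].
Qed.

(** * The local Cauchy integral *)

(** Equality would force [y = x] by comparison of the moduli, and then
    [beta / n], which lies in ]0, 2 pi[, would be a multiple of [2 pi]. *)
Lemma arc_avoids_rotation (Q : R -> C) (b beta x y : R) (n : nat) :
  (0 < n)%nat ->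
  (forall x y, 0 <= x < y -> y <= b -> Cmod (Q x) < Cmod (Q y)) ->
  0 < x <= b -> 0 <= y <= b -> 0 < beta < 2 * PI * INR n ->
  Q y <> (Cexp (RtoC (beta / INR n) * Ci) * Q x)%C.
Proof.
  intros Hn Inc Hx Hy Hb E.
  assert (Pn : 0 < INR n) by (apply lt_0_INR, Hn).
  assert (M := f_equal Cmod E). rewrite Cmod_mult, Cmod_rotation, Rmult_1_l in M.
  assert (y = x) as ->.
  { destruct (Rtotal_order y x) as [L|[L|L]]; [|exact L|]; exfalso.
    - assert (I := Inc y x ltac:(lra) ltac:(lra)). lra.
    - assert (I := Inc x y ltac:(lra) ltac:(lra)). lra. }
  assert (NQ : Q x <> 0%C).
  { apply Cmod_gt_0. apply Rle_lt_trans with (Cmod (Q 0)); [apply Cmod_ge_0|].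
    apply Inc; lra. }
  apply (rotation_neq_1 (beta / INR n)).
  - split; [apply Rdiv_lt_0_compat; lra|].
    apply Rmult_lt_reg_r with (1 := Pn). unfold Rdiv. rewrite Rmult_assoc, Rinv_l by lra. lra.
  - replace (Cexp (RtoC (beta / INR n) * Ci))
      with ((Cexp (RtoC (beta / INR n) * Ci) * Q x) * / Q x)%C by (field; exact NQ).
    rewrite <- E. field. exact NQ.
Qed.

Lemma open_interval_convex (a c x y r : R) :
  a < x < c -> a < y < c -> 0 <= r <= 1 -> a < x + r * (y - x) < c.
Proof.
  intros Hx Hy Hr. destruct (Rle_lt_dec x y) as [L|L].
  - assert (0 <= r * (y - x)) by (apply Rmult_le_pos; lra).
    assert (r * (y - x) <= 1 * (y - x)) by (apply Rmult_le_compat_r; lra). lra.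
  - assert (0 <= r * (x - y)) by (apply Rmult_le_pos; lra).
    assert (r * (x - y) <= 1 * (x - y)) by (apply Rmult_le_compat_r; lra). lra.
Qed.

(** [beta] ranges over ]0, 2 pi n[ and not over an interval of length [2 pi], so that
    one and the same constant [M] serves the [n] preimages
    [exp (i * (alpha + 2 pi j) / n) * Q x] of a point; the terms [j / n] of the final
    formula come from this.  [M] is a constant because the difference of the two
    sides depends continuously on [(x, beta)] and has a constant exponential
    after multiplication by [n]. *)
Lemma arc_logarithm (Q dQ lam : R -> C) (b b1 : R) (m : nat) (l : nat -> C) (A : R) :
  0 < b1 <= b ->
  (forall x, 0 <= x <= b -> Ccontinuous Q x) ->
  (forall x, 0 <= x <= b -> Ccontinuous dQ x) ->
  (forall x, 0 < x < b -> Cderiv Q x (dQ x)) -> Q 0 = 0%C ->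
  (forall x y, 0 <= x < y -> y <= b -> Cmod (Q x) < Cmod (Q y)) ->
  (forall x, 0 < x < b1 -> 2 * Cmod (Q x) < Cmod (Q b)) ->
  (forall x, 0 < x < b -> Ccontinuous lam x) ->
  (forall x, 0 < x < b -> Cexp (lam x) = (Q x ^ S m)%C) ->
  geometric_bound l A (/ Cmod (Q b)) ->
  (forall u, Cmod u < Cmod (Q b) -> Cexp (Cpseries l u) = (1 - u / Q b)%C) ->
  exists M : C, forall x beta, 0 < x < b1 -> 0 < beta < 2 * PI * INR (S m) ->
    let u := (Cexp (RtoC (beta / INR (S m)) * Ci) * Q x)%C in
    CInt (fun y => dQ y / (Q y - u))%C 0 b =
      (Cpseries l u - / RtoC (INR (S m)) * (RtoC beta * Ci + lam x) + M)%C.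
Proof.
  intros Hb CQ CdQ DQ Q0 Inc Half Clam Elam Gl El.
  set (n := S m) in *.
  assert (Hn : (0 < n)%nat) by (unfold n; lia).
  assert (Pn : 0 < INR n) by (apply lt_0_INR, Hn).
  assert (Nn : RtoC (INR n) <> 0%C) by (apply INR_C_neq_0, Hn).
  assert (PP := PI_RGT_0).
  assert (NQ : forall x, 0 < x <= b -> Q x <> 0%C).
  { intros x Hx. apply Cmod_gt_0. apply Rle_lt_trans with (Cmod (Q 0)); [apply Cmod_ge_0|].
    apply Inc; lra. }
  set (U := fun x beta => (Cexp (RtoC (beta / INR n) * Ci) * Q x)%C).
  set (K := fun u => CInt (fun y => dQ y / (Q y - u))%C 0 b).
  set (D := fun x beta => (RtoC (INR n) *
     (K (U x beta) - Cpseries l (U x beta) + / RtoC (INR n) * (RtoC beta * Ci + lam x)))%C).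
  assert (MU : forall x beta, Cmod (U x beta) = Cmod (Q x)).
  { intros. unfold U. rewrite Cmod_mult, Cmod_rotation. ring. }
  assert (Pb : 0 < Cmod (Q b)) by (apply Cmod_gt_0, NQ; lra).
  assert (Avoid : forall x beta y, 0 < x < b1 -> 0 < beta < 2 * PI * INR n -> 0 <= y <= b ->
    Q y <> U x beta).
  { intros x beta y Hx Hbeta Hy. apply (arc_avoids_rotation Q b); auto. lra. }
  (* [exp D] is the [n]-th power of [(Q b - u) / (- u)] divided by [1 - u / Q b],
     times [exp (i * beta) * Q x ^ n], which is [u ^ n] *)
  assert (ED : forall x beta, 0 < x < b1 -> 0 < beta < 2 * PI * INR n ->
    Cexp (D x beta) = ((- Q b) ^ n)%C).
  { intros x beta Hx Hbeta. unfold D.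
    rewrite <- Cexp_pow. rewrite Cexp_plus. unfold Cminus at 1.
    rewrite Cexp_plus, Cexp_opp_inv.
    assert (NU : U x beta <> 0%C).
    { unfold U. apply Cmult_neq_0; [apply Cexp_nz | apply NQ; lra]. }
    assert (Hu : Cmod (U x beta) < Cmod (Q b)).
    { rewrite MU. apply Inc; lra. }
    assert (NB : (Q b - U x beta)%C <> 0%C).
    { apply Cminus_eq_contra. intros E. rewrite E in Hu. lra. }
    rewrite El by exact Hu.
    assert (EK : Cexp (K (U x beta)) = ((Q b - U x beta) / (- U x beta))%C).
    { unfold K. rewrite (Cexp_CInt_log_derivative (fun y => Q y - U x beta)%C dQ 0 b).
      - rewrite Q0. f_equal. f_equal. ring.
      - lra.
      - intros y Hy. apply continuous_Cminus; [apply CQ, Hy | apply continuous_Cconst].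
      - intros y Hy. destruct (DQ y Hy) as [D1 D2].
        replace (dQ y) with (dQ y - 0)%C by ring.
        split.
        + apply (is_derive_minus (V := R_NormedModule)); [exact D1|].
          apply (is_derive_const (V := R_NormedModule)).
        + apply (is_derive_minus (V := R_NormedModule)); [exact D2|].
          apply (is_derive_const (V := R_NormedModule)).
      - exact CdQ.
      - intros y Hy. apply Cminus_eq_contra, Avoid; assumption. }
    rewrite EK.
    rewrite Cpow_mult_l, (Cexp_pow (/ RtoC (INR n) * _)).
    rewrite Cmult_assoc, Cinv_r, Cmult_1_l by exact Nn.
    rewrite Cexp_plus, Elam by lra.
    rewrite <- (rotation_pow n beta Hn).
    fold n. rewrite <- !Cpow_mult_l. f_equal. fold (U x beta).
    change (Cexp (RtoC (beta / INR n) * Ci) * Q x)%C with (U x beta).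
    assert (NQb := NQ b ltac:(lra)).
    field. repeat split; assumption. }
  assert (CD : forall x beta x' beta' r, 0 < x < b1 -> 0 < beta < 2 * PI * INR n ->
     0 < x' < b1 -> 0 < beta' < 2 * PI * INR n -> 0 <= r <= 1 ->
     0 < x + r * (x' - x) < b1 /\ 0 < beta + r * (beta' - beta) < 2 * PI * INR n).
  { intros. split; apply open_interval_convex; assumption. }
  set (x0 := b1 / 2). set (beta0 := PI * INR n).
  assert (Hx0 : 0 < x0 < b1) by (unfold x0; lra).
  assert (Hbeta0 : 0 < beta0 < 2 * PI * INR n) by (unfold beta0; nra).
  exists (/ RtoC (INR n) * D x0 beta0)%C.
  intros x beta Hx Hbeta. cbv zeta. fold (U x beta). 
  change (CInt (fun y => dQ y / (Q y - U x beta))%C 0 b) with (K (U x beta)).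
  assert (E : D x0 beta0 = D x beta).
  { set (xr := fun r => x0 + r * (x - x0)). set (br := fun r => beta0 + r * (beta - beta0)).
    assert (Rg : forall r, 0 <= r <= 1 -> 0 < xr r < b1 /\ 0 < br r < 2 * PI * INR n).
    { intros r Hr. apply CD; assumption. }
    assert (Cxr : forall r, continuous xr r).
    { intros r. apply (ex_derive_continuous (V := R_NormedModule)). unfold xr. auto_derive. exact I. }
    assert (Cbr : forall r, continuous br r).
    { intros r. apply (ex_derive_continuous (V := R_NormedModule)). unfold br. auto_derive. exact I. }
    replace (D x0 beta0) with (D (xr 0) (br 0)) by (f_equal; unfold xr, br; ring).
    replace (D x beta) with (D (xr 1) (br 1)) by (f_equal; unfold xr, br; ring).
    apply (continuous_log_unique (fun r => D (xr r) (br r)) ((- Q b) ^ n)%C).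
    - intros r Hr. destruct (Rg r Hr) as [Rx Rb].
      assert (CU : Ccontinuous (fun r => U (xr r) (br r)) r).
      { apply continuous_Cmult.
        - apply (continuous_rotation (fun r => br r / INR n)).
          apply (continuous_mult (K := R_AbsRing) br (fun _ => / INR n));
            [apply Cbr | apply continuous_const].
        - apply (continuous_comp (U := R_UniformSpace) (V := R_UniformSpace) (W := C_UniformSpace)
            xr Q); [apply Cxr | apply CQ; lra]. }
      apply continuous_Cmult; [apply continuous_Cconst|].
      apply continuous_Cplus; [apply continuous_Cminus|].
      + apply (continuous_comp (U := R_UniformSpace) (V := C_UniformSpace) (W := C_UniformSpace)
          (fun r => U (xr r) (br r)) K); [exact CU|].
        apply continuous_cauchy_transform; [lra | exact CQ | exact CdQ |].
        intros y Hy. apply Avoid; assumption.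
      + apply (continuous_comp (U := R_UniformSpace) (V := C_UniformSpace) (W := C_UniformSpace)
          (fun r => U (xr r) (br r)) (Cpseries l)); [exact CU|].
        apply continuous_Cpseries with A (/ Cmod (Q b)); [exact Gl|].
        rewrite MU. assert (Hf := Half _ Rx).
        apply Rmult_lt_reg_l with (1 := Pb). rewrite <- Rmult_assoc, Rinv_r by lra. lra.
      + apply continuous_Cmult; [apply continuous_Cconst|].
        apply continuous_Cplus.
        * apply continuous_Cmult; [apply continuous_RtoC, Cbr | apply continuous_Cconst].
        * apply (continuous_comp (U := R_UniformSpace) (V := R_UniformSpace) (W := C_UniformSpace)
            xr lam); [apply Cxr | apply Clam; lra].
    - intros r Hr. destruct (Rg r Hr) as [Rx Rb]. apply ED; assumption. }
  rewrite E. unfold D. set (k := K (U x beta)). change C in (type of k). Cfield. exact Nn.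
Qed.

(** Partial fractions turn the Cauchy kernel of [Q ^ n] into the kernels of [Q]
    at the [n] preimages of the pole; each of them is split into a divided
    difference, analytic in the pole, and a logarithm. *)
Lemma uniformized_cauchy_integral (Q dQ : R -> C) (b : R) (m : nat)
    (a : nat -> C) (A Rr : R) :
  0 < b -> geometric_bound a A Rr ->
  (forall x, 0 <= x <= b -> Ccontinuous Q x) ->
  (forall x, 0 <= x <= b -> Ccontinuous dQ x) ->
  (forall x, 0 <= x <= b -> Rr * Cmod (Q x) < / 2) ->
  exists (G : nat -> C) (B : R), geometric_bound G B Rr /\
    forall u, Rr * Cmod u < 1 ->
      (forall x, 0 <= x <= b -> (Q x ^ S m)%C <> (u ^ S m)%C) ->
      is_CInt (fun x => Cpseries a (Q x) * (RtoC (INR (S m)) * Q x ^ m * dQ x)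
                        / (Q x ^ S m - u ^ S m))%C 0 b
        (sum_n (fun j => let v := root_of_unity (S m) ^ j * u in
           Cpseries G v + Cpseries a v * CInt (fun x => dQ x / (Q x - v)) 0 b) m)%C.
Proof.
  intros Hb Ga CQ CdQ Small.
  assert (A0 := geometric_bound_ge_0 _ _ _ Ga). assert (P : 0 < Rr) by apply Ga.
  destruct (Cmod_max_on_segment dQ 0 b ltac:(lra) CdQ) as [M [HM Hmax]].
  set (phi := fun r x => (divdiff a (Q x) r * dQ x)%C).
  assert (Cphi : forall r x, 0 <= x <= b ->
    Ccontinuous (phi r) x).
  { intros r x Hx. apply continuous_Cmult; [|apply CdQ, Hx].
    apply (continuous_comp (U := R_UniformSpace) (V := C_UniformSpace) (W := C_UniformSpace)
      Q (fun z => divdiff a z r)); [apply CQ, Hx|].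
    apply continuous_Cpseries with (1 := geometric_bound_shift a A Rr (S r) Ga).
    apply Small, Hx. }
  destruct (is_CInt_Cpseries phi (fun r => CInt (phi r) 0 b) 0 b (2 * A * Rr * M) Rr)
    as [GG HG]; [lra | exact P | | | |].
  { apply Rmult_le_pos; [nra | exact HM]. }
  { intros r. apply CInt_correct, ex_CInt_continuous; [lra | apply Cphi]. }
  { intros r x Hx. unfold phi. rewrite Cmod_mult.
    replace (2 * A * Rr * M * Rr ^ r) with ((2 * A * Rr * Rr ^ r) * M) by ring.
    apply Rmult_le_compat; auto using Cmod_ge_0.
    - apply divdiff_Cmod_le; [exact Ga|]. left. apply Small. lra.
    - apply Hmax. lra. }
  exists (fun r => CInt (phi r) 0 b); eexists. split; [exact GG|].
  intros u Hu Hpole.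
  assert (Mv : forall j, Cmod (root_of_unity (S m) ^ j * u) = Cmod u).
  { intros j. rewrite root_of_unity_pow, Cmod_mult, Cmod_rotation by lia. ring. }
  assert (Nv : forall j x, 0 <= x <= b -> (Q x - root_of_unity (S m) ^ j * u)%C <> 0%C).
  { intros j x Hx. apply Cminus_eq_contra. intros E. apply (Hpole x Hx).
    rewrite E, Cpow_mult_l, <- Cpow_mult_r, Nat.mul_comm.
    rewrite root_of_unity_pow_multiple by lia. ring. }
  apply is_CInt_ext with (fun x => sum_n (fun j =>
     let v := (root_of_unity (S m) ^ j * u)%C in
     Cpseries (fun r => phi r x) v + Cpseries a v * (dQ x / (Q x - v)))%C m).
  - lra.
  - intros x Hx. cbv zeta.
    transitivity (Cpseries a (Q x) * dQ x *
      sum_n (fun j => / (Q x - root_of_unity (S m) ^ j * u)) m)%C.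
    + rewrite <- sum_n_C_mult_l. apply sum_n_ext. intros j.
      set (v := (root_of_unity (S m) ^ j * u)%C).
      assert (E : Cpseries (fun r => phi r x) v = (dQ x * Cpseries (divdiff a (Q x)) v)%C).
      { rewrite (Cpseries_ext _ (fun r => dQ x * divdiff a (Q x) r)%C).
        - eapply Cpseries_mult_l.
          + apply geometric_bound_divdiff; [exact Ga|]. left. apply Small. lra.
          + unfold v. rewrite Mv. exact Hu.
        - intros k. unfold phi. ring. }
      rewrite E.
      assert (Nvx := Nv j x ltac:(lra)). fold v in Nvx.
      assert (F := divdiff_correct a A Rr (Q x) v Ga (Rlt_le _ _ (Small x ltac:(lra)))
        ltac:(unfold v; rewrite Mv; exact Hu)).
      replace (Cpseries a (Q x)) with
        ((Cpseries a (Q x) - Cpseries a v) + Cpseries a v)%C by ring.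
      rewrite F. Cfield. exact Nvx.
    + rewrite partial_fractions_root by (apply Hpole; lra).
      Cfield. apply Cminus_eq_contra, Hpole. lra.
  - apply (is_CInt_sum_n (fun j x => let v := (root_of_unity (S m) ^ j * u)%C in
       Cpseries (fun r => phi r x) v + Cpseries a v * (dQ x / (Q x - v)))%C
      (fun j => let v := (root_of_unity (S m) ^ j * u)%C in
       Cpseries (fun r => CInt (phi r) 0 b) v +
       Cpseries a v * CInt (fun x => dQ x / (Q x - v))%C 0 b)%C).
    intros j. cbv zeta. apply is_CInt_plus.
    + apply HG. rewrite Mv. exact Hu.
    + apply is_CInt_mult_l. apply CInt_correct, ex_CInt_continuous; [lra|].
      intros x Hx. apply continuous_Cdiv; [apply CdQ, Hx | | apply Nv, Hx].
      apply continuous_Cminus; [apply CQ, Hx | apply continuous_Cconst].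
Qed.

Lemma pow_lt_mono (x y : R) (m : nat) : 0 <= x < y -> x ^ S m < y ^ S m.
Proof.
  intros H. induction m as [|m IH]; [simpl; lra|].
  assert (0 <= x ^ S m) by (apply pow_le; lra).
  change (x * x ^ S m < y * y ^ S m). apply Rle_lt_trans with (x * y ^ S m).
  - apply Rmult_le_compat_l; lra.
  - apply Rmult_lt_compat_r; lra.
Qed.

Lemma pow_lt_inv (x y : R) (m : nat) : 0 <= y -> x ^ S m < y ^ S m -> x < y.
Proof.
  intros Hy H. apply Rnot_le_lt. intros L. apply (Rlt_not_le _ _ H).
  apply pow_incr. lra.
Qed.

Lemma nth_root_exists (s b : R) (m : nat) : 0 <= s <= b ^ S m -> 0 <= b ->
  exists x, 0 <= x <= b /\ x ^ S m = s.
Proof.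
  intros Hs Hb.
  destruct (Rle_lt_or_eq_dec 0 s (proj1 Hs)) as [L|<-].
  - set (x := Rpower s (/ INR (S m))).
    assert (Px : 0 < x) by apply exp_pos.
    assert (E : x ^ S m = s).
    { rewrite <- Rpower_pow by exact Px. unfold x.
      rewrite Rpower_mult, Rinv_l by (apply not_0_INR; lia). apply Rpower_1, L. }
    exists x. split; [|exact E]. split; [lra|].
    apply Rnot_lt_le. intros F. assert (T := pow_lt_mono b x m (conj Hb F)). lra.
  - exists 0. split; [lra|]. apply pow_i. lia.
Qed.

(** [H] tends to [0] because its [n]-th power does. *)
Lemma continuous_root_0 (H : R -> C) (p : R -> C) (m : nat) (e : R) : 0 < e ->
  Ccontinuous p 0 ->
  (forall s, 0 < s < e -> (H s ^ S m)%C = (p s - p 0)%C) ->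
  Ccontinuous
    (fun s => if Rle_dec s 0 then RtoC 0 else H s) 0.
Proof.
  intros He Cp EH. apply continuous_Cmod. intros r Hr.
  assert (L := proj1 (continuous_Cmod p 0) Cp (r ^ S m) (pow_lt _ _ Hr)).
  assert (Le : locally 0 (fun s => s < e)).
  { apply locally_Rabs. exists e. split; [exact He|]. intros y Hy.
    rewrite Rminus_0_r in Hy. apply Rabs_def2 in Hy. lra. }
  generalize (filter_and _ _ L Le). apply filter_imp. intros y [Hy Ye].
  destruct (Rle_dec 0 0) as [_|N]; [|lra].
  destruct (Rle_dec y 0) as [Ny|Ny].
  - replace (RtoC 0 - RtoC 0)%C with (RtoC 0) by ring. rewrite Cmod_0. exact Hr.
  - replace (H y - RtoC 0)%C with (H y) by ring.
    rewrite <- EH, Cmod_pow in Hy by lra.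
    apply pow_lt_inv with m; [lra | exact Hy].
Qed.

(** In the variable [s] the integrand involves [H], which is only continuous at
    [0]; the substitution [s = x ^ n] replaces it by the C^1 path [Q]. *)
Lemma initial_arc_integral (p dp H Q dQ : R -> C) (f : R -> C) (b e : R) (m : nat)
    (a : nat -> C) (A Rr : R) (w l : C) :
  0 < b -> b ^ S m < e -> geometric_bound a A Rr ->
  (forall s, is_Cderive p s (dp s)) ->
  (forall s, Ccontinuous dp s) ->
  (forall s, 0 < s < e -> Ccontinuous H s) ->
  (forall s, 0 < s < e -> (H s ^ S m)%C = (p s - p 0)%C) ->
  (forall x, 0 < x <= b -> Q x = H (x ^ S m)) ->
  (forall x, 0 <= x <= b -> (Q x ^ S m)%C = (p (x ^ S m)%R - p 0)%C) ->
  (forall x, 0 < x < b ->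
      (RtoC (INR (S m)) * Q x ^ m * dQ x)%C = (RtoC (INR (S m) * x ^ m) * dp (x ^ S m)%R)%C) ->
  (forall x, 0 <= x <= b -> Rr * Cmod (Q x) < / 2) ->
  (forall x, 0 <= x <= b -> (Q x ^ S m)%C <> w) ->
  (forall s, 0 < s < b ^ S m -> f s = (Cpseries a (H s) / (p s - (p 0 + w)) * dp s)%C) ->
  is_CInt (fun x => Cpseries a (Q x) * (RtoC (INR (S m)) * Q x ^ m * dQ x)
                        / (Q x ^ S m - w))%C 0 b l ->
  is_CInt f 0 (b ^ S m) l.
Proof.
  intros Hb Hbe Ga Hp Hdp CH EH EQ PQ DQ Small Hw Hf Hl.
  assert (Pb : 0 < b ^ S m) by (apply pow_lt, Hb).
  set (q := fun s => if Rle_dec s 0 then RtoC 0 else H s).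
  set (F := fun s => (Cpseries a (q s) / (p s - (p 0 + w)) * dp s)%C).
  assert (Pp : forall s, 0 <= s <= b ^ S m ->
    (p s - (p 0 + w))%C <> 0%C /\ Rr * Cmod (q s) < / 2).
  { intros s Hs. destruct (nth_root_exists s b m Hs (Rlt_le _ _ Hb)) as [x [Hx <-]]. split.
    - replace (p (x ^ S m)%R - (p 0 + w))%C with ((p (x ^ S m)%R - p 0) - w)%C by ring.
      rewrite <- PQ by exact Hx. apply Cminus_eq_contra, Hw, Hx.
    - unfold q. destruct (Rle_dec (x ^ S m) 0) as [L|L].
      + rewrite Cmod_0. lra.
      + rewrite <- EQ; [apply Small, Hx|].
        destruct (Req_dec x 0) as [->|D]; [|lra]. rewrite pow_i in L by lia. lra. }
  assert (Cq : forall s, 0 <= s <= b ^ S m -> Ccontinuous q s).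
  { intros s Hs. destruct (Req_dec s 0) as [->|D].
    - apply (continuous_root_0 H p m e); [lra | | exact EH].
      apply is_derive_continuous_C with (dp 0), Hp.
    - apply (continuous_ext_loc (T := R_UniformSpace) (U := C_UniformSpace) _ H).
      + apply locally_interval with 0 (s + 1); [lra|]. intros y Hy. unfold q.
        destruct (Rle_dec y 0); [lra | reflexivity].
      + apply CH. lra. }
  assert (CF : forall s, 0 <= s <= b ^ S m -> Ccontinuous F s).
  { intros s Hs. destruct (Pp s Hs) as [P1 P2].
    apply continuous_Cmult; [apply continuous_Cdiv; [| |exact P1]|apply Hdp].
    - apply (continuous_comp (U := R_UniformSpace) (V := C_UniformSpace) (W := C_UniformSpace)
        q (Cpseries a)); [apply Cq, Hs | apply continuous_Cpseries with A Rr; assumption].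
    - apply continuous_Cminus; [|apply continuous_Cconst].
      apply is_derive_continuous_C with (dp s), Hp. }
  assert (I := is_RInt_comp (V := C_R_CompleteNormedModule) F (fun x => x ^ S m)
    (fun x => INR (S m) * x ^ m) 0 b).
  rewrite Rmin_left, Rmax_right in I by lra.
  assert (J : is_CInt (fun x => scal (INR (S m) * x ^ m) (F (x ^ S m))) 0 b
    (CInt F (0 ^ S m) (b ^ S m))).
  { apply I.
    - intros x Hx. apply CF. split; [apply pow_le; lra | apply pow_incr; lra].
    - intros x Hx. split.
      + replace (INR (S m) * x ^ m) with (INR (S m) * 1 * x ^ pred (S m)) by (simpl pred; ring).
        apply (is_derive_pow (fun y => y) (S m) x 1). apply (is_derive_id (K := R_AbsRing)).
      + apply (ex_derive_continuous (V := R_NormedModule)). auto_derive. exact Logic.I. }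
  clear I. rewrite pow_i in J by lia.
  assert (E : CInt F 0 (b ^ S m) = l).
  { rewrite <- (is_CInt_unique _ _ _ _ Hl). symmetry. apply is_CInt_unique.
    apply is_CInt_ext with (3 := J); [lra|]. intros x Hx.
    rewrite scal_R_Cmult. unfold F, q.
    assert (Px : 0 < x ^ S m) by (apply pow_lt; lra).
    destruct (Rle_dec (x ^ S m) 0) as [L|_]; [lra|].
    rewrite <- EQ by lra.
    replace (p (x ^ S m)%R - (p 0 + w))%C with ((p (x ^ S m)%R - p 0) - w)%C by ring.
    rewrite <- PQ, DQ by lra. 
    assert (N := Cminus_eq_contra _ _ (Hw x ltac:(lra))).
    field. exact N. }
  apply is_CInt_ext with F; [lra| |].
  - intros s Hs. rewrite Hf by exact Hs. unfold F, q.
    destruct (Rle_dec s 0); [lra | reflexivity].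
  - rewrite <- E. apply CInt_correct, ex_CInt_continuous; [lra | exact CF].
Qed.

(** Along the segment from [c] to [c - u] both sides are continuous and have, up to
    a constant factor, the same exponential; so they differ by a constant.  In particular a branch that is merely assumed continuous is
    analytic. *)
Lemma log_branch_series (V : C -> Prop) (L : C -> C) (c : C) (l : nat -> C) (A : R) :
  open V -> V c -> c <> 0%C -> log_branch_upto_constant V L ->
  geometric_bound l A (/ Cmod c) ->
  (forall u, Cmod u < Cmod c -> Cexp (Cpseries l u) = (1 - u / c)%C) ->
  Cpseries l 0 = 0%C ->
  exists r, 0 < r /\ forall u, Cmod u < r ->
    V (c - u)%C /\ L (c - u)%C = (L c + Cpseries l u)%C.
Proof.
  intros Vo Vc Nc [kappa [CL EL]] Gl El L0.
  assert (Pc := proj1 (Cmod_gt_0 c) Nc).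
  destruct (proj1 (locally_Cmod c V) (Vo c Vc)) as [r [Hr HV]].
  exists (Rmin r (Cmod c / 2)). split; [apply Rmin_glb_lt; lra|].
  intros u Hu.
  assert (U1 := Rlt_le_trans _ _ _ Hu (Rmin_l _ _)).
  assert (U2 := Rlt_le_trans _ _ _ Hu (Rmin_r _ _)).
  set (cl := clamp 0 1).
  assert (Rc : forall x, 0 <= cl x <= 1) by (intros; apply clamp_range; lra).
  assert (Mx : forall x, Cmod (RtoC (cl x) * u) <= Cmod u).
  { intros x. rewrite Cmod_mult, Cmod_R, Rabs_pos_eq by apply Rc.
    assert (T := Rc x). assert (T' := Cmod_ge_0 u). nra. }
  assert (Vx : forall x, V (c - RtoC (cl x) * u)%C).
  { intros x. apply HV. replace (c - RtoC (cl x) * u - c)%C with (- (RtoC (cl x) * u))%C by ring.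
    rewrite Cmod_opp. specialize (Mx x). lra. }
  assert (c0 : cl 0 = 0) by (apply clamp_id; lra).
  assert (c1 : cl 1 = 1) by (apply clamp_id; lra).
  assert (Cx : forall x, Ccontinuous (fun x => RtoC (cl x) * u)%C x).
  { intros x. apply continuous_Cmult; [|apply continuous_Cconst].
    apply continuous_RtoC, continuous_clamp. lra. }
  split; [generalize (Vx 1); rewrite c1, Cmult_1_l; auto|].
  set (f := fun x => ((L (c - RtoC (cl x) * u) - kappa) - Cpseries l (RtoC (cl x) * u))%C).
  assert (F : f 0 = f 1).
  { apply (continuous_log_unique f c).
    - intros x _. apply continuous_Cminus.
      + apply (continuous_in_path V (fun w => L w - kappa)%C (fun x => c - RtoC (cl x) * u)%C);
          [exact CL | exact Vx |].
        apply continuous_Cminus; [apply continuous_Cconst | apply Cx].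
      + apply (continuous_comp (U := R_UniformSpace) (V := C_UniformSpace) (W := C_UniformSpace)
          (fun x => RtoC (cl x) * u)%C (Cpseries l)); [apply Cx|].
        apply continuous_Cpseries with A (/ Cmod c); [exact Gl|].
        apply Rmult_lt_reg_l with (1 := Pc). rewrite <- Rmult_assoc, Rinv_r by lra.
        specialize (Mx x). lra.
    - intros x _. unfold f, Cminus at 1. rewrite Cexp_plus, Cexp_opp_inv.
      rewrite EL by apply Vx. specialize (Mx x).
      rewrite El by lra.
      assert (N : (c - RtoC (cl x) * u)%C <> 0%C).
      { intros E. assert (E' : c = (RtoC (cl x) * u)%C) by (apply Ceq_minus; exact E).
        rewrite <- E' in Mx. lra. }
      field. split; assumption. }
  unfold f in F. rewrite c0, c1, Cmult_0_l, Cmult_1_l, L0 in F.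
  replace (c - 0)%C with c in F by ring.
  replace (L (c - u)%C) with ((L (c - u) - kappa - Cpseries l u) + kappa + Cpseries l u)%C by ring.
  rewrite <- F. ring.
Qed.

(** The rest of the curve keeps a positive distance to the starting point, so its
    contribution is analytic there. *)
Lemma far_cauchy_integral (gamma : R -> C) (g : C -> C) (s0 : R) :
  piecewise_smooth gamma -> no_poles_on_curve gamma g -> 0 < s0 <= 1 ->
  (forall s, 0 < s <= 1 -> gamma s <> gamma 0) ->
  exists (c : nat -> C) (A d : R), 0 < d /\ geometric_bound c A (/ d) /\
    (forall s, s0 <= s <= 1 -> d <= Cmod (gamma s - gamma 0)) /\
    forall t, Cmod (t - gamma 0) < d ->
      is_CInt (fun s => g (gamma s) / (gamma s - t) * Cderive gamma s)%C s0 1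
        (Cpseries c (t - gamma 0)%C).
Proof.
  intros Hg Hn Hs Once.
  destruct (Cmod_min_on_segment (fun x => gamma (clamp 0 1 x) - gamma 0)%C s0 1) as [d [Hd Hmin]];
    [lra | | |].
  { intros x Hx. apply continuous_Cminus; [|apply continuous_Cconst].
    apply continuous_curve_clamp; [exact Hg | lra]. }
  { intros x Hx. rewrite clamp_id by lra. apply Cminus_eq_contra, Once. lra. }
  assert (Dist : forall s, s0 <= s <= 1 -> d <= Cmod (gamma s - gamma 0)).
  { intros s Hs'. assert (T := Hmin s Hs'). cbv beta in T. rewrite clamp_id in T by lra. exact T. }
  set (phi := fun s => (g (gamma s) * Cderive gamma s)%C).
  assert (Ephi : ex_CInt phi s0 1).
  { apply ex_CInt_ext with (fun x => g (gamma x) * (Cderive gamma x * 1))%C; [lra| |].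
    - intros x _. unfold phi. ring.
    - apply (ex_CInt_curve gamma g (fun _ => RtoC 1)); [exact Hg | exact Hn | lra | lra |].
      intros x _. apply continuous_Cconst. }
  destruct (ex_RInt_ub (V := C_R_NormedModule) phi s0 1 Ephi) as [M HM].
  rewrite Rmin_left, Rmax_right in HM by lra.
  assert (HM' : forall x, s0 <= x <= 1 -> Cmod (phi x) <= M).
  { intros x Hx. rewrite Cmod_norm. exact (HM x Hx). }
  destruct (cauchy_transform_series phi gamma s0 1 d M (gamma 0)) as [c [A [G H]]];
    [lra | exact Hd | | | | |].
  - eapply Rle_trans; [apply Cmod_ge_0 | apply (HM' s0); lra].
  - intros x Hx. apply Dist. lra.
  - intros x Hx. apply HM'. lra.
  - intros r.
    apply ex_CInt_ext with
      (fun x => g (gamma x) * (Cderive gamma x * (/ (gamma x - gamma 0) ^ S r)))%C; [lra| |].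
    + intros x _. unfold phi, Cdiv. ring.
    + apply (ex_CInt_curve gamma g (fun z => / (z - gamma 0) ^ S r)%C);
        [exact Hg | exact Hn | lra | lra |].
      intros x Hx. apply continuous_Cinv.
      * apply continuous_Cpow, continuous_Cminus; [apply continuous_id | apply continuous_Cconst].
      * apply Cpow_nz, Cminus_eq_contra, Once. lra.
  - exists c, A, d. split; [exact Hd|]. split; [exact G|]. split; [exact Dist|].
    intros t Ht. apply is_CInt_ext with (3 := H t Ht); [lra|].
    intros x Hx. unfold phi, Cdiv. ring.
Qed.

(** The contour integral is the far part [c], analytic in [t], plus the sum over the
    preimages of [t] of an analytic function [f] and of a multiple of the Puiseux
    series: the multivalued part of the logarithm found in [arc_logarithm], with
    the angle of [t] expressed by [Log (t - z0)]. *)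
Lemma contour_integral_expansion (gamma : R -> C) (g : C -> C) (m : nat) (a : nat -> C)
    (Vg : C -> Prop) (eta : R) (h Log : C -> C) :
  piecewise_smooth gamma -> no_poles_on_curve gamma g ->
  (forall s, 0 < s <= 1 -> gamma s <> gamma 0) -> convergent_near_0 a ->
  0 < eta <= 1 -> (forall s, 0 < s < eta -> Vg (gamma s)) ->
  root_branch (S m) (gamma 0) Vg h ->
  at_right 0 (fun s => g (gamma s) = Cpseries a (h (gamma s))) ->
  log_branch (fun w => ccw_side gamma eta Vg (gamma 0 + w)%C \/
                       initial_part gamma eta (gamma 0 + w)%C) Log ->
  exists (c f : nat -> C) (A B d Rr delta : R),
    0 < d /\ geometric_bound c A (/ d) /\ geometric_bound f B Rr /\ 0 < delta /\
    forall t, ccw_side gamma eta Vg t -> Cmod (t - gamma 0) < delta ->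
      (h t ^ S m)%C = (t - gamma 0)%C /\
      contour_integral gamma (fun z => g z / (z - t))%C =
        (Cpseries c (t - gamma 0) +
         sum_n (fun j => let v := root_of_unity (S m) ^ j * h t in
           Cpseries f v - Cpseries a v *
             (/ RtoC (INR (S m)) * (Log (t - gamma 0) + RtoC (2 * PI * INR j) * Ci))) m)%C.
Proof.
  intros Hg Hpoles Once Ha He HV Hroot Hgh HLog.
  set (n := S m) in *.
  assert (Hn : (0 < n)%nat) by (unfold n; lia).
  assert (Nn : RtoC (INR n) <> 0%C) by (apply INR_C_neq_0, Hn).
  assert (Pn : 0 < INR n) by (apply lt_0_INR, Hn).
  assert (Eh := proj2 Hroot). assert (Ch := proj1 Hroot).
  destruct (convergent_geometric_bound a Ha) as [A [Rr Ga]].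
  assert (PR : 0 < Rr) by apply Ga.
  destruct (piecewise_smooth_right gamma Hg 0 ltac:(lra)) as (d1 & Hd1 & Hd1' & p & dp & Hp & Hdp & Ep).
  rewrite Rplus_0_l in Ep.
  assert (p0 : p 0 = gamma 0) by (apply Ep; lra).
  assert (Ndp : dp 0 <> 0%C) by (apply (Ep 0); lra).
  destruct (distance_increasing p dp Hp Hdp Ndp) as (d2 & Hd2 & Dinc).
  destruct (proj1 (locally_Rabs _ _) Hgh) as [s0 [Hs0 Eg]].
  (* [n]-th roots of the distances below [(/ (4 * Rr)) ^ n] lie well inside the disc of
     convergence of the Puiseux series *)
  destruct (proj1 (locally_Rabs _ _) (proj1 (continuous_Cmod p 0)
    (is_derive_continuous_C _ _ _ (Hp 0)) ((/ (4 * Rr)) ^ n)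
    (pow_lt _ _ (Rinv_0_lt_compat (4 * Rr) ltac:(lra))))) as [d3 [Hd3 Psmall]].
  set (e := Rmin (Rmin d1 d2) (Rmin (Rmin s0 d3) eta)).
  assert (E1 : e <= d1) by (eapply Rle_trans; [apply Rmin_l | apply Rmin_l]).
  assert (E2 : e <= d2) by (eapply Rle_trans; [apply Rmin_l | apply Rmin_r]).
  assert (E3 : e <= s0) by (eapply Rle_trans; [apply Rmin_r | eapply Rle_trans; [apply Rmin_l | apply Rmin_l]]).
  assert (E4 : e <= d3) by (eapply Rle_trans; [apply Rmin_r | eapply Rle_trans; [apply Rmin_l | apply Rmin_r]]).
  assert (E5 : e <= eta) by (eapply Rle_trans; [apply Rmin_r | apply Rmin_r]).
  assert (He0 : 0 < e) by (unfold e; repeat apply Rmin_glb_lt; lra).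
  set (H := fun s => h (gamma s)).
  assert (CH : forall s, 0 < s < e -> Ccontinuous H s).
  { intros s Hs. apply (continuous_in_path_segment Vg h gamma 0 eta); auto; [lra|].
    intros y Hy. apply continuous_curve; [exact Hg | lra]. }
  assert (EH : forall s, 0 < s < e -> (H s ^ n)%C = (p s - p 0)%C).
  { intros s Hs. unfold H. rewrite Eh by (apply HV; lra).
    rewrite p0, (proj1 (Ep s ltac:(lra))). reflexivity. }
  destruct (root_parametrization p dp H m e Hp Hdp Ndp He0 CH EH)
    as (b & Q & dQ & Hb & Hbe & CQ & CdQ & DQ & Q0 & EQ & PQ & RQ).
  fold n in Hbe, EQ, PQ, RQ.
  set (s2 := b ^ n) in *.
  assert (Hs2 : 0 < s2) by (apply pow_lt, Hb).
  assert (Bn : forall x, 0 <= x <= b -> 0 <= x ^ n <= s2).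
  { intros x Hx. split; [apply pow_le; lra | apply pow_incr; lra]. }
  assert (Qinc : forall x y, 0 <= x < y -> y <= b -> Cmod (Q x) < Cmod (Q y)).
  { intros x y Hx Hy. apply pow_lt_inv with m; [apply Cmod_ge_0|]. fold n.
    rewrite <- !Cmod_pow, !PQ by lra.
    assert (L := pow_lt_mono x y m Hx). fold n in L.
    assert (L1 := Bn x ltac:(lra)). assert (L2 := Bn y ltac:(lra)).
    apply Dinc; lra. }
  assert (Qsmall : forall x, 0 <= x <= b -> Rr * Cmod (Q x) < / 2).
  { intros x Hx. assert (L := Bn x Hx).
    assert (T := Psmall (x ^ n) ltac:(rewrite Rminus_0_r, Rabs_pos_eq; lra)).
    rewrite <- PQ, Cmod_pow in T by exact Hx.
    apply pow_lt_inv in T; [|left; apply Rinv_0_lt_compat; lra].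
    apply Rmult_lt_compat_l with (1 := PR) in T.
    replace (Rr * / (4 * Rr)) with (/ 4) in T by (field; lra). lra. }
  assert (PQb : 0 < Cmod (Q b)).
  { apply Rle_lt_trans with (Cmod (Q 0)); [apply Cmod_ge_0 | apply Qinc; lra]. }
  assert (NQb : Q b <> 0%C) by (apply Cmod_gt_0, PQb).
  destruct (proj1 (locally_Rabs _ _) (proj1 (continuous_Cmod Q 0) (CQ 0 ltac:(lra))
    (Cmod (Q b) / 2) ltac:(lra))) as [b' [Hb' Qhalf]].
  set (b1 := Rmin b' b).
  assert (Hb1 : 0 < b1 <= b) by (split; [apply Rmin_glb_lt; lra | apply Rmin_r]).
  assert (Hb1' : b1 <= b') by apply Rmin_l.
  destruct (log_series (Q b) NQb) as (l & Al & Gl & El & _).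
  set (lam := fun x => Log (gamma (x ^ n)%R - gamma 0)%C).
  assert (Lam : forall x, 0 < x < b -> Ccontinuous lam x /\
    Cexp (lam x) = (Q x ^ n)%C).
  { intros x Hx. assert (L := Bn x ltac:(lra)).
    assert (L' : 0 < x ^ n) by (apply pow_lt; lra).
    destruct (continuous_Log_curve gamma eta Vg Log (x ^ n) Hg ltac:(lra) HLog ltac:(lra)) as [C1 C2].
    split.
    - apply (continuous_comp (U := R_UniformSpace) (V := R_UniformSpace) (W := C_UniformSpace)
        (fun x => x ^ n) (fun s => Log (gamma s - gamma 0)%C)); [|exact C1].
      apply (ex_derive_continuous (V := R_NormedModule)). auto_derive. exact I.
    - unfold lam. rewrite C2, PQ by lra. rewrite p0, (proj1 (Ep (x ^ n) ltac:(lra))). reflexivity. }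
  destruct (arc_logarithm Q dQ lam b b1 m l Al) as [M HM]; auto.
  { intros x Hx. apply is_derive_Cderiv, DQ, Hx. }
  { intros x Hx. assert (T := Qhalf x ltac:(rewrite Rminus_0_r, Rabs_pos_eq; lra)).
    rewrite Q0 in T. replace (Q x - 0)%C with (Q x) in T by ring. lra. }
  { intros x Hx. apply Lam, Hx. }
  { intros x Hx. apply Lam, Hx. }
  fold n in HM. cbv zeta in HM.
  destruct (uniformized_cauchy_integral Q dQ b m a A Rr Hb Ga CQ CdQ Qsmall) as (G & BG & GG & HG).
  fold n in HG. cbv zeta in HG.
  destruct (far_cauchy_integral gamma g s2 Hg Hpoles ltac:(lra) Once)
    as (c & Ac & d & Hd & Gc & Far & Hc).
  set (R1 := Rmax Rr (/ Cmod (Q b))).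
  assert (Ga' := geometric_bound_weaken _ _ A _ R1 Ga (Rle_refl _) (Rmax_l _ _)).
  assert (Gl' := geometric_bound_weaken _ _ Al _ R1 Gl (Rle_refl _) (Rmax_r _ _)).
  assert (PR1 : 0 < R1) by apply Ga'.
  assert (R1Rr : Rr <= R1) by apply Rmax_l.
  assert (Gal := geometric_bound_Cauchy_product _ _ _ _ _ Ga' Gl').
  assert (GG' := geometric_bound_weaken _ _ BG _ (2 * R1) GG (Rle_refl _) ltac:(lra)).
  assert (Ga2 := geometric_bound_weaken _ _ A _ (2 * R1) Ga (Rle_refl _) ltac:(lra)).
  assert (GGal := geometric_bound_plus _ _ _ _ _ GG' Gal).
  assert (GMa := geometric_bound_mult_l M _ _ _ Ga2).
  set (f := fun k => ((G k + Cauchy_product a l k) + M * a k)%C).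
  assert (Gf := geometric_bound_plus _ _ _ _ _ GGal GMa). fold f in Gf.
  assert (Ef : forall u, 2 * R1 * Cmod u < 1 ->
    Cpseries f u = (Cpseries G u + Cpseries a u * (Cpseries l u + M))%C).
  { intros u Hu. unfold f.
    rewrite (Cpseries_plus _ _ _ _ _ _ GGal GMa Hu).
    rewrite (Cpseries_plus _ _ _ _ _ _ GG' Gal Hu).
    rewrite (Cpseries_mult _ _ _ _ _ _ Ga' Gl').
    - rewrite (Cpseries_mult_l _ _ _ _ _ Ga2 Hu). ring.
    - assert (T := Cmod_ge_0 u). nra. }
  set (rho := Rmin (Cmod (Q b1)) (/ (4 * R1))).
  assert (Hrho : 0 < rho).
  { apply Rmin_glb_lt; [|apply Rinv_0_lt_compat; lra].
    apply Rle_lt_trans with (Cmod (Q 0)); [apply Cmod_ge_0 | apply Qinc; lra]. }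
  exists c, f, Ac. eexists. exists d, (2 * R1), (Rmin d (rho ^ n)).
  split; [exact Hd|]. split; [exact Gc|]. split; [exact Gf|].
  split; [apply Rmin_glb_lt; [exact Hd | apply pow_lt, Hrho]|].
  intros t Ht Dt.
  assert (Dt1 := Rlt_le_trans _ _ _ Dt (Rmin_l _ _)).
  assert (Dt2 := Rlt_le_trans _ _ _ Dt (Rmin_r _ _)).
  destruct (ccw_side_branches gamma n eta Vg h Log t Hg Once Hn ltac:(lra) HV
    Hroot HLog Ht) as (s & alpha & Hs & Hal & Et & Eht & ELt).
  assert (Tz : (t - gamma 0)%C = (Cexp (RtoC alpha * Ci) * (gamma s - gamma 0))%C).
  { rewrite Et. unfold rotate. ring. }
  assert (Mt : Cmod (t - gamma 0) = Cmod (gamma s - gamma 0)).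
  { rewrite Tz, Cmod_mult, Cmod_rotation. ring. }
  assert (Ls : s < s2).
  { apply Rnot_le_lt. intros L. assert (T := Far s ltac:(lra)). lra. }
  destruct (nth_root_exists s b m ltac:(fold n s2; lra) ltac:(lra)) as [x [Hx Ex]].
  fold n in Ex. subst s.
  assert (Hx0 : 0 < x).
  { destruct (Req_dec x 0) as [->|D]; [|lra]. rewrite pow_i in Hs by exact Hn. lra. }
  assert (EQx : h (gamma (x ^ n)) = Q x) by (symmetry; apply EQ; lra).
  rewrite EQx in Eht.
  assert (PQx : (Q x ^ n)%C = (gamma (x ^ n)%R - gamma 0)%C).
  { rewrite PQ by lra. rewrite p0, (proj1 (Ep (x ^ n) ltac:(lra))). reflexivity. }
  set (u := h t) in *.
  assert (Un : (u ^ n)%C = (t - gamma 0)%C).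
  { rewrite Eht, Cpow_mult_l, rotation_pow, PQx by exact Hn. symmetry. exact Tz. }
  split; [exact Un|].
  assert (Mu : Cmod u = Cmod (Q x)).
  { rewrite Eht, Cmod_mult, Cmod_rotation. ring. }
  assert (Lu : Cmod u < rho).
  { apply pow_lt_inv with m; [lra|]. fold n. rewrite <- Cmod_pow, Un. exact Dt2. }
  assert (Lu1 := Rlt_le_trans _ _ _ Lu (Rmin_l _ _)).
  assert (Lu2 := Rlt_le_trans _ _ _ Lu (Rmin_r _ _)).
  assert (Hu : R1 * Cmod u < / 4).
  { apply Rmult_lt_compat_l with (1 := PR1) in Lu2.
    replace (R1 * / (4 * R1)) with (/ 4) in Lu2 by (field; lra). exact Lu2. }
  assert (Hxb1 : 0 < x < b1).
  { split; [exact Hx0|]. apply Rnot_le_lt. intros L.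
    destruct (Rle_lt_or_eq_dec b1 x L) as [L'|E].
    - assert (T := Qinc b1 x ltac:(lra) ltac:(lra)). lra.
    - rewrite <- E in Mu. lra. }
  assert (PP := PI_RGT_0).
  assert (Rot : forall j, (root_of_unity n ^ j * u)%C =
    (Cexp (RtoC ((alpha + 2 * PI * INR j) / INR n) * Ci) * Q x)%C).
  { intros j. rewrite root_of_unity_pow, Eht, Cmult_assoc, <- Cexp_plus by exact Hn.
    f_equal. f_equal. rewrite <- Cmult_plus_distr_r, <- RtoC_plus. f_equal. f_equal. field. lra. }
  assert (Pole : forall y, 0 <= y <= b -> (Q y ^ n)%C <> (u ^ n)%C).
  { intros y Hy E.
    assert (My : Cmod (Q y) ^ n = Cmod (Q x) ^ n).
    { rewrite <- Mu, <- !Cmod_pow, E. reflexivity. }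
    assert (y = x) as ->.
    { destruct (Rtotal_order y x) as [L|[L|L]]; [|exact L|]; exfalso.
      - assert (I := pow_lt_mono _ _ m (conj (Cmod_ge_0 _) (Qinc y x ltac:(lra) ltac:(lra)))).
        fold n in I. lra.
      - assert (I := pow_lt_mono _ _ m (conj (Cmod_ge_0 _) (Qinc x y ltac:(lra) ltac:(lra)))).
        fold n in I. lra. }
    apply (rotation_neq_1 alpha Hal).
    assert (NQ : (Q x ^ n)%C <> 0%C).
    { rewrite PQx. apply Cminus_eq_contra, Once. lra. }
    rewrite Un, Tz, <- PQx in E.
    replace (Cexp (RtoC alpha * Ci)) with ((Cexp (RtoC alpha * Ci) * Q x ^ n) * / (Q x ^ n))%C
      by (field; exact NQ).
    rewrite <- E. field. exact NQ. }
  assert (First := HG u ltac:(assert (T := Cmod_ge_0 u); nra) Pole).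
  apply (initial_arc_integral p dp H Q dQ
    (fun s => g (gamma s) / (gamma s - t) * Cderive gamma s)%C b e m a A Rr) in First;
    [|assumption..|].
  2: { intros s Hs'. fold n s2 in Hs'.
       rewrite (Cderive_smooth_arc gamma p dp 0 d1 s Hp); [| |lra].
       - rewrite (Eg s) by (try apply Rabs_def1; lra).
         rewrite (proj1 (Ep s ltac:(lra))). rewrite Un, p0.
         replace (gamma 0 + (t - gamma 0))%C with t by ring. reflexivity.
       - intros y Hy. apply Ep, Hy. }
  fold n s2 in First.
  assert (Tot := is_RInt_Chasles (V := C_R_NormedModule) _ _ _ _ _ _ First (Hc t Dt1)).
  unfold contour_integral.
  rewrite (is_CInt_unique _ _ _ _ Tot).
  match goal with |- plus ?x ?y = _ => change (plus x y) with (Cplus x y) end.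
  rewrite Cplus_comm. f_equal.
  apply sum_n_ext_loc. intros j Hj.
  assert (Hbj : 0 < alpha + 2 * PI * INR j < 2 * PI * INR n).
  { assert (J0 := pos_INR j). assert (J1 : INR j <= INR m) by (apply le_INR, Hj).
    unfold n. rewrite S_INR. split; nra. }
  assert (KM := HM x (alpha + 2 * PI * INR j) Hxb1 Hbj). rewrite <- Rot in KM.
  set (v := (root_of_unity n ^ j * u)%C) in *.
  assert (Mv : Cmod v = Cmod u).
  { unfold v. rewrite root_of_unity_pow, Cmod_mult, Cmod_rotation by exact Hn. ring. }
  rewrite Ef by (rewrite Mv; lra).
  transitivity (Cpseries G v + Cpseries a v *
    (Cpseries l v - / RtoC (INR n) * (RtoC (alpha + 2 * PI * INR j) * Ci + lam x) + M))%C.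
  { f_equal. f_equal. exact KM. }
  rewrite ELt, RtoC_plus. unfold lam. Cring.
Qed.

Theorem theorem3p4
  (gamma : R -> C) (g : C -> C)
  (gamma_smooth : piecewise_smooth gamma)
  (gamma_transversal : transversal_self_intersections gamma)
  (g_algebraic : algebraic_on_curve gamma g)
  (g_no_poles : no_poles_on_curve gamma g)
  (* z0 is the starting point of gamma, and gamma passes through it only there *)
  (z0 : C) (z0_start : gamma 0 = z0)
  (z0_once : forall s, 0 < s <= 1 -> gamma s <> z0)
  (* the Puiseux series of g at z0, with a genuinely fractional exponent *)
  (n : nat) (n_pos : (0 < n)%nat)
  (a : nat -> C) (a_conv : convergent_near_0 a)
  (z0_ramified : exists k, a k <> 0%C /\ ~ Nat.divide n k)
  (* V_gamma, and the branch h of (z - z0)^(1/n) on it selected by g *)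
  (Vg : C -> Prop) (eta : R) (eta_range : 0 < eta <= 1)
  (Vg_open : open Vg) (Vg_sc : simply_connected Vg)
  (Vg_gamma : forall s, 0 < s < eta -> Vg (gamma s))
  (h : C -> C) (h_branch : root_branch n z0 Vg h)
  (h_g : at_right 0 (fun s => g (gamma s) = Cpseries a (h (gamma s))))
  (* Log(t - z0) on U_0 and on the adjacent part of gamma *)
  (Log : C -> C)
  (Log_branch : log_branch
     (fun w => ccw_side gamma eta Vg (z0 + w)%C \/
               initial_part gamma eta (z0 + w)%C) Log)
  (z1 : C) (z1_gamma : initial_part gamma eta z1)
  (* Log_1 near c = h(z1) *)
  (V : C -> Prop) (V_open : open V) (V_sc : simply_connected V)
  (V_c : V (h z1))
  (Log1 : C -> C) (Log1_branch : log_branch_upto_constant V Log1)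
  (Log1_c : Log1 (h z1) = (/ RtoC (INR n) * Log (z1 - z0))%C) :
  let gt := Cpseries a in
  let gr := fun t : C => Cpseries (fun l => a (n * l)%nat) (t - z0)%C in
  let eps := Cexp (two_pi_i / RtoC (INR n))%C in
  let tj := fun (t : C) (j : nat) => (eps ^ j * h t)%C in
  let c := h z1 in
  c <> 0%C /\
  exists reg : C -> C, holomorphic_at reg z0 /\
  exists delta : R, 0 < delta /\
  forall t : C, ccw_side gamma eta Vg t -> Cmod (t - z0) < delta ->
    (forall j, (j < n)%nat -> V (c - tj t j)%C) /\
    cauchy_integral gamma g t =
      (reg t
       - sum_n (fun j => RtoC (INR j / INR n - 1 / 2) * gt (tj t j)) (n - 1)
       + / two_pi_i * sum_n (fun j => gt (tj t j) * Log1 (c - tj t j)) (n - 1)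
       - / two_pi_i * gr t * Log (t - z0))%C.
Proof.
  intros gt gr eps tj c.
  subst z0. destruct n as [|m]; [lia|]. set (n := S m) in *.
  assert (Nn : RtoC (INR n) <> 0%C) by (apply INR_C_neq_0, n_pos).
  assert (Vz1 : Vg z1) by (destruct z1_gamma as [s [Hs ->]]; apply Vg_gamma, Hs).
  assert (Nc : c <> 0%C).
  { intros E. destruct z1_gamma as [s [Hs ->]].
    apply (Cminus_eq_contra _ _ (z0_once s ltac:(lra))).
    destruct h_branch as [_ Eh]. rewrite <- (Eh (gamma s) Vz1). fold c. rewrite E.
    unfold n. rewrite Cpow_S. ring. }
  split; [exact Nc|].
  destruct (contour_integral_expansion gamma g m a Vg eta h Log gamma_smooth g_no_poles z0_once
    a_conv eta_range Vg_gamma h_branch h_g Log_branch)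
    as (k & f & A & B & d & Rr & delta & Hd & Gk & Gf & Hdelta & Hexp).
  fold n in Hexp. cbv zeta in Hexp.
  destruct (convergent_geometric_bound a a_conv) as [Aa [Ra Ga]].
  destruct (log_series c Nc) as (l & Al & Gl & El & L0).
  destruct (log_branch_series V Log1 c l Al V_open V_c Nc Log1_branch Gl El L0) as [r [Hr HL]].
  assert (Pc := proj1 (Cmod_gt_0 c) Nc).
  set (R1 := Rmax (Rmax Rr Ra) (/ Cmod c)).
  assert (M1 : Rr <= R1) by (eapply Rle_trans; [apply Rmax_l | apply Rmax_l]).
  assert (M2 : Ra <= R1) by (eapply Rle_trans; [apply Rmax_r | apply Rmax_l]).
  assert (M3 : / Cmod c <= R1) by apply Rmax_r.
  assert (Ga' := geometric_bound_weaken _ _ Aa _ R1 Ga (Rle_refl _) M2).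
  assert (Gl' := geometric_bound_weaken _ _ Al _ R1 Gl (Rle_refl _) M3).
  assert (PR1 : 0 < R1) by apply Ga'.
  assert (Gf' := geometric_bound_weaken _ _ B _ (2 * R1) Gf (Rle_refl _) ltac:(lra)).
  assert (Ga2 := geometric_bound_weaken _ _ Aa _ (2 * R1) Ga (Rle_refl _) ltac:(lra)).
  assert (Gal := geometric_bound_mult_l (- (1))%C _ _ _
    (geometric_bound_Cauchy_product _ _ _ _ _ Ga' Gl')).
  assert (Gfal := geometric_bound_plus _ _ _ _ _ Gf' Gal).
  (* the constants [Log1 c] and [i * PI] are absorbed by the regular part as well *)
  set (w := (- (Log1 c + two_pi_i / 2))%C).
  assert (Gwa := geometric_bound_mult_l w _ _ _ Ga2).
  set (fr := fun i => ((f i + - (1) * Cauchy_product a l i) + w * a i)%C).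
  assert (Gfr := geometric_bound_plus _ _ _ _ _ Gfal Gwa). fold fr in Gfr.
  assert (Efr : forall u, 2 * R1 * Cmod u < 1 ->
    Cpseries fr u = (Cpseries f u - Cpseries a u * Cpseries l u + w * Cpseries a u)%C).
  { intros u Hu. unfold fr.
    assert (Hu1 : R1 * Cmod u < 1) by (assert (T := Cmod_ge_0 u); nra).
    rewrite (Cpseries_plus _ _ _ _ _ _ Gfal Gwa Hu).
    rewrite (Cpseries_plus _ _ _ _ _ _ Gf' Gal Hu).
    rewrite (Cpseries_mult_l _ _ _ _ _ (geometric_bound_Cauchy_product _ _ _ _ _ Ga' Gl') Hu).
    rewrite (Cpseries_mult _ _ _ _ _ _ Ga' Gl' Hu1).
    rewrite (Cpseries_mult_l _ _ _ _ _ Ga2 Hu). ring. }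
  assert (Gav := geometric_bound_mult_l (RtoC (INR n)) _ _ _ (geometric_bound_multiples _ _ _ n Gfr)).
  set (R2 := Rmax (/ d) ((2 * R1) ^ n)).
  assert (Gk2 := geometric_bound_weaken _ _ A _ R2 Gk (Rle_refl _) (Rmax_l _ _)).
  assert (Gav2 := geometric_bound_weaken _ _ _ _ R2 Gav (Rle_refl _) (Rmax_r _ _)).
  assert (Greg := geometric_bound_mult_l (/ two_pi_i)%C _ _ _ (geometric_bound_plus _ _ _ _ _ Gk2 Gav2)).
  assert (PR2 : 0 < R2) by apply Gk2.
  match type of Greg with geometric_bound ?s _ _ => set (reg := s) in * end.
  exists (fun t => Cpseries reg (t - gamma 0)%C).
  split; [eapply holomorphic_Cpseries, Greg|].
  set (rho := Rmin r (/ (4 * R1))).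
  assert (Hrho : 0 < rho) by (apply Rmin_glb_lt; [exact Hr | apply Rinv_0_lt_compat; lra]).
  exists (Rmin delta (Rmin (rho ^ n) (/ (2 * R2)))).
  split.
  { apply Rmin_glb_lt; [exact Hdelta|]. apply Rmin_glb_lt; [apply pow_lt, Hrho|].
    apply Rinv_0_lt_compat. lra. }
  intros t Ht Dt.
  assert (D1 := Rlt_le_trans _ _ _ Dt (Rmin_l _ _)).
  assert (D0 := Rlt_le_trans _ _ _ Dt (Rmin_r _ _)).
  assert (D2 := Rlt_le_trans _ _ _ D0 (Rmin_l _ _)).
  assert (D3 := Rlt_le_trans _ _ _ D0 (Rmin_r _ _)).
  destruct (Hexp t Ht D1) as [Un EI].
  assert (Lu : Cmod (h t) < rho).
  { apply pow_lt_inv with m; [lra|]. fold n. rewrite <- Cmod_pow, Un. exact D2. }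
  assert (Lu1 := Rlt_le_trans _ _ _ Lu (Rmin_l _ _)).
  assert (Lu2 := Rlt_le_trans _ _ _ Lu (Rmin_r _ _)).
  assert (Hu : R1 * Cmod (h t) < / 4).
  { apply Rmult_lt_compat_l with (1 := PR1) in Lu2.
    replace (R1 * / (4 * R1)) with (/ 4) in Lu2 by (field; lra). exact Lu2. }
  assert (HT : R2 * Cmod (t - gamma 0) < 1).
  { apply Rmult_lt_compat_l with (1 := PR2) in D3.
    replace (R2 * / (2 * R2)) with (/ 2) in D3 by (field; lra). lra. }
  assert (Mv : forall j, Cmod (tj t j) = Cmod (h t)).
  { intros j. unfold tj. change eps with (root_of_unity n).
    rewrite root_of_unity_pow, Cmod_mult, Cmod_rotation by exact n_pos. ring. }
  split; [intros j _; apply HL; rewrite Mv; exact Lu1|].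
  unfold cauchy_integral. rewrite EI.
  replace (n - 1)%nat with m by (unfold n; lia).
  assert (Ereg : Cpseries reg (t - gamma 0)%C =
    (/ two_pi_i * (Cpseries k (t - gamma 0) + sum_n (fun j => Cpseries fr (tj t j)) m))%C).
  { unfold reg. rewrite (Cpseries_mult_l _ _ _ _ _ (geometric_bound_plus _ _ _ _ _ Gk2 Gav2) HT).
    rewrite (Cpseries_plus _ _ _ _ _ _ Gk2 Gav2 HT). f_equal. f_equal.
    rewrite (Cpseries_mult_l _ _ _ ((2 * R1) ^ n) _ (geometric_bound_multiples _ _ _ n Gfr)).
    - rewrite <- Un. symmetry. apply (Cpseries_average fr _ (2 * R1) m (h t) Gfr). lra.
    - eapply Rle_lt_trans; [|exact HT].
      apply Rmult_le_compat_r; [apply Cmod_ge_0 | apply Rmax_r]. }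
  assert (Egr : gr t = (/ RtoC (INR n) * sum_n (fun j => gt (tj t j)) m)%C).
  { unfold gt, tj. change eps with (root_of_unity (S m)).
    rewrite (Cpseries_average a _ R1 m (h t) Ga') by lra.
    fold n. rewrite Un. unfold gr. field. exact Nn. }
  rewrite Ereg, Egr.
  assert (NP := two_pi_i_neq_0).
  set (X := Cpseries k (t - gamma 0)%C). set (La := Log (t - gamma 0)%C).
  assert (Sum : sum_n (fun j => let v := (root_of_unity n ^ j * h t)%C in
      Cpseries f v - Cpseries a v * (/ RtoC (INR n) * (La + RtoC (2 * PI * INR j) * Ci)))%C m
    = (sum_n (fun j => Cpseries fr (tj t j)) m
       - two_pi_i * sum_n (fun j => RtoC (INR j / INR n - 1 / 2) * gt (tj t j)) m
       + sum_n (fun j => gt (tj t j) * Log1 (c - tj t j)) m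
       - / RtoC (INR n) * La * sum_n (fun j => gt (tj t j)) m)%C).
  { rewrite <- !sum_n_C_mult_l, <- sum_n_C_minus, <- sum_n_C_plus, <- sum_n_C_minus.
    apply sum_n_ext. intros j. cbv zeta.
    change (root_of_unity n ^ j * h t)%C with (tj t j).
    rewrite Efr by (rewrite Mv; lra).
    rewrite (proj2 (HL (tj t j) ltac:(rewrite Mv; exact Lu1))).
    unfold gt, w, two_pi_i.
    rewrite RtoC_minus, !RtoC_div, !RtoC_mult by (try apply not_0_INR; lia || lra).
    Cfield. exact Nn. }
  cbv zeta in Sum. rewrite Sum.
  set (s1 := sum_n _ m). set (s2 := sum_n _ m). set (s3 := sum_n _ m). set (s4 := sum_n _ m).
  change C in (type of s1), (type of s2), (type of s3), (type of s4).
  field. split; assumption.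
Qed.
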